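(* Let $\sigma\in L_2[0,1]$ be complex-valued and $d>0$. Let $y=y(x,\mu)$ be the solution of \[ (y^{[1]})'(x)-\sigma(x)y^{[1]}(x)+\sigma^2(x)y(x)+\mu^2y(x)=0,\quad x\in[0,1],\qquad y(0,\mu)=0,\quad y^{[1]}(0,\mu)=1 . \] Then for $\mu\in\Omega_d(\sigma)$ we have \begin{align*} \mu y(x,\mu)&=\sin(\mu x)+\sin(\mu x)\int_0^x\cos(2\mu t)\sigma(t)dt-\cos(\mu x)\int_0^x\sin(2\mu t)\sigma(t)dt\\ &+2\cos(\mu x)\int_0^x\int_0^t\sigma(s)\sigma(t)\cos(2\mu t)\sin(2\mu s)\,ds\,dt\\ &-\frac{1}{2\mu}\cos(\mu x)\int_0^x\cos(2\mu t)\sigma^2(t)dt-\frac{1}{2\mu}\sin(\mu x)\int_0^x\sin(2\mu t)\sigma^2(t)dt\\ &+\frac{1}{2\mu}\cos(\mu x)\int_0^x\sigma^2(t)dt+\int_0^x\sin(\mu(x-2t))N_\sigma(x,t)dt\\ &-\cos(\mu x)\int_0^x\sigma(t)\sin(2\mu t)dt\int_0^x\sigma(s)\cos(2\mu s)ds\\ &+\frac12\sin(\mu x)\Big(\Big(\int_0^x\cos(2\mu t)\sigma(t)dt\Big)^2+\Big(\int_0^x\sin(2\mu t)\sigma(t)dt\Big)^2\Big)\\ &-\frac{1}{2\mu}\int_0^x\sigma^2(t)dt\int_0^x\cos(\mu(x-2s))\sigma(s)ds\\ &+\frac{1}{2\mu}\cos(\mu x)\int_0^x\int_0^x\cos(2\mu(t-s))\sigma^2(t)\sigma(s)\,dt\,ds\\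 &-\frac{1}{2\mu}\sin(\mu x)\int_0^x\int_0^x\sin(2\mu(t-s))\sigma^2(t)\sigma(s)\,dt\,ds+\phi_1(x,\mu), \end{align*} \begin{align*} y^{[1]}(x,\mu)&=\cos(\mu x)+\cos(\mu x)\int_0^x\cos(2\mu t)\sigma(t)dt+\sin(\mu x)\int_0^x\sin(2\mu t)\sigma(t)dt\\ &-2\sin(\mu x)\int_0^x\int_0^t\sigma(s)\sigma(t)\cos(2\mu t)\sin(2\mu s)\,ds\,dt\\ &+\frac{1}{2\mu}\sin(\mu x)\int_0^x\cos(2\mu t)\sigma^2(t)dt-\frac{1}{2\mu}\cos(\mu x)\int_0^x\sin(2\mu t)\sigma^2(t)dt\\ &-\frac{1}{2\mu}\sin(\mu x)\int_0^x\sigma^2(t)dt+\int_0^x\cos(\mu(x-2t))N_\sigma(x,t)dt\\ &+\sin(\mu x)\int_0^x\sigma(t)\sin(2\mu t)dt\int_0^x\sigma(s)\cos(2\mu s)ds\\ &+\frac12\cos(\mu x)\Big(\Big(\int_0^x\cos(2\mu t)\sigma(t)dt\Big)^2+\Big(\int_0^x\sin(2\mu t)\sigma(t)dt\Big)^2\Big)\\ &+\frac{1}{2\mu}\int_0^x\sigma^2(t)dt\int_0^x\sin(\mu(x-2s))\sigma(s)ds\\ &-\frac{1}{2\mu}\sin(\mu x)\int_0^x\int_0^x\cos(2\mu(t-s))\sigma^2(t)\sigma(s)\,dt\,ds\\ &-\frac{1}{2\mu}\cos(\mu x)\int_0^x\int_0^x\sin(2\mu(t-s))\sigma^2(t)\sigma(s)\,dt\,ds+\phi_2(x,\mu),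 \end{align*} where \[ \|\phi_j(x,\mu)\|_{C[0,1]}\le C\rho(\mu),\qquad j=1,2, \] with the sup-norm taken in $x\in[0,1]$ and a constant $C>0$ depending only on $d$ and $\|\sigma\|_{L_2}$.
   Context: $P_d:=\{\mu\in\mathbb{C}:|\mathrm{Im}\,\mu|\le d\}$; $L_p=L_p[0,1]$; and \[ \Omega_d(\sigma):=\{\mu\in P_d:\ |\mu|>2be^{2d}\},\qquad b=\|\sigma\|_{L_2}^2\Big(1+\|\sigma\|_{L_1}+e^{\|\sigma\|_{L_1}}\|\sigma\|_{L_2}^2\Big)^2 . \] The quasi-derivative is $y^{[1]}(x):=y'(x)+\sigma(x)y(x)$; a solution $y$ is a function such that both $y$ and $y^{[1]}$ are absolutely continuous on $[0,1]$ and the equation holds a.e. For $0\le t\le x\le1$, \[ \tilde\sigma(x,t)=\int_0^{x-t}\sigma(t+\xi)\sigma(\xi)\,d\xi,\qquad N_\sigma(x,t)=\int_0^{x-t}\sigma(t+\xi)\tilde\sigma(t+\xi,\xi)\,d\xi . \] The function $\rho$ is \[ \rho(\mu)=\gamma^2(\mu)+\gamma_1(\mu)+|\mu|^{-1}k_{\sigma^2}(\mu)+|\mu|^{-2}, \] where \[ \gamma(\mu)=2\Big(\Big\|\int_0^xe^{-2i\mu t}\sigma(t)dt\Big\|_{L_2}+\Big\|\int_0^xe^{2i\mu t}\sigma(t)dt\Big\|_{L_2}\Big) \] ($L_2$-norms in $x\in[0,1]$), \[ \gamma_0(x,\mu)=2\Big(\Big|\int_0^xe^{-2i\mu t}\sigma(t)dt\Big|+\Big|\int_0^xe^{2i\mu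 t}\sigma(t)dt\Big|\Big), \] \[ \gamma_1(\mu)=2\int_0^1|\sigma(s)|\gamma_0^2(s,\mu)\,ds,\qquad k_{\sigma^2}(\mu)=\int_0^1|\sigma(t)|^2\gamma_0(t,\mu)\,dt. \] *)

(* Defs.v *)
From mathcomp Require Import all_boot all_order all_algebra.
From mathcomp Require Import all_classical all_reals all_analysis.
From mathcomp Require Export complex.

Set Implicit Arguments.
Unset Strict Implicit.
Unset Printing Implicit Defensive.

Import Order.TTheory GRing.Theory Num.Theory.
Import numFieldNormedType.Exports.

Local Open Scope classical_set_scope.
Local Open Scope ring_scope.

Reserved Notation "\cint_ ( a <= t <= b ) F"
  (at level 36, F at level 36, a, t, b at level 50,
   format "'[' \cint_ ( a  <=  t  <=  b ) '/  '  F ']'").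

Section Defs.
Context {R : realType}.
Implicit Types (f sigma y phi : R -> R[i]) (mu z : R[i]) (a b x t d : R).

(** Complex modulus with values in [R]; the library's [`|z|] lives in [R[i]]. *)
Definition cmod z : R := ComplexField.Normc.normc z.

Definition cexp z : R[i] :=
  Complex (expR (complex.Re z) * cos (complex.Im z))
          (expR (complex.Re z) * sin (complex.Im z)).

Definition iu : R[i] := Complex 0 1.
Definition ccos z : R[i] := (cexp (iu * z) + cexp (- (iu * z))) / 2.
Definition csin z : R[i] := (cexp (iu * z) - cexp (- (iu * z))) / (2 * iu).

Definition cint a b f : R[i] :=
  Complex (\int[lebesgue_measure]_(t in `[a, b]) complex.Re (f t))
          (\int[lebesgue_measure]_(t in `[a, b]) complex.Im (f t)).

Local Notation "\cint_ ( a <= t <= b ) F" := (cint a b (fun t => F)).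

(** Functions on [0,1] are represented by functions on [R] whose values outside
    [0,1] are irrelevant. *)
Definition Lp01_norm (p : R) f : \bar R :=
  'N[lebesgue_measure]_p%:E[EFin \o ((cmod \o f) \_ `[0, 1])].

Definition L2_01 f : Prop :=
  [/\ measurable_fun `[0 : R, 1] (fun x => complex.Re (f x)),
      measurable_fun `[0 : R, 1] (fun x => complex.Im (f x)) &
      (Lp01_norm 2 f < +oo)%E].

Definition L1norm f : R := fine (Lp01_norm 1 f).
Definition L2norm f : R := fine (Lp01_norm 2 f).

Definition continuous01 f : Prop :=
  {within `[0 : R, 1], continuous (fun x => complex.Re (f x))} /\
  {within `[0 : R, 1], continuous (fun x => complex.Im (f x))}.

Definition C01_norm f : \bar R :=
  ereal_sup [set (cmod (f x))%:E | x in `[0, 1]].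

Definition abs_continuous01 f : Prop :=
  forall e : R, 0 < e -> exists2 delta : R, 0 < delta &
    forall (n : nat) (a b : 'I_n -> R),
      (forall i, 0 <= a i /\ a i <= b i /\ b i <= 1) ->
      trivIset setT (fun i => [set` `]a i, b i[]) ->
      \sum_(i < n) (b i - a i) < delta ->
      \sum_(i < n) cmod (f (b i) - f (a i)) < e.

Definition has_cderivative f x (l : R[i]) : Prop :=
  is_derive x 1 (fun t => complex.Re (f t)) (complex.Re l) /\
  is_derive x 1 (fun t => complex.Im (f t)) (complex.Im l).

(** [y1] is the quasi-derivative y' + sigma y, which is determined only almost
    everywhere; [is_solution] selects its absolutely continuous version. *)
Definition is_quasi_derivative sigma y y1 : Prop :=
  {ae lebesgue_measure, forall x, x \in `[0, 1] ->
    exists2 y', has_cderivative y x y' & y1 x = y' + sigma x * y x}.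

Definition is_solution sigma mu y y1 : Prop :=
  [/\ abs_continuous01 y, abs_continuous01 y1, is_quasi_derivative sigma y y1 &
  {ae lebesgue_measure, forall x, x \in `[0, 1] ->
    exists2 dy1, has_cderivative y1 x dy1 &
      dy1 - sigma x * y1 x + sigma x ^+ 2 * y x + mu ^+ 2 * y x = 0}].

Definition strip d : set (R[i]) := [set mu | `|complex.Im mu| <= d].

Definition bconst sigma : R :=
  L2norm sigma ^+ 2 *
  (1 + L1norm sigma + expR (L1norm sigma) * L2norm sigma ^+ 2) ^+ 2.

Definition Omega d sigma : set (R[i]) :=
  strip d `&` [set mu | 2 * bconst sigma * expR (2 * d) < cmod mu].

Definition sigma_tilde sigma x t : R[i] :=
  \cint_(0 <= xi <= x - t) (sigma (t + xi) * sigma xi).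

Definition Nker sigma x t : R[i] :=
  \cint_(0 <= xi <= x - t) (sigma (t + xi) * sigma_tilde sigma (t + xi) xi).

Definition fourier_m sigma mu x : R[i] :=
  \cint_(0 <= t <= x) (cexp (- (2 * iu * mu * t%:C%C)) * sigma t).
Definition fourier_p sigma mu x : R[i] :=
  \cint_(0 <= t <= x) (cexp (2 * iu * mu * t%:C%C) * sigma t).

Definition gam sigma mu : R :=
  2 * (L2norm (fourier_m sigma mu) + L2norm (fourier_p sigma mu)).

Definition gam0 sigma x mu : R :=
  2 * (cmod (fourier_m sigma mu x) + cmod (fourier_p sigma mu x)).

Definition gam1 sigma mu : R :=
  2 * \int[lebesgue_measure]_(s in `[0, 1])
        (cmod (sigma s) * gam0 sigma s mu ^+ 2).

Definition ksq sigma mu : R :=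
  \int[lebesgue_measure]_(t in `[0, 1])
    (cmod (sigma t) ^+ 2 * gam0 sigma t mu).

Definition rho sigma mu : R :=
  gam sigma mu ^+ 2 + gam1 sigma mu + (cmod mu)^-1 * ksq sigma mu
  + (cmod mu) ^- 2.

End Defs.

Notation "\cint_ ( a <= t <= b ) F" := (cint a b (fun t => F)) : ring_scope.

(* Main.v *)
Require Import Defs.
From HB Require Import structures.
From mathcomp Require Import all_boot all_order all_algebra.
From mathcomp Require Import all_classical all_reals all_analysis.
From mathcomp Require Import measurable_realfun ring lra.

Import Order.TTheory GRing.Theory Num.Theory.
Import numFieldNormedType.Exports.

Set Implicit Arguments.
Unset Strict Implicit.
Unset Printing Implicit Defensive.

Local Open Scope classical_set_scope.
Local Open Scope ring_scope.

(** Put ep = exp(i mu x) and em = exp(- i mu x), and let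
      wp = em (y1 + i mu y),    wm = ep (y1 - i mu y)
    be the amplitudes of the solution. With eps = 1 / (2 i mu) they satisfy
      wp' = a wm - eps (c wp - a2 wm),    wm' = b wp + eps (c wm - b2 wp),
    where a = em^2 sigma, b = ep^2 sigma, c = sigma^2, a2 = em^2 sigma^2 and
    b2 = ep^2 sigma^2, and both are 1 at 0 ([solution_wp], [solution_wm]).
    Conversely mu y = (ep wp - em wm) / (2 i) and y1 = (ep wp + em wm) / 2.
    Write A and B for the primitives of a and b vanishing at 0: they are the
    two Fourier integrals of sigma from which gam0, gam, gam1 and ksq are built.

    Keep, in the Picard series of wp, the terms without eps of degree at most
    three in (a, b) and, at order eps, the integral of c - a2 and the
    iterated integral of (a, c - b2); similarly for wm. The result [picard] solves the system
    up to a residual whose primitive is O(rho) ([resid_le]). The dangerous term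
    is the primitive of a * (int b * (int a * B)). Let J be the integral of
    |sigma| (|A| + |B|). Two integrations by parts bound the term, up to
    constants, by J^2 plus the integral of |sigma| (|A| + |B|)^2. Since
    J <= ||sigma|| (||A|| + ||B||) by the Cauchy-Schwarz inequality, J^2 is
    controlled by gam^2, and the other summand is controlled by gam1. The terms
    with one eps are controlled in the same way by ksq / |mu| and by |eps| J,
    where 2 |eps| J <= |eps|^2 + J^2, and those with eps^2 by |mu|^-2.
    Gronwall's lemma turns this into a bound on the difference between the amplitudes and
    [picard] ([system_picard]). The condition defining Omega gives
    |eps| exp(2d) ||sigma||^2 <= 1/2, so that the Gronwall factor depends on d
    and ||sigma|| only. A last integration by parts, which costs
    a multiple of |eps| ksq, replaces [picard] by [main_p] and [main_m].

    The explicit terms of the two formulas are the combinations of [main_p] and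
    [main_m] by ep and em: after the sines and cosines have been expanded, each
    integral is a polynomial in A, B, the integrals of c, a2, b2, the twofold
    integral of (a, b), and the threefold integrals of (a, b, a) and (b, a, b),
    and the formulas become polynomial identities modulo i^2 = -1. The
    terms in N_sigma are the threefold integrals: by Fubini's theorem and the
    substitution t = alpha + u - beta,
      int_0^x e^(k t) N_sigma(x, t) dt
        = int_0^x e^(k alpha) sigma(alpha) int_0^alpha e^(- k beta) sigma(beta)
            int_0^beta e^(k u) sigma(u) du dbeta dalpha  ([cI_Nker]).

    Two facts of real analysis support the calculus used throughout. An
    absolutely continuous function whose derivative vanishes almost everywhere
    is constant ([ac01_derive0_cst]); with the Lebesgue differentiation theorem
    it follows that an absolutely continuous function is the integral of its
    almost everywhere derivative, if the latter is integrable ([ac_prim]). In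
    particular such primitives can be multiplied and composed with smooth
    functions ([primM], [prim_comp]), which is integration by parts. *)

(** * Absolute continuity on the unit interval *)

Section AbsoluteContinuity.
Context {R : realType}.
Notation mu := (@lebesgue_measure R).
Implicit Types (F G : R -> R).

(** Absolute continuity of a real function on [0,1]. *)
Definition ac01 F : Prop :=
  forall e : R, 0 < e -> exists2 delta : R, 0 < delta &
    forall (n : nat) (a b : 'I_n -> R),
      (forall i, 0 <= a i /\ a i <= b i /\ b i <= 1) ->
      trivIset setT (fun i => [set` `]a i, b i[]) ->
      \sum_(i < n) (b i - a i) < delta ->
      \sum_(i < n) `|F (b i) - F (a i)| < e.

Lemma sum_length_le (U : set R) n (a b : 'I_n -> R) :
  measurable U -> (forall i, a i <= b i) ->
  trivIset setT (fun i => [set` `]a i, b i[]) ->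
  (forall i, [set` `]a i, b i[] `<=` U) ->
  ((\sum_(i < n) (b i - a i))%:E <= mu U)%E.
Proof.
move=> mU ab tab abU.
rewrite -sumEFin.
have -> : (\sum_(i < n) (b i - a i)%:E)%E = (\sum_(i < n) mu [set` `]a i, b i[])%E.
  apply: eq_bigr => i _; rewrite lebesgue_measure_itv /= lte_fin.
  by case: ltP => // h; have /eqP -> : b i - a i == 0 by rewrite subr_eq0 eq_le h ab.
rewrite -measure_bigsetU_ord//.
apply: le_measure; rewrite ?inE//.
  by apply: bigsetU_measurable => i _.
apply: (big_ind (fun A : set R => A `<=` U)) => [//|A B AU BU|//].
by rewrite subUset.
Qed.

Lemma is_derive0_small F (x e : R) : is_derive x 1 F 0 -> 0 < e ->
  exists2 r : R, 0 < r & forall t : R, `|t - x| < r -> `|F t - F x| <= e * `|t - x|.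
Proof.
move=> [dF F'0] e0; rewrite /derivable /derive in dF F'0; have {}dF := dF.
have : (h^-1 *: ((F \o shift x) (h *: 1) - F x)) @[h --> 0^'] --> (0 : R).
  by move: dF; rewrite F'0.
move=> /cvgrPdist_le /(_ _ e0).
rewrite /dnbhs /within /= => /nbhs_ballP [r /= r0 H].
exists r => // t tx.
have [->|tNx] := eqVneq t x; first by rewrite !subrr !normr0 mulr0.
have tx0 : t - x != 0 by rewrite subr_eq0.
have := H (t - x); rewrite /ball /= sub0r normrN => /(_ tx tx0).
rewrite /shift /= sub0r normrN /GRing.scale /= mulr1 subrK normrM normfV.
by rewrite ler_pdivrMl ?normr_gt0// mulrC.
Qed.

(** Adding an interval on the right of a finite disjoint family. The families
    are indexed by ordinals, so the new interval takes the index [ord0]. *)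
Lemma trivIset_consitv n (a b : 'I_n -> R) (u v : R) :
  (forall i, b i <= u) ->
  trivIset setT (fun i => [set` `]a i, b i[]) ->
  trivIset setT (fun i : 'I_n.+1 =>
    [set` `](if unlift ord0 i is Some j then a j else u),
            (if unlift ord0 i is Some j then b j else v)[]).
Proof.
move=> bu tab i j _ _.
case: unliftP => [i'|] ->; case: unliftP => [j'|] -> //=.
- by move=> h; congr lift; apply: tab.
- move=> [z [/=]]; rewrite !in_itv/= => /andP[_ zb] /andP[uz _].
  by have := lt_trans uz (lt_le_trans zb (bu _)); rewrite ltxx.
- move=> [z [/=]]; rewrite !in_itv/= => /andP[uz _] /andP[_ zb].
  by have := lt_trans uz (lt_le_trans zb (bu _)); rewrite ltxx.
Qed.

Lemma sum_consitv n (f : R -> R -> R) (a b : 'I_n -> R) (u v : R) :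
  \sum_(i < n.+1) f (if unlift ord0 i is Some j then a j else u)
            (if unlift ord0 i is Some j then b j else v)
  = f u v + \sum_(i < n) f (a i) (b i).
Proof.
rewrite big_ord_recl unlift_none; congr (_ + _).
by apply: eq_bigr => i _; rewrite liftK.
Qed.

(** Given e > 0, cover the exceptional null set by an open set [U] whose measure
    is below the delta of absolute continuity for e/2. The set [S] of the points
    x for which |F x - F 0| is at most (e/2) x plus the variation of [F] over
    finitely many disjoint intervals inside [U] can be extended beyond its
    supremum: through an interval of [U] if the supremum is in [U], and by the
    vanishing derivative otherwise. Hence it contains [c]. *)
Theorem ac01_derive0_cst F : ac01 F ->
  {ae mu, forall x : R, x \in `[0, 1] -> is_derive x 1 F 0} ->
  forall x, x \in `[0, 1] -> F x = F 0.
Proof.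
move=> acF [N [mN N0 badN]] c; rewrite in_itv/= => /andP[c0 c1].
suff H e : 0 < e -> `|F c - F 0| <= e.
  apply/eqP; rewrite -subr_eq0 -normr_le0; apply/ler_addgt0Pr => e e0.
  by rewrite add0r; exact: H.
move=> e0; have e20 : 0 < e / 2 by rewrite divr_gt0.
have [delta d0 acd] := acF _ e20.
have [|U [oU NU UN]] := lebesgue_regularity_outer mN _ d0.
  by rewrite [X in (X < _)%E]N0.
have mUU : measurable U by exact: open_measurable.
have muU : (mu U < delta%:E)%E.
  have -> : U = N `|` (U `\` N) by rewrite setDUK.
  rewrite measureU//; last 2 first.
  - exact: measurableD.
  - by apply/seteqP; split => // z [? []].
  by rewrite [X in (X + _)%E]N0 add0e.
pose S := [set x | 0 <= x <= c /\ exists n, exists a b : 'I_n -> R,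
  [/\ forall i, [/\ 0 <= a i, a i <= b i & b i <= x],
      trivIset setT (fun i => [set` `]a i, b i[]),
      forall i, [set` `]a i, b i[] `<=` U &
      `|F x - F 0| <= e / 2 * x + \sum_(i < n) `|F (b i) - F (a i)| ]].
have S0 : S 0.
  split; first by rewrite lexx.
  exists 0%N, (fun=> 0), (fun=> 0); split => //; try by move=> [].
  by rewrite big_ord0 subrr normr0 mulr0 addr0.
have ubS : ubound S c by move=> x [/andP[]].
have supS : has_sup S by split; [exists 0|exists c].
have sS x : S x -> x <= sup S by move=> Sx; apply: (sup_upper_bound supS).
have s0 : 0 <= sup S by exact: sS.
have sc : sup S <= c by apply: ge_sup => //; exists 0.
(* Points of [S] just below the supremum propagate just above it. *)
have [r r0 ext] : exists2 r, 0 < r & forall u v, S u -> u <= sup S ->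
    sup S - r < u -> sup S <= v -> v <= c -> v < sup S + r -> S v.
  have [Us|NUs] := pselect (U (sup S)).
    move: oU => /(_ _ Us) /nbhs_ballP[r /= r0 rU].
    exists r => // u v [/andP[u0 _] [n [a [b [ab tab abU Fu]]]]] us ru sv vc vr.
    split; first by rewrite vc (le_trans s0 sv).
    exists n.+1, (fun i => if unlift ord0 i is Some j then a j else u),
                 (fun i => if unlift ord0 i is Some j then b j else v).
    split => //.
    - move=> i; case: unliftP => [j|] _; last by split=> //; lra.
      by have [? ? ?] := ab j; split => //; lra.
    - by apply: trivIset_consitv => // i; have [] := ab i.
    - move=> i; case: unliftP => [j|] _; first exact: abU.
      move=> z /=; rewrite in_itv/= => /andP[uz zv]; apply: rU.
      by rewrite /ball/= ltr_distlC; apply/andP; split; lra.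
    - rewrite (sum_consitv (fun x y => `|F y - F x|)).
      have -> : F v - F 0 = (F v - F u) + (F u - F 0) by ring.
      have := ler_normD (F v - F u) (F u - F 0).
      have : e / 2 * u <= e / 2 * v by rewrite ler_pM2l//; lra.
      lra.
  have [|dF] := pselect (is_derive (sup S) 1 F 0); last first.
    exfalso; apply: NUs; apply: NU; apply: badN => /= h; apply: dF; apply: h.
    by rewrite in_itv/= s0 (le_trans sc).
  move=> /is_derive0_small /(_ e20)[r r0 Fr].
  exists r => // u v [/andP[u0 _] [n [a [b [ab tab abU Fu]]]]] us ru sv vc vr.
  split; first by rewrite vc (le_trans s0 sv).
  exists n, a, b; split => //.
    by move=> i; have [? ? ?] := ab i; split => //; lra.
  have := Fr u; rewrite ler0_norm; last lra.
  have := Fr v; rewrite ger0_norm; last lra.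
  move=> /(_ ltac:(lra)) Fv /(_ ltac:(lra)); rewrite distrC => Fu'.
  have -> : F v - F 0 = (F v - F (sup S)) + (F (sup S) - F u) + (F u - F 0) by ring.
  have := ler_normD (F v - F (sup S) + (F (sup S) - F u)) (F u - F 0).
  have := ler_normD (F v - F (sup S)) (F (sup S) - F u).
  have -> : e / 2 * v = e / 2 * (v - sup S) + e / 2 * - (u - sup S) + e / 2 * u by ring.
  lra.
have [u Su ru] := sup_adherent r0 supS.
have Sc : S c.
  have [cr|rc] := ltP c (sup S + r / 2).
    by apply: (ext u) => //; [exact: sS|lra].
  have : S (sup S + r / 2) by apply: (ext u) => //; [exact: sS|lra..].
  by move=> /sS; lra.
case: Sc => _ [n [a [b [ab tab abU Fc]]]].
have := acd n a b.
have abc i : 0 <= a i /\ a i <= b i /\ b i <= 1.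
  by have [? ? ?] := ab i; split => //; split => //; lra.
move=> /(_ abc tab).
have : \sum_(i < n) (b i - a i) < delta.
  rewrite -lte_fin; apply: le_lt_trans muU; apply: sum_length_le => // i.
  by have [] := abc i => _ [].
move=> h /(_ h) h2.
have : e / 2 * c <= e / 2 * 1 by rewrite ler_pM2l.
lra.
Qed.

End AbsoluteContinuity.

(** * Integrals as functions of the upper limit *)

(** The integral of [f] from 0 to [x]. It is locked, so that rewriting never
    looks inside the underlying Lebesgue integral. *)
HB.lock Definition rint {R : realType} (x : R) (f : R -> R) : R :=
  \int[@lebesgue_measure R]_(t in `[0, x]) f t.

Local Notation "\I_ ( x ) f" := (rint x f) (at level 36, x at level 50, f at level 36).

Section Primitives.
Context {R : realType}.
Notation mu := (@lebesgue_measure R).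
Implicit Types (F G f g : R -> R).

(** Integrability of a real function over [0,1]. *)
Definition int01 f := mu.-integrable `[0, 1] (EFin \o f).

(** Absolute continuity passes to functions whose increments are dominated by
    those of two absolutely continuous functions. *)
Lemma ac01_lipschitz2 K F G H : 
  (forall u v, 0 <= u -> u <= v -> v <= 1 ->
     `|H v - H u| <= K * (`|F v - F u| + `|G v - G u|)) ->
  ac01 F -> ac01 G -> ac01 H.
Proof.
move=> HK acF acG e e0.
pose K' := `|K| + 1.
have K'0 : 0 < K' by rewrite /K' ltr_wpDl.
have eK0 : 0 < e / K' / 2 by rewrite !divr_gt0.
have [d1 d10 H1] := acF _ eK0.
have [d2 d20 H2] := acG _ eK0.
exists (Num.min d1 d2); first by rewrite lt_min d10 d20.
move=> n a b ab tab; rewrite lt_min => /andP[s1 s2].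
apply: (@le_lt_trans _ _ (K' * (\sum_(i < n) `|F (b i) - F (a i)| + \sum_(i < n) `|G (b i) - G (a i)|))).
  rewrite -big_split/= mulr_sumr; apply: ler_sum => i _.
  have [a0 [ab' b1]] := ab i.
  apply: le_trans (HK _ _ a0 ab' b1) _.
  apply: ler_wpM2r; first by rewrite addr_ge0.
  by rewrite /K' (le_trans (ler_norm K))// lerDl.
rewrite -ltr_pdivlMl//.
have := H1 _ _ _ ab tab s1.
have := H2 _ _ _ ab tab s2.
have -> : K'^-1 * e = e / K' / 2 + e / K' / 2 by field; rewrite gt_eqF.
by move=> ? ?; rewrite ltrD.
Qed.

Lemma ac01_unif F : ac01 F -> forall e, 0 < e -> exists2 d : R, 0 < d &
  forall u v, 0 <= u <= 1 -> 0 <= v <= 1 -> `|v - u| < d -> `|F v - F u| < e.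
Proof.
move=> acF e e0; have [d d0 H] := acF _ e0; exists d => //.
suff K u v : 0 <= u -> u <= v -> v <= 1 -> v - u < d -> `|F v - F u| < e.
  move=> u v /andP[u0 u1] /andP[v0 v1].
  have [uv|vu] := leP u v; first by rewrite ger0_norm ?subr_ge0//; exact: K.
  by rewrite distrC ger0_norm ?subr_ge0 ?(ltW vu)// distrC; apply: K; rewrite // ltW.
move=> u0 uv v1 uvd.
have := H 1%N (fun=> u) (fun=> v); rewrite !big_ord1; apply=> //.
by move=> i j _ _ _; rewrite (ord1 i) (ord1 j).
Qed.

Lemma ac01_continuous F : ac01 F -> {within `[0, 1], continuous F}.
Proof.
move=> acF; apply/subspace_continuousP => x /=; rewrite in_itv/= => x01.
apply/cvgrPdist_lt => e e0; have [d d0 H] := ac01_unif acF e0.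
rewrite near_withinE; apply/nbhs_ballP; exists d => //= y.
rewrite /ball/= in_itv/= => xy y01; rewrite distrC; apply: H => //.
by rewrite distrC.
Qed.

Lemma cont01_bounded F : {within `[0, 1], continuous F} ->
  exists2 M, 0 <= M & forall x, x \in `[0, 1] -> `|F x| <= M.
Proof.
move=> cF.
have [c _ Mc] := EVT_max (ler01 : 0 <= 1 :> R) cF.
have [c' _ mc'] := EVT_min (ler01 : 0 <= 1 :> R) cF.
exists (`|F c| + `|F c'|); first by rewrite addr_ge0.
move=> x x01; rewrite ler_norml; apply/andP; split.
  apply: le_trans (mc' _ x01); rewrite lerNl.
  by apply: le_trans (ler_norm _) _; rewrite normrN lerDr.
by apply: le_trans (Mc _ x01) _; apply: le_trans (ler_norm _) _; rewrite lerDl.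
Qed.

Lemma cont01_measurable F : {within `[0, 1], continuous F} ->
  measurable_fun `[0 : R, 1] F.
Proof. by move=> cF; apply: subspace_continuous_measurable_fun. Qed.

Lemma cont01_bounded_near F : {within `[0, 1], continuous F} ->
  [bounded F x | x in `[0 : R, 1]].
Proof.
move=> /cont01_bounded[M M0 HM]; exists M; split; rewrite ?num_real// => y My x x01.
by apply: le_trans (ltW My); apply: HM.
Qed.

Lemma int01_cont F : {within `[0, 1], continuous F} -> int01 F.
Proof. by move=> cF; apply: continuous_compact_integrable => //; exact: segment_compact. Qed.

Lemma int01M F g : {within `[0, 1], continuous F} -> int01 g ->
  int01 (fun x => F x * g x).
Proof.
move=> cF ig; rewrite /int01.
have -> : EFin \o (fun x => F x * g x) = ((EFin \o F) \* (EFin \o g))%E.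
  by apply/funext => x /=; rewrite EFinM.
by apply: integrableMr => //; [exact: cont01_measurable|exact: cont01_bounded_near].
Qed.

Lemma int01D f g : int01 f -> int01 g -> int01 (fun x => f x + g x).
Proof.
by move=> ff ig; apply: eq_integrable (integrableD _ ff ig).
Qed.

Lemma int01N f : int01 f -> int01 (fun x => - f x).
Proof.
by move=> ff; apply: eq_integrable (integrableN ff).
Qed.

Lemma int01B f g : int01 f -> int01 g -> int01 (fun x => f x - g x).
Proof. by move=> ff ig; apply: int01D => //; apply: int01N. Qed.

Lemma int01Z k f : int01 f -> int01 (fun x => k * f x).
Proof.
by move=> ff; apply: eq_integrable (integrableZl _ k ff).
Qed.

Lemma eq_int01 f g : (forall x, x \in `[0, 1] -> f x = g x) -> int01 f -> int01 g.
Proof.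
move=> fg; apply: eq_integrable => // x; rewrite inE/= => xi.
by rewrite fg.
Qed.

Lemma int01_norm f : int01 f -> int01 (fun x => `|f x|).
Proof. by move=> ff; apply: eq_integrable (integrable_abse ff). Qed.

Lemma int01_le f g : measurable_fun `[0 : R, 1] f -> int01 g ->
  (forall x, x \in `[0, 1] -> `|f x| <= g x) -> int01 f.
Proof.
move=> mf ig fg; apply: le_integrable ig => //; first exact/measurable_EFinP.
move=> x x01 /=; rewrite lee_fin.
by apply: le_trans (fg _ x01) _; exact: ler_norm.
Qed.

Lemma int01_measurable f : int01 f -> measurable_fun `[0 : R, 1] f.
Proof. by move=> /measurable_int/measurable_EFinP. Qed.

Lemma int01_sub f x : x \in `[0, 1] -> int01 f -> mu.-integrable `[0, x] (EFin \o f).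
Proof.
rewrite in_itv/= => /andP[x0 x1]; apply: integrableS => //.
by apply: subset_itvl; rewrite bnd_simp.
Qed.

Lemma rint0 f : \I_(0) f = 0.
Proof. by rewrite rint.unlock set_itv1 Rintegral_set1. Qed.

Lemma eq_rint f g x : x \in `[0, 1] -> (forall t, t \in `[0, 1] -> f t = g t) -> \I_(x) f = \I_(x) g.
Proof.
rewrite rint.unlock in_itv/= => /andP[x0 x1] fg; apply: eq_Rintegral => t; rewrite inE/= in_itv/= => /andP[t0 tx].
by apply: fg; rewrite in_itv/= t0 (le_trans tx).
Qed.

Lemma rintD f g x : x \in `[0, 1] -> int01 f -> int01 g ->
  \I_(x) (fun t => f t + g t) = \I_(x) f + \I_(x) g.
Proof. by move=> x01 ff ig; rewrite rint.unlock RintegralD//; exact: int01_sub. Qed.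

Lemma rintB f g x : x \in `[0, 1] -> int01 f -> int01 g ->
  \I_(x) (fun t => f t - g t) = \I_(x) f - \I_(x) g.
Proof. by move=> x01 ff ig; rewrite rint.unlock RintegralB//; exact: int01_sub. Qed.

Lemma rintZ k f x : x \in `[0, 1] -> int01 f -> \I_(x) (fun t => k * f t) = k * \I_(x) f.
Proof. by move=> x01 ff; rewrite rint.unlock RintegralZl//; exact: int01_sub. Qed.

Lemma le_rint f g x : x \in `[0, 1] -> int01 f -> int01 g ->
  (forall t, t \in `[0, 1] -> f t <= g t) -> \I_(x) f <= \I_(x) g.
Proof.
move=> x01 ff ig fg; rewrite rint.unlock; apply: le_Rintegral => //; try exact: int01_sub.
move: x01; rewrite in_itv/= => /andP[x0 x1] t /=; rewrite in_itv/= => /andP[t0 tx].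
by apply: fg; rewrite in_itv/= t0 (le_trans tx).
Qed.

(** Increments of the integral, over an open interval as in [ac01]. *)
Lemma rint_incr f (x y : R) : 0 <= x -> x <= y -> y <= 1 -> int01 f ->
  \I_(y) f - \I_(x) f = \int[mu]_(t in `]x, y[) f t.
Proof.
move=> x0 xy y1 ff.
have iy : mu.-integrable `[0, y] (EFin \o f).
  by apply: int01_sub => //; rewrite in_itv/= y1 (le_trans x0).
rewrite rint.unlock Rintegral_itvB// ?bnd_simp//.
rewrite -Rintegral_itv_bndo_bndc//.
apply: integrableS iy => //; apply: subset_itv; rewrite bnd_simp//.
Qed.

Lemma le_rintx f x y : 0 <= x -> x <= y -> y <= 1 -> int01 f ->
  (forall t, t \in `[0, 1] -> 0 <= f t) -> \I_(x) f <= \I_(y) f.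
Proof.
move=> x0 xy y1 ff f0; rewrite -subr_ge0 rint_incr//; apply: Rintegral_ge0 => t /=.
rewrite in_itv/= => /andP[xt ty]; apply: f0; rewrite in_itv/=.
by rewrite (le_trans x0 (ltW xt)) (le_trans (ltW ty)).
Qed.

Lemma rint_ac f : int01 f -> ac01 (fun x => \I_(x) f).
Proof.
move=> ff e e0.
have ff' : mu.-integrable setT (EFin \o f \_ `[0, 1]).
  by rewrite -restrict_EFin; apply/integrable_restrict => //=; rewrite setTI.
have [d [d0 H]] := integral_normr_continuous ff' e0.
exists d => // n a b ab tab sd.
pose A i : set (measurableTypeR R) := [set` `]a i, b i[].
have mA i : measurable (A i) by exact: measurable_itv.
have Ai i : A i `<=` `[0, 1].
  move=> z /=; rewrite !in_itv/= => /andP[az zb].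
  have [h1 [_ h2]] := ab i.
  by rewrite (le_trans h1 (ltW az)) (le_trans (ltW zb) h2).
have iA i : mu.-integrable (A i) (EFin \o (fun x => `|(f \_ `[0, 1]) x|)).
  by apply: eq_integrable (integrableS measurableT (mA i) (@subsetT _ _) (integrable_abse ff')).
have muA : (mu (\big[setU/set0]_(i < n) A i) < d%:E)%E.
  rewrite measure_bigsetU_ord//.
  apply: (@le_lt_trans _ _ (\sum_(i < n) (b i - a i))%:E); last by rewrite lte_fin.
  rewrite -sumEFin; apply: lee_sum => i _.
  rewrite [leLHS](@lebesgue_measure_itv R `]a i, b i[) /= lte_fin.
  by case: ltP => // h; rewrite lee_fin subr_ge0; have [_ []] := ab i.
apply: le_lt_trans (H _ _ muA); last exact: bigsetU_measurable.
rewrite [leRHS]/Rintegral ge0_integral_bigsetU//=; last 3 first.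
- by rewrite index_enum_uniq.
- by apply: sub_trivIset tab.
- have /measurable_int := integrable_abse ff'.
  by apply: measurable_funS => //; exact: bigsetU_measurable.
have -> : (\sum_(i < n) \int[mu]_(x in A i) (`|(f \_ `[0%R, 1%R]) x|)%:E)%E =
  (\sum_(i < n) \int[mu]_(x in A i) `|(f \_ `[0%R, 1%R]) x|)%:E.
  rewrite -sumEFin; apply: eq_bigr => i _.
  rewrite /Rintegral fineK//; exact: integrable_fin_num.
rewrite /=; apply: ler_sum => i _.
have [? [? ?]] := ab i.
rewrite rint_incr//.
have -> : \int[mu]_(x in A i) `|(f \_ `[0, 1]) x| = \int[mu]_(x in A i) `|f x|.
  apply: eq_Rintegral => x; rewrite inE => /Ai xi.
  by rewrite patchE mem_set.
apply: le_normr_Rintegral => //.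
by apply: integrableS (Ai i) ff.
Qed.

End Primitives.

(** * Primitives almost everywhere *)

Section Prim.
Context {R : realType}.
Notation mu := (@lebesgue_measure R).
Implicit Types (F G f g : R -> R).

(** The end points of [0,1] form a null set, so that statements about almost
    every point of [0,1] only concern interior points, where a two-sided
    derivative is insensitive to the values outside [0,1]. *)
Lemma ae_Ioo : {ae mu, forall x : R, 0 < x < 1 \/ ~ (x \in `[0, 1])}.
Proof.
exists [set 0; 1]; split => //.
- by apply: measurableU => //; exact: measurable_set1.
- apply/eqP; rewrite -measure_le0.
  apply: le_trans (measureU2 _ _ _) _; try exact: measurable_set1.
  apply: (@le_trans _ _ (0 + 0)%E); last by rewrite adde0.
  by apply: leeD; rewrite le_eqVlt; apply/orP; left; apply/eqP; exact: lebesgue_measure_set1.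
- move=> x /= h.
  have [->|x0] := eqVneq x 0; first by left.
  have [->|x1] := eqVneq x 1; first by right.
  exfalso; apply: h; rewrite in_itv/=.
  have [x0'|] := boolP (0 <= x); last by right.
  have [x1'|] := boolP (x <= 1); last by right.
  by left; rewrite !lt_neqAle eq_sym x0 x0' x1 x1'.
Qed.

Lemma rint_derive f : int01 f ->
  {ae mu, forall x : R, x \in `[0, 1] -> is_derive x 1 (fun x => \I_(x) f) (f x)}.
Proof.
move=> ff.
pose f' : R -> R := f \_ `[0, 1].
have ff' : mu.-integrable setT (EFin \o f').
  by rewrite -restrict_EFin; apply/integrable_restrict => //=; rewrite setTI.
have locf : locally_integrable setT f'.
  by apply: open_integrable_locally => //; exact: openT.
have inty (y : R) : mu.-integrable `[0, y] (EFin \o f').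
  by apply: integrableS ff'.
have := lebesgue_differentiation locf; move: ae_Ioo.
apply: filterS2; first exact: (ae_filter_ringOfSetsType mu).
move=> x /= x01 fx x01'.
case: x01 => [/andP[x0 x1]|//].
have [|D Dx] := FTC1_lebesgue_pt x1 (inty 1) _ fx; first by rewrite lte_fin.
have Hd : is_derive x 1 (fun y => \I_(y) f') (f' x).
  rewrite rint.unlock; apply: DeriveDef; first exact: D.
  by rewrite -derive1E; exact: Dx.
rewrite (_ : f x = f' x); last by rewrite /f' patchE mem_set.
apply: near_eq_is_derive Hd.
near=> y; rewrite rint.unlock.
apply: eq_Rintegral => t; rewrite inE/= in_itv/= => /andP[t0 ty].
rewrite /f' patchE mem_set//= in_itv/= t0/= (le_trans ty)//.
by near: y; apply: lt_le_nbhsl.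
Unshelve. all: by end_near. Qed.

(** [F] is a primitive of the integrable function [f] on [0,1]. Unlike an almost
    everywhere derivative, [f] may be changed on a null set without harm, and
    the relation is preserved by sums, products and composition. *)
Definition prim F f := int01 f /\ forall x : R, x \in `[0, 1] -> F x = F 0 + \I_(x) f.

Lemma ac01_ext F G : (forall x : R, x \in `[0, 1] -> F x = G x) -> ac01 F -> ac01 G.
Proof.
move=> FG acF; apply: (@ac01_lipschitz2 _ 1 F F G) => // u v u0 uv v1.
rewrite mul1r -!FG ?in_itv/= ?u0 ?v1 ?(le_trans u0) ?(le_trans uv)//.
by rewrite lerDl.
Qed.

Lemma prim_ac F f : prim F f -> ac01 F.
Proof.
move=> [ff FE].
apply: (@ac01_ext (fun x => F 0 + \I_(x) f)); first by move=> x /FE ->.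
have acI := rint_ac ff.
apply: (@ac01_lipschitz2 _ 1 _ _ _ _ acI acI) => u v u0 uv v1.
by rewrite mul1r opprD addrACA subrr add0r lerDl.
Qed.

Lemma prim_cont F f : prim F f -> {within `[0, 1], continuous F}.
Proof. by move=> /prim_ac/ac01_continuous. Qed.

Lemma prim_derive F f : prim F f ->
  {ae mu, forall x : R, x \in `[0, 1] -> is_derive x 1 F (f x)}.
Proof.
move=> [ff FE]; have := rint_derive ff; move: ae_Ioo.
apply: filterS2; first exact: (ae_filter_ringOfSetsType mu).
move=> x /= x01 D x01'.
case: x01 => [/andP[x0 x1]|//].
have D0 := D x01'.
have D' : is_derive x 1 (cst (F 0) + (fun x => \I_(x) f)) (f x).
  by apply: is_derive_eq; rewrite add0r.
apply: near_eq_is_derive D'.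
near=> y; have y01 : y \in `[0, 1].
  rewrite in_itv/=; apply/andP; split; apply/ltW; near: y.
    exact: lt_nbhsr.
  exact: lt_nbhsl.
by rewrite (FE _ y01).
Unshelve. all: by end_near. Qed.

Lemma ac_prim F f : ac01 F -> int01 f ->
  {ae mu, forall x : R, x \in `[0, 1] -> is_derive x 1 F (f x)} -> prim F f.
Proof.
move=> acF ff dF; split => // x x01.
have : F x - \I_(x) f = F 0 - \I_(0) f.
  apply: (@ac01_derive0_cst _ (fun x => F x - \I_(x) f)) => //.
    apply: (@ac01_lipschitz2 _ 1 _ _ _ _ acF (rint_ac ff)) => u v u0 uv v1.
    rewrite mul1r.
    have -> : F v - \I_(v) f - (F u - \I_(u) f) = (F v - F u) - (\I_(v) f - \I_(u) f) by ring.
    exact: ler_normB.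
  have := rint_derive ff; move: dF; apply: filterS2; first exact: (ae_filter_ringOfSetsType mu).
move=> z /= d1 d2 z01.
  have := d1 z01; have := d2 z01 => d2' d1'.
  by apply: is_derive_eq; rewrite subrr.
by rewrite rint0 subr0 => /eqP; rewrite subr_eq => /eqP.
Qed.

Lemma prim_rint f : int01 f -> prim (fun x => \I_(x) f) f.
Proof. by move=> ff; split => // x x01; rewrite rint0 add0r. Qed.

Lemma primD F G f g : prim F f -> prim G g -> prim (fun x => F x + G x) (fun x => f x + g x).
Proof.
move=> [ff FE] [ig GE]; split; first exact: int01D.
by move=> x x01; rewrite FE// GE// rintD//; ring.
Qed.

Lemma primZ k F f : prim F f -> prim (fun x => k * F x) (fun x => k * f x).
Proof.
move=> [ff FE]; split; first exact: int01Z.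
by move=> x x01; rewrite FE// rintZ//; ring.
Qed.

Lemma prim_ext F G f g : (forall x : R, x \in `[0, 1] -> F x = G x) ->
   (forall x : R, x \in `[0, 1] -> f x = g x) -> prim F f -> prim G g.
Proof.
move=> FG fg [ff FE]; split; first exact: (eq_int01 fg ff).
move=> x x01; have m0 : (0 : R) \in `[0, 1] by rewrite in_itv/= lexx ler01.
by rewrite -(FG _ x01) -(FG _ m0) (FE _ x01) (eq_rint x01 fg).
Qed.

Lemma primB F G f g : prim F f -> prim G g -> prim (fun x => F x - G x) (fun x => f x - g x).
Proof.
move=> pF pG; apply: prim_ext (primD pF (primZ (-1) pG)) => x _ /=; ring.
Qed.

Lemma prim_cst (c : R) : prim (fun=> c) (fun=> 0).
Proof.
have i0 : int01 (fun _ : R => 0 : R).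
  apply: int01_cont; apply: continuous_subspaceT => ?; exact: cvg_cst.
split => // x x01; suff -> : \I_(x) (fun=> 0 : R) = 0 by rewrite addr0.
rewrite (@eq_rint _ _ (fun t => 0 * 0) _ x01) ?(rintZ 0 x01 i0) ?mul0r//.
Qed.

Lemma primM F G f g : prim F f -> prim G g ->
  prim (fun x => F x * G x) (fun x => f x * G x + F x * g x).
Proof.
move=> pF pG.
have cF := prim_cont pF; have cG := prim_cont pG.
apply: ac_prim.
- have [M M0 FM] := cont01_bounded cF.
  have [N N0 GN] := cont01_bounded cG.
  apply: (@ac01_lipschitz2 _ (M + N) _ _ _ _ (prim_ac pF) (prim_ac pG)) => u v u0 uv v1.
  have -> : F v * G v - F u * G u = (F v - F u) * G v + F u * (G v - G u) by ring.
  apply: le_trans (ler_normD _ _) _; rewrite !normrM mulrDr lerD//.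
    rewrite mulrC ler_wpM2r//; apply: le_trans (GN _ _) _; last by rewrite lerDr.
    by rewrite in_itv/= v1 (le_trans u0).
  rewrite ler_wpM2r//; apply: le_trans (FM _ _) _; last by rewrite lerDl.
  by rewrite in_itv/= u0 (le_trans uv).
- apply: int01D; last by apply: int01M => //; case: pG.
  by apply: eq_int01 (int01M cG (proj1 pF)) => x _; rewrite mulrC.
- have := prim_derive pG; have := prim_derive pF.
  apply: filterS2; first exact: (ae_filter_ringOfSetsType mu).
move=> z d1 d2 z01.
  have d1' := d1 z01; have d2' := d2 z01.
  by apply: (is_derive_eq (is_deriveM _ _)); rewrite /GRing.scale/=; ring.
Qed.

(** On the compact range of [F] the function [phi] is Lipschitz, so that the
    composition is absolutely continuous. *)
Lemma prim_comp (phi phi' : R -> R) F f :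
  (forall z : R, is_derive z 1 phi (phi' z)) -> continuous phi' -> prim F f ->
  prim (fun x => phi (F x)) (fun x => phi' (F x) * f x).
Proof.
move=> dphi cphi' pF; have cF := prim_cont pF.
have [M M0 FM] := cont01_bounded cF.
have cphi : continuous phi.
  by move=> z; apply: differentiable_continuous; apply/derivable1_diffP; case: (dphi z).
have MM : - M <= M by rewrite ge0_cp.
have cphi'M : {within `[- M, M], continuous (fun z => `|phi' z|)}.
  by apply: continuous_subspaceT => z; apply: continuous_comp; [exact: cphi'|exact: norm_continuous].
have [c _ phic] := EVT_max MM cphi'M.
have key (u v : R) : u \in `[- M, M] -> v \in `[- M, M] -> u <= v ->
    `|phi v - phi u| <= `|phi' c| * `|v - u|.
  rewrite !in_itv/= => /andP[Mu uM] /andP[Mv vM] uv.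
  have [w] := MVT_segment uv (fun z _ => dphi z) (continuous_subspaceT cphi).
  rewrite in_itv/= => /andP[uw wv] ->; rewrite normrM ler_wpM2r//; apply: phic.
  by rewrite in_itv/= (le_trans Mu uw) (le_trans wv vM).
have acphi : ac01 (fun x => phi (F x)).
  apply: (@ac01_lipschitz2 _ `|phi' c| _ _ _ _ (prim_ac pF) (prim_ac pF)) => u v u0 uv v1.
  have Fu : F u \in `[- M, M].
    by rewrite in_itv/= -ler_norml; apply: FM; rewrite in_itv/= u0 (le_trans uv).
  have Fv : F v \in `[- M, M].
    by rewrite in_itv/= -ler_norml; apply: FM; rewrite in_itv/= v1 (le_trans u0).
  apply: (@le_trans _ _ (`|phi' c| * `|F v - F u|)); last first.
    by rewrite ler_wpM2l// lerDl.
  have [uv'|vu'] := leP (F u) (F v); first exact: key.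
  by rewrite distrC (distrC (F v)); apply: key => //; exact: ltW.
apply: ac_prim => //.
- apply: int01M; last by case: pF.
  by move=> z; apply: continuous_comp; [exact: cF|exact: cphi'].
- have := prim_derive pF; apply: filterS; first exact: (ae_filter_ringOfSetsType mu).
  move=> z d z01.
  have d' := d z01.
  exact: (is_derive1_comp (dphi _) d').
Qed.

Lemma prim_expR F f : prim F f -> prim (fun x => expR (F x)) (fun x => expR (F x) * f x).
Proof. exact: prim_comp (fun z => is_derive_expR z) (@continuous_expR R). Qed.

Lemma prim_cos F f : prim F f -> prim (fun x => cos (F x)) (fun x => - sin (F x) * f x).
Proof.
apply: (@prim_comp cos (fun z => - sin z)) => z.
by apply: continuousN; exact: continuous_sin.
Qed.

Lemma prim_sin F f : prim F f -> prim (fun x => sin (F x)) (fun x => cos (F x) * f x).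
Proof. by apply: (@prim_comp sin cos) => z; exact: continuous_cos. Qed.

Lemma prim_id : prim (fun x => x) (fun=> 1).
Proof.
have cid : {within `[0, 1], continuous (fun x : R => x)} by apply: continuous_subspaceT => ?; exact: cvg_id.
have c1 : {within `[0, 1], continuous (fun x : R => 1 : R)} by apply: continuous_subspaceT => ?; exact: cvg_cst.
apply: ac_prim; last 2 first.
- exact: int01_cont.
- by apply: aeW => x _; exact: is_derive_id.
move=> e e0; exists e => // n a b ab _; apply: le_lt_trans.
by apply: ler_sum => i _; have [_ [h _]] := ab i; rewrite ger0_norm ?subr_ge0.
Qed.

End Prim.

(** * Gronwall's lemma and the Cauchy-Schwarz inequality *)

Section Gronwall.
Context {R : realType}.
Notation mu := (@lebesgue_measure R).
Implicit Types (F G f g a p q : R -> R).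

Lemma zero01 : (0 : R) \in `[0, 1]. Proof. by rewrite in_itv/= lexx ler01. Qed.
Lemma one01 : (1 : R) \in `[0, 1]. Proof. by rewrite in_itv/= lexx ler01. Qed.

Lemma rint_ge0 f x : x \in `[0, 1] -> (forall t, t \in `[0, 1] -> 0 <= f t) -> 0 <= \I_(x) f.
Proof.
rewrite in_itv/= => /andP[x0 x1] f0; rewrite rint.unlock; apply: Rintegral_ge0 => t /=.
rewrite in_itv/= => /andP[t0 tx]; apply: f0; rewrite in_itv/= t0.
exact: le_trans tx x1.
Qed.

Lemma le_rint1 f x : x \in `[0, 1] -> int01 f ->
  (forall t, t \in `[0, 1] -> 0 <= f t) -> \I_(x) f <= \I_(1) f.
Proof. by rewrite in_itv/= => /andP[x0 x1] ff f0; apply: le_rintx. Qed.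

(** The function (S + int a n) exp(- int a) has a nonpositive derivative and
    starts at [S]. *)
Lemma gronwall (n a : R -> R) (S : R) : 
  {within `[0, 1], continuous n} -> int01 a ->
  (forall t, t \in `[0, 1] -> 0 <= a t) -> 0 <= S ->
  (forall x, x \in `[0, 1] -> n x <= S + \I_(x) (fun t => a t * n t)) ->
  forall x, x \in `[0, 1] -> n x <= S * expR (\I_(1) a).
Proof.
move=> cn ia a0 S0 H.
have ian : int01 (fun t => a t * n t).
  by apply: eq_int01 (int01M cn ia) => t _; rewrite mulrC.
have pG := primD (prim_cst S) (prim_rint ian).
have pA := prim_rint ia.
have pe := prim_expR (primZ (-1) pA).
have [ih pH] := primM pG pe.
move=> x x01; apply: le_trans (H x x01) _.
have := pH x x01; rewrite !rint0 addr0 mulr0 expR0 mulr1.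
have : \I_(x) (fun x =>
    (0 + a x * n x) * expR (-1 * \I_(x) a) +
    (S + \I_(x) (fun t => a t * n t)) * (expR (-1 * \I_(x) a) * (-1 * a x))) <= 0.
  rewrite -oppr_ge0 -[X in 0 <= X]mulN1r -rintZ//; apply: rint_ge0 => // t t01.
  rewrite [X in 0 <= X](_ : _ = expR (-1 * \I_(t) a) * (a t *
    (S + \I_(t) (fun t => a t * n t) - n t))); last by ring.
  by rewrite !mulr_ge0 ?expR_ge0 ?a0 ?subr_ge0 ?H.
have := le_rint1 x01 ia a0.
move: (\I_(x) a) (\I_(1) a) => A A1 AA1.
move: (\I_(x) (fun t => a t * n t)) => G.
move: (\I_(x) _) => D D0 GD.
have GS : (S + G) * expR (-1 * A) <= S by rewrite GD gerDl.
have e0 : 0 < expR A by exact: expR_gt0.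
have eA : expR A <= expR A1 by rewrite ler_expR.
move: GS; rewrite mulN1r expRN ler_pdivrMr// => /le_trans; apply.
by rewrite ler_wpM2l.
Qed.

Lemma int01_mul p q : measurable_fun `[0 : R, 1] p -> measurable_fun `[0 : R, 1] q ->
  int01 (fun t => p t ^+ 2) -> int01 (fun t => q t ^+ 2) -> int01 (fun t => p t * q t).
Proof.
move=> mp mq ip iq; apply: (int01_le _ (int01D ip iq)); first exact: measurable_funM.
have key (u v : R) : u * v <= u ^+ 2 + v ^+ 2.
  have := sqr_ge0 (u - v); have := sqr_ge0 u; have := sqr_ge0 v.
  have -> : (u - v) ^+ 2 = u ^+ 2 + v ^+ 2 - 2 * (u * v) by ring.
  move: (u ^+ 2) (v ^+ 2) (u * v) => A B C; lra.
by move=> x _; rewrite normrM -(real_normK (num_real (p x))) -(real_normK (num_real (q x))).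
Qed.

(** The quadratic form (s, t) |-> int (s p + t q)^2 is nonnegative. *)
Lemma cauchy_schwarz p q : measurable_fun `[0 : R, 1] p -> measurable_fun `[0 : R, 1] q ->
  int01 (fun t => p t ^+ 2) -> int01 (fun t => q t ^+ 2) ->
  (\I_(1) (fun t => p t * q t)) ^+ 2 <= \I_(1) (fun t => p t ^+ 2) * \I_(1) (fun t => q t ^+ 2).
Proof.
move=> mp mq ip iq.
have ipq := int01_mul mp mq ip iq.
have key (s t : R) : 0 <= s ^+ 2 * \I_(1) (fun t => p t ^+ 2) + 2 * s * t * \I_(1) (fun t => p t * q t)
    + t ^+ 2 * \I_(1) (fun t => q t ^+ 2).
  have one := one01.
  rewrite -!rintZ// -!rintD//; try do ?[exact: int01Z|apply: int01D].
  apply: rint_ge0 => // z _.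
  rewrite [X in 0 <= X](_ : _ = (s * p z + t * q z) ^+ 2) ?sqr_ge0//; ring.
move: key; set A := \I_(1) _; set B := \I_(1) _; set C := \I_(1) _ => key.
have A0 : 0 <= A by have := key 1 0; lra.
have C0 : 0 <= C by have := key 0 1; lra.
have [C00|] := eqVneq C 0.
  (* With C = 0 the value at (- B, A + 1) is - B^2 (A + 2). *)
  have := key (- B) (A + 1); rewrite C00 => h.
  have : B ^+ 2 * (A + 2) <= 0 by lra.
  rewrite pmulr_lle0; last lra.
  by rewrite mulr0.
move=> Cn; have Cp : 0 < C by rewrite lt_neqAle eq_sym Cn.
have := key C (- B).
have -> : C ^+ 2 * A + 2 * C * - B * B + (- B) ^+ 2 * C = C * (A * C - B ^+ 2) by ring.
by rewrite pmulr_rge0// subr_ge0.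
Qed.

End Gronwall.

(** * Complex-valued functions *)

Section ComplexAlgebra.
Context {R : realType}.
Implicit Types (z w k : R[i]) (x : R).
Notation Re := complex.Re.
Notation Im := complex.Im.

Lemma cReD z w : Re (z + w) = Re z + Re w. Proof. by case: z; case: w. Qed.
Lemma cImD z w : Im (z + w) = Im z + Im w. Proof. by case: z; case: w. Qed.
Lemma cReN z : Re (- z) = - Re z. Proof. by case: z. Qed.
Lemma cImN z : Im (- z) = - Im z. Proof. by case: z. Qed.
Lemma cReM z w : Re (z * w) = Re z * Re w - Im z * Im w. Proof. by case: z; case: w. Qed.
Lemma cImM z w : Im (z * w) = Re z * Im w + Im z * Re w.
Proof. by case: z => a b; case: w => c d. Qed.
Lemma complex_eq z w : Re z = Re w -> Im z = Im w -> z = w.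
Proof. by case: z => a b; case: w => c d /= -> ->. Qed.

Lemma cmodE z : cmod z = Num.sqrt (Re z ^+ 2 + Im z ^+ 2).
Proof. by case: z. Qed.
Lemma cmod_ge0 z : 0 <= cmod z. Proof. by rewrite cmodE sqrtr_ge0. Qed.
Lemma sqr_cmod z : cmod z ^+ 2 = Re z ^+ 2 + Im z ^+ 2.
Proof. by rewrite cmodE sqr_sqrtr// addr_ge0// sqr_ge0. Qed.
Lemma cmodM z w : cmod (z * w) = cmod z * cmod w.
Proof. exact: ComplexField.Normc.normcM. Qed.
Lemma cmodD z w : cmod (z + w) <= cmod z + cmod w.
Proof. exact: le_normcD. Qed.
Lemma cmodN z : cmod (- z) = cmod z.
Proof. exact: normcN. Qed.
Lemma cmodB z w : cmod (z - w) <= cmod z + cmod w.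
Proof. by rewrite -(cmodN w) cmodD. Qed.
Lemma cmodV z : cmod z^-1 = (cmod z)^-1.
Proof. exact: ComplexField.Normc.normcV. Qed.
Lemma cmod0 : cmod (0 : R[i]) = 0.
Proof. exact: ComplexField.Normc.normc0. Qed.
Lemma cmod1 : cmod (1 : R[i]) = 1.
Proof. exact: ComplexField.Normc.normc1. Qed.
Lemma cmodX z n : cmod (z ^+ n) = cmod z ^+ n.
Proof. by elim: n => [|n IH]; rewrite ?expr0 ?cmod1// !exprS cmodM IH. Qed.
Lemma Re_le_cmod z : `|Re z| <= cmod z.
Proof. by rewrite cmodE -sqrtr_sqr ler_wsqrtr// lerDl sqr_ge0. Qed.
Lemma Im_le_cmod z : `|Im z| <= cmod z.
Proof. by rewrite cmodE -sqrtr_sqr ler_wsqrtr// lerDr sqr_ge0. Qed.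

Lemma cmod_le_ReIm z : cmod z <= `|Re z| + `|Im z|.
Proof.
have h : 0 <= `|Re z| + `|Im z| by rewrite addr_ge0.
rewrite cmodE -(ger0_norm h) -sqrtr_sqr ler_wsqrtr// sqrrD !real_normK ?num_real//.
by rewrite -addrA (addrC (_ *+ 2)) addrA lerDl mulrn_wge0// mulr_ge0.
Qed.

Lemma cexpD z w : cexp (z + w) = cexp z * cexp w.
Proof.
apply: complex_eq; rewrite ?cReM ?cImM /= ?cReD ?cImD expRD ?cosD ?sinD; ring.
Qed.
Lemma cexp0 : cexp (0 : R[i]) = 1.
Proof. by apply: complex_eq; rewrite /= expR0 ?cos0 ?sin0 ?mulr0 ?mul1r. Qed.
Lemma cmod_cexp z : cmod (cexp z) = expR (Re z).
Proof.
rewrite cmodE /= !exprMn -mulrDr cos2Dsin2 mulr1 sqrtr_sqr ger0_norm//.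
Qed.
Lemma iu2 : iu ^+ 2 = -1 :> R[i].
Proof. by apply: complex_eq; rewrite expr2 ?cReM ?cImM /=; ring. Qed.
Lemma iu_neq0 : iu != 0 :> R[i].
Proof. by rewrite eq_complex /= oner_eq0 andbF. Qed.
Lemma cmod_iu : cmod (iu : R[i]) = 1.
Proof. by rewrite cmodE /= expr0n expr1n add0r sqrtr1. Qed.
Lemma cmod_real x : cmod (x%:C%C : R[i]) = `|x|.
Proof. by rewrite cmodE /= expr0n addr0 sqrtr_sqr. Qed.
Lemma cmod2 : cmod (2 : R[i]) = 2.
Proof. by rewrite -(rmorph_nat (real_complex R) 2) cmod_real ger0_norm. Qed.

Lemma measurable_cmod (f : R -> R[i]) :
  measurable_fun `[0 : R, 1] (fun x => Re (f x)) ->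
  measurable_fun `[0 : R, 1] (fun x => Im (f x)) ->
  measurable_fun `[0 : R, 1] (fun x => cmod (f x)).
Proof.
move=> mR mI.
rewrite (_ : (fun x => cmod (f x)) = Num.sqrt \o (fun x => Re (f x) ^+ 2 + Im (f x) ^+ 2)); last first.
  by apply/funext => x; rewrite cmodE.
have mS : measurable_fun [set: R] (@Num.sqrt R) by apply: continuous_measurable_fun; exact: sqrt_continuous.
apply: (measurableT_comp mS).
by apply: measurable_funD; exact: measurable_funX.
Qed.
End ComplexAlgebra.

(** The integral from 0 to [x] of a complex-valued function, locked. *)
HB.lock Definition cI {R : realType} (x : R) (f : R -> R[i]) : R[i] :=
  \cint_(0 <= t <= x) f t.

Section ComplexIntegral.
Context {R : realType}.
Implicit Types (z w k : R[i]) (x : R) (f g F G : R -> R[i]).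
Notation Re := complex.Re.
Notation Im := complex.Im.

(** Integrability of a complex-valued function over [0,1]. *)
Definition cint01 f := int01 (fun t => Re (f t)) /\ int01 (fun t => Im (f t)).

Lemma cIE x f : cI x f = Complex (rint x (fun t => Re (f t))) (rint x (fun t => Im (f t))).
Proof. by rewrite cI.unlock rint.unlock. Qed.

Lemma cReI x f : Re (cI x f) = rint x (fun t => Re (f t)). Proof. by rewrite cIE. Qed.
Lemma cImI x f : Im (cI x f) = rint x (fun t => Im (f t)). Proof. by rewrite cIE. Qed.

Lemma eq_cint01 f g : (forall x, x \in `[0, 1] -> f x = g x) -> cint01 f -> cint01 g.
Proof.
by move=> fg [rf jf]; split; [apply: eq_int01 rf|apply: eq_int01 jf] => x x01; rewrite fg.
Qed.

Lemma eq_cI x f g : x \in `[0, 1] -> (forall t, t \in `[0, 1] -> f t = g t) -> cI x f = cI x g.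
Proof.
by move=> x01 fg; rewrite !cIE; congr Complex; apply: eq_rint => // t t01; rewrite fg.
Qed.

Lemma cI0 f : cI 0 f = 0. Proof. by rewrite cIE !rint0. Qed.

Lemma cint01D f g : cint01 f -> cint01 g -> cint01 (fun t => f t + g t).
Proof.
move=> [rf jf] [rg jg]; split.
  by apply: eq_int01 (int01D rf rg) => x _; rewrite cReD.
by apply: eq_int01 (int01D jf jg) => x _; rewrite cImD.
Qed.

Lemma cint01Z k f : cint01 f -> cint01 (fun t => k * f t).
Proof.
move=> [rf jf]; split.
  by apply: eq_int01 (int01B (int01Z (Re k) rf) (int01Z (Im k) jf)) => x _; rewrite cReM.
by apply: eq_int01 (int01D (int01Z (Re k) jf) (int01Z (Im k) rf)) => x _; rewrite cImM.
Qed.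

Lemma cint01N f : cint01 f -> cint01 (fun t => - f t).
Proof. by move=> /(cint01Z (-1)); apply: eq_cint01 => x _; rewrite mulN1r. Qed.

Lemma cint01B f g : cint01 f -> cint01 g -> cint01 (fun t => f t - g t).
Proof. by move=> ff ig; apply: cint01D => //; exact: cint01N. Qed.

Lemma cint01M F g : continuous01 F -> cint01 g -> cint01 (fun t => F t * g t).
Proof.
move=> [cR cJ] [rg jg]; split.
  by apply: eq_int01 (int01B (int01M cR rg) (int01M cJ jg)) => x _; rewrite cReM.
by apply: eq_int01 (int01D (int01M cR jg) (int01M cJ rg)) => x _; rewrite cImM.
Qed.

Lemma cint01_cont F : continuous01 F -> cint01 F.
Proof. by move=> [cR cJ]; split; exact: int01_cont. Qed.

Lemma cint01_cmod f : cint01 f -> int01 (fun t => cmod (f t)).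
Proof.
move=> [rf jf]; apply: (int01_le _ (int01D (int01_norm rf) (int01_norm jf))).
  by apply: measurable_cmod; exact: int01_measurable.
move=> x _; rewrite ger0_norm ?cmod_ge0//.
exact: cmod_le_ReIm.
Qed.

Lemma cint01_le f h : measurable_fun `[0 : R, 1] (fun t => Re (f t)) ->
   measurable_fun `[0 : R, 1] (fun t => Im (f t)) -> int01 h ->
   (forall t, t \in `[0, 1] -> cmod (f t) <= h t) -> cint01 f.
Proof.
move=> mR mJ ih fh; split.
  by apply: (int01_le mR ih) => x x01; apply: le_trans (Re_le_cmod _) (fh x x01).
by apply: (int01_le mJ ih) => x x01; apply: le_trans (Im_le_cmod _) (fh x x01).
Qed.

Lemma cID x f g : x \in `[0, 1] -> cint01 f -> cint01 g ->
  cI x (fun t => f t + g t) = cI x f + cI x g.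
Proof.
move=> x01 [rf jf] [rg jg]; apply: complex_eq.
  rewrite cReD !cReI -rintD//; apply: eq_rint => // t _; exact: cReD.
rewrite cImD !cImI -rintD//; apply: eq_rint => // t _; exact: cImD.
Qed.

Lemma cIZ x k f : x \in `[0, 1] -> cint01 f -> cI x (fun t => k * f t) = k * cI x f.
Proof.
move=> x01 [rf jf]; apply: complex_eq.
  rewrite cReM !cReI !cImI -!rintZ// -rintB//; try exact: int01Z.
  by apply: eq_rint => // t _; exact: cReM.
rewrite cImM !cReI !cImI -!rintZ// -rintD//; try exact: int01Z.
by apply: eq_rint => // t _; exact: cImM.
Qed.

Lemma cIN x f : x \in `[0, 1] -> cint01 f -> cI x (fun t => - f t) = - cI x f.
Proof.
by move=> x01 ff; rewrite -mulN1r -cIZ//; apply: eq_cI => // t _; rewrite mulN1r.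
Qed.

Lemma cIB x f g : x \in `[0, 1] -> cint01 f -> cint01 g ->
  cI x (fun t => f t - g t) = cI x f - cI x g.
Proof. by move=> x01 ff ig; rewrite cID// ?cIN//; exact: cint01N. Qed.

(** With z the integral, |z|^2 is the integral of the real part of conj(z) f. *)
Lemma cI_le x f (h : R -> R) : x \in `[0, 1] -> cint01 f -> int01 h ->
  (forall t, t \in `[0, 1] -> cmod (f t) <= h t) -> cmod (cI x f) <= rint x h.
Proof.
move=> x01 [rf jf] ih fh.
have := cReI x f; have := cImI x f; move: (cI x f) => z Jz Rz.
have z2 : cmod z ^+ 2 <= cmod z * rint x h.
  rewrite sqr_cmod !expr2 {2}Rz {2}Jz -!rintZ// -rintD//; try exact: int01Z.
  apply: le_rint => //; [by apply: int01D; exact: int01Z|exact: int01Z|].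
  move=> t t01; apply: (@le_trans _ _ (cmod z * cmod (f t))); last first.
    by rewrite ler_wpM2l ?cmod_ge0// fh.
  have -> : cmod z = cmod (Complex (Re z) (- Im z)) by rewrite !cmodE/= sqrrN.
  rewrite -cmodM.
  have -> : Re z * Re (f t) + Im z * Im (f t) = Re (Complex (Re z) (- Im z) * f t).
    by rewrite cReM/= mulNr opprK.
  exact: le_trans (ler_norm _) (Re_le_cmod _).
have [z0|z0] := eqVneq (cmod z) 0.
  by rewrite z0; apply: rint_ge0 => // t t01; apply: le_trans (fh t t01); exact: cmod_ge0.
have zp : 0 < cmod z by rewrite lt_neqAle eq_sym z0 cmod_ge0.
by rewrite -(ler_pM2l zp) -expr2.
Qed.

(** [F] is a primitive of the complex-valued function [f] on [0,1]. *)
Definition cprim F f := prim (fun t => Re (F t)) (fun t => Re (f t)) /\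
                        prim (fun t => Im (F t)) (fun t => Im (f t)).

Lemma cprim_int F f : cprim F f -> cint01 f.
Proof. by move=> [[? _] [? _]]. Qed.

Lemma cprimE F f x : cprim F f -> x \in `[0, 1] -> F x = F 0 + cI x f.
Proof.
move=> [[_ rF] [_ jF]] x01; apply: complex_eq.
  by rewrite cReD cReI rF.
by rewrite cImD cImI jF.
Qed.

Lemma cprim_cI F f x : cprim F f -> F 0 = 0 -> x \in `[0, 1] -> cI x f = F x.
Proof. by move=> pF F0 x01; rewrite (cprimE pF x01) F0 add0r. Qed.

Lemma cprim_cont F f : cprim F f -> continuous01 F.
Proof. by move=> [pR pJ]; split; [exact: (prim_cont pR)|exact: (prim_cont pJ)]. Qed.

Lemma cprim_I f : cint01 f -> cprim (fun x => cI x f) f.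
Proof.
move=> [rf jf]; split.
  by apply: prim_ext (prim_rint rf) => x _ //; rewrite cReI.
by apply: prim_ext (prim_rint jf) => x _ //; rewrite cImI.
Qed.

Lemma cprim_ext F G f g : (forall x, x \in `[0, 1] -> F x = G x) ->
   (forall x, x \in `[0, 1] -> f x = g x) -> cprim F f -> cprim G g.
Proof.
move=> FG fg [pR pJ]; split.
  by apply: prim_ext pR => x x01; rewrite ?FG ?fg.
by apply: prim_ext pJ => x x01; rewrite ?FG ?fg.
Qed.

Lemma cprimD F G f g : cprim F f -> cprim G g ->
  cprim (fun x => F x + G x) (fun x => f x + g x).
Proof.
move=> [pR pJ] [qR qJ]; split.
  by apply: prim_ext (primD pR qR) => x _; rewrite cReD.
by apply: prim_ext (primD pJ qJ) => x _; rewrite cImD.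
Qed.

Lemma cprimM F G f g : cprim F f -> cprim G g ->
  cprim (fun x => F x * G x) (fun x => f x * G x + F x * g x).
Proof.
move=> [pR pJ] [qR qJ]; split.
  apply: prim_ext (primB (primM pR qR) (primM pJ qJ)) => x _; first by rewrite cReM.
  by rewrite cReD !cReM; ring.
apply: prim_ext (primD (primM pR qJ) (primM pJ qR)) => x _; first by rewrite cImM.
by rewrite cImD !cImM; ring.
Qed.

Lemma cprim_cst k : cprim (fun=> k) (fun=> 0).
Proof. by split; exact: prim_cst. Qed.

Lemma cprimZ k F f : cprim F f -> cprim (fun x => k * F x) (fun x => k * f x).
Proof.
by move=> pF; apply: cprim_ext (cprimM (cprim_cst k) pF) => x _ //; rewrite mul0r add0r.
Qed.

Lemma cprimN F f : cprim F f -> cprim (fun x => - F x) (fun x => - f x).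
Proof. by move=> /(cprimZ (-1)); apply: cprim_ext => x _; rewrite mulN1r. Qed.

Lemma cprimB F G f g : cprim F f -> cprim G g ->
  cprim (fun x => F x - G x) (fun x => f x - g x).
Proof. by move=> pF pG; apply: cprimD => //; exact: cprimN. Qed.

Lemma cprim_cexp k : cprim (fun x => cexp (k * x%:C%C)) (fun x => k * cexp (k * x%:C%C)).
Proof.
have pe := prim_expR (primZ (Re k) prim_id).
have pc := prim_cos (primZ (Im k) prim_id).
have ps := prim_sin (primZ (Im k) prim_id).
split.
  apply: prim_ext (primM pe pc) => x _; first by rewrite /= cReM cImM /= !mulr0 subr0 add0r.
  by rewrite /= cReM /= cReM cImM /= !mulr0 subr0 add0r; ring.
apply: prim_ext (primM pe ps) => x _; first by rewrite /= cReM cImM /= !mulr0 subr0 add0r.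
by rewrite /= cImM /= cReM cImM /= !mulr0 subr0 add0r; ring.
Qed.

Lemma cont01M F G : continuous01 F -> continuous01 G -> continuous01 (fun x => F x * G x).
Proof.
move=> [a b] [c d]; split.
  rewrite (_ : (fun x => Re (F x * G x)) = (fun x => Re (F x) * Re (G x) - Im (F x) * Im (G x))); last first.
    by apply/funext => x; rewrite cReM.
  by move=> z; apply: cvgB; apply: cvgM; [exact: a|exact: c|exact: b|exact: d].
rewrite (_ : (fun x => Im (F x * G x)) = (fun x => Re (F x) * Im (G x) + Im (F x) * Re (G x))); last first.
  by apply/funext => x; rewrite cImM.
by move=> z; apply: cvgD; apply: cvgM; [exact: a|exact: d|exact: b|exact: c].
Qed.

End ComplexIntegral.

(** * The truncated Picard series and its residual *)

Section Residual.
Context {R : realType}.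
Implicit Types (f g F G : R -> R[i]).

Lemma cint01Mr f F : cint01 f -> continuous01 F -> cint01 (fun t => f t * F t).
Proof.
by move=> ff cF; apply: eq_cint01 (cint01M cF ff) => t _; rewrite mulrC.
Qed.

Lemma cont_cmod F : continuous01 F -> {within `[0, 1], continuous (fun t : R => cmod (F t))}.
Proof.
move=> [cR cJ].
rewrite (_ : (fun t => cmod (F t)) = (fun t => Num.sqrt (complex.Re (F t) ^+ 2 + complex.Im (F t) ^+ 2))); last first.
  by apply/funext => t; rewrite cmodE.
move=> z; apply: continuous_comp; last exact: sqrt_continuous.
by apply: cvgD; apply: cvgM; [exact: cR|exact: cR|exact: cJ|exact: cJ].
Qed.

Lemma cI_bound f (h : R -> R) (k x : R) : x \in `[0, 1] -> cint01 f -> int01 h ->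
  (forall t, t \in `[0, 1] -> 0 <= h t) -> 0 <= k ->
  (forall t, t \in `[0, 1] -> cmod (f t) <= k * h t) ->
  cmod (cI x f) <= k * rint 1 h.
Proof.
move=> x01 ff ih h0 k0 fh.
apply: le_trans (cI_le x01 ff (int01Z k ih) fh) _.
rewrite -rintZ ?one01//; apply: le_rint1 => //; first exact: int01Z.
by move=> t t01; rewrite mulr_ge0 ?h0.
Qed.

(** The iterated integrals of (f, g) and of (f, g, f), the outermost function
    coming first. *)
Definition iter2 f g (x : R) := cI x (fun t => f t * cI t g).
Definition iter3 f g (x : R) := cI x (fun t => f t * iter2 g f t).

(** The truncated Picard series of wp. Of order [eps], the integral of
    c - a2 and the iterated integral of (a, c - b2) are kept; the other terms
    are small. Exchanging a, a2 with b, b2 and changing the sign of [eps] gives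
    the series of wm. *)
Definition picard (a b c a2 b2 : R -> R[i]) (eps : R[i]) (x : R) : R[i] :=
  1 + cI x a + iter2 a b x + iter3 a b x - eps * cI x (fun t => c t - a2 t)
  + eps * cI x (fun t => a t * cI t (fun s => c s - b2 s)).

(** What the truncated series lacks to solve the first equation; see
    [picard_prim]. *)
Definition resid (a b c a2 b2 : R -> R[i]) (eps : R[i]) (t : R) : R[i] :=
  - (a t * iter3 b a t)
  + eps * (a t * cI t (fun s => b s * cI s (fun r => c r - a2 r)))
  + eps * (c t * cI t a - a2 t * cI t b + c t * iter2 a b t - a2 t * iter2 b a t
           + c t * iter3 a b t - a2 t * iter3 b a t)
  + eps ^+ 2 * (- (c t * cI t (fun s => c s - a2 s))
       + c t * cI t (fun s => a s * cI s (fun r => c r - b2 r))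
       - a2 t * cI t (fun s => c s - b2 s)
       + a2 t * cI t (fun s => b s * cI s (fun r => c r - a2 r))).

(** The bound on the primitive of the residual. Here |a|, |b| <= E q and
    |c|, |a2|, |b2| <= E q^2; M1 and M2 are the integrals of q and q^2; and with
    g = |A| + |B|, the parameters J, K2, G1 are the integrals of q g, q^2 g and
    q g^2. *)
Definition resid_bound (E M1 M2 J K2 G1 e : R) : R :=
  3 * (E ^+ 2 * J ^+ 2) + E ^+ 2 * M1 * G1
  + e * (6 * (E ^+ 2 * J * M2) + 2 * (E ^+ 2 * M1 * K2))
  + e * (2 * (E * K2) + 2 * (E ^+ 2 * M2 * J) + 2 * (E ^+ 3 * M1 * M2 * J))
  + e ^+ 2 * (4 * (E ^+ 2 * M2 ^+ 2) + 4 * (E ^+ 3 * M1 * M2 ^+ 2)).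

Variables (a b c a2 b2 : R -> R[i]) (eps : R[i]) (q : R -> R) (E : R).
Hypotheses (ia : cint01 a) (ib : cint01 b) (ic : cint01 c) (ia2 : cint01 a2) (ib2 : cint01 b2).
Hypotheses (E1 : 1 <= E) (q0 : forall t, t \in `[0, 1] -> 0 <= q t).
Hypotheses (iq : int01 q) (iq2 : int01 (fun t => q t ^+ 2)).
Hypotheses (aE : forall t, t \in `[0, 1] -> cmod (a t) <= E * q t).
Hypotheses (bE : forall t, t \in `[0, 1] -> cmod (b t) <= E * q t).
Hypotheses (cE : forall t, t \in `[0, 1] -> cmod (c t) <= q t ^+ 2).
Hypotheses (a2E : forall t, t \in `[0, 1] -> cmod (a2 t) <= E * q t ^+ 2).
Hypotheses (b2E : forall t, t \in `[0, 1] -> cmod (b2 t) <= E * q t ^+ 2).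

Let g (t : R) : R := cmod (cI t a) + cmod (cI t b).
Let M1 := rint 1 q.
Let M2 := rint 1 (fun t => q t ^+ 2).
Let J := rint 1 (fun t => q t * g t).
Let K2 := rint 1 (fun t => q t ^+ 2 * g t).
Let G1 := rint 1 (fun t => q t * g t ^+ 2).

Let cA : continuous01 (fun t => cI t a). Proof. exact: cprim_cont (cprim_I ia). Qed.
Let cB : continuous01 (fun t => cI t b). Proof. exact: cprim_cont (cprim_I ib). Qed.
Let i2ab : cint01 (fun t => a t * cI t b). Proof. exact: cint01Mr. Qed.
Let i2ba : cint01 (fun t => b t * cI t a). Proof. exact: cint01Mr. Qed.
Let cH : continuous01 (iter2 a b). Proof. exact: cprim_cont (cprim_I i2ab). Qed.
Let cH' : continuous01 (iter2 b a). Proof. exact: cprim_cont (cprim_I i2ba). Qed.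
Let i3ab : cint01 (fun t => a t * iter2 b a t). Proof. exact: cint01Mr. Qed.
Let i3ba : cint01 (fun t => b t * iter2 a b t). Proof. exact: cint01Mr. Qed.
Let cT : continuous01 (iter3 a b). Proof. exact: cprim_cont (cprim_I i3ab). Qed.
Let cT' : continuous01 (iter3 b a). Proof. exact: cprim_cont (cprim_I i3ba). Qed.
Let iP : cint01 (fun t => c t - a2 t). Proof. exact: cint01B. Qed.
Let iP' : cint01 (fun t => c t - b2 t). Proof. exact: cint01B. Qed.
Let P x := cI x (fun t => c t - a2 t).
Let P' x := cI x (fun t => c t - b2 t).
Let cP : continuous01 P. Proof. exact: cprim_cont (cprim_I iP). Qed.
Let cP' : continuous01 P'. Proof. exact: cprim_cont (cprim_I iP'). Qed.
Let iaP' : cint01 (fun t => a t * P' t). Proof. exact: cint01Mr. Qed.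
Let ibP : cint01 (fun t => b t * P t). Proof. exact: cint01Mr. Qed.
Let S x := cI x (fun t => a t * P' t).
Let S' x := cI x (fun t => b t * P t).
Let cS : continuous01 S. Proof. exact: cprim_cont (cprim_I iaP'). Qed.
Let cS' : continuous01 S'. Proof. exact: cprim_cont (cprim_I ibP). Qed.

Let E0 : 0 <= E. Proof. exact: le_trans E1. Qed.
Let g0 t : 0 <= g t. Proof. by rewrite addr_ge0 ?cmod_ge0. Qed.
Let Ag t : cmod (cI t a) <= g t. Proof. by rewrite lerDl cmod_ge0. Qed.
Let Bg t : cmod (cI t b) <= g t. Proof. by rewrite lerDr cmod_ge0. Qed.
Let cg : {within `[0, 1], continuous g}.
Proof.
by move=> z; apply: cvgD; [exact: (cont_cmod cA)|exact: (cont_cmod cB)].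
Qed.
Let iqg : int01 (fun t => q t * g t).
Proof. by apply: eq_int01 (int01M cg iq) => t _; rewrite mulrC. Qed.
Let iq2g : int01 (fun t => q t ^+ 2 * g t).
Proof. by apply: eq_int01 (int01M cg iq2) => t _; rewrite mulrC. Qed.
Let iqg2 : int01 (fun t => q t * g t ^+ 2).
Proof. by apply: eq_int01 (int01M cg iqg) => t _; ring. Qed.
Let M10 : 0 <= M1. Proof. by apply: rint_ge0 => //; exact: one01. Qed.
Let q20 t : t \in `[0, 1] -> 0 <= q t ^+ 2. Proof. by rewrite sqr_ge0. Qed.
Let qg0 t : t \in `[0, 1] -> 0 <= q t * g t. Proof. by move=> t01; rewrite mulr_ge0 ?q0. Qed.
Let q2g0 t : t \in `[0, 1] -> 0 <= q t ^+ 2 * g t. Proof. by move=> t01; rewrite mulr_ge0 ?q20. Qed.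
Let qg20 t : t \in `[0, 1] -> 0 <= q t * g t ^+ 2. Proof. by move=> t01; rewrite mulr_ge0 ?q0// sqr_ge0. Qed.
Let M20 : 0 <= M2. Proof. by apply: rint_ge0 => //; exact: one01. Qed.
Let J0 : 0 <= J. Proof. by apply: rint_ge0 => //; exact: one01. Qed.
Let K20 : 0 <= K2. Proof. by apply: rint_ge0 => //; exact: one01. Qed.
Let G10 : 0 <= G1. Proof. by apply: rint_ge0 => //; exact: one01. Qed.

Lemma picard_prim : cprim (picard a b c a2 b2 eps) (fun t =>
  a t * picard b a c b2 a2 (- eps) t
  - eps * (c t * picard a b c a2 b2 eps t - a2 t * picard b a c b2 a2 (- eps) t)
  + resid a b c a2 b2 eps t).
Proof.
have p1 := cprimD (cprimD (cprimD (cprim_cst 1) (cprim_I ia)) (cprim_I i2ab)) (cprim_I i3ab).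
have p2 := cprimD (cprimB p1 (cprimZ eps (cprim_I iP))) (cprimZ eps (cprim_I iaP')).
apply: cprim_ext p2 => t _ //.
rewrite /picard /resid /P'; ring.
Qed.

Let cmodMle (z w : R[i]) p r : cmod z <= p -> cmod w <= r -> cmod (z * w) <= p * r.
Proof. by move=> zp wr; rewrite cmodM ler_pM ?cmod_ge0. Qed.

Let fbound f F (h : R -> R) (k l x : R) : x \in `[0, 1] -> cint01 f -> continuous01 F ->
  int01 h -> (forall t, t \in `[0, 1] -> 0 <= h t) -> 0 <= k -> 0 <= l ->
  (forall t, t \in `[0, 1] -> cmod (f t) <= k * h t) ->
  (forall t, t \in `[0, 1] -> cmod (F t) <= l) ->
  cmod (cI x (fun t => f t * F t)) <= k * l * rint 1 h.
Proof.
move=> x01 ff cF ih h0 k0 l0 fh Fl; apply: cI_bound => //.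
- exact: cint01Mr.
- by rewrite mulr_ge0.
- by move=> t t01; rewrite -mulrA (mulrC l) mulrA; apply: cmodMle; [exact: fh|exact: Fl].
Qed.

Let Abound x : x \in `[0, 1] -> cmod (cI x a) <= E * M1.
Proof. by move=> x01; apply: cI_bound. Qed.

Let Hbound x : x \in `[0, 1] -> cmod (iter2 a b x) <= E * J.
Proof.
move=> x01; apply: cI_bound => // t t01.
by rewrite mulrA; apply: cmodMle => //; exact: aE.
Qed.

Let H'bound x : x \in `[0, 1] -> cmod (iter2 b a x) <= E * J.
Proof.
move=> x01; apply: cI_bound => // t t01.
by rewrite mulrA; apply: cmodMle => //; exact: bE.
Qed.

Let ABbound x : x \in `[0, 1] -> cmod (cI x a * cI x b) <= E * J.
Proof.
move=> x01.
have pAB := cprimM (cprim_I ia) (cprim_I ib).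
rewrite -(cprim_cI pAB _ x01) ?cI0 ?mul0r//.
apply: cI_bound => //; first exact: cprim_int pAB.
move=> t t01; apply: le_trans (cmodD _ _) _; rewrite /g !mulrDr addrC.
by apply: lerD; rewrite ?(mulrC (cI t a)) mulrA; apply: cmodMle; rewrite ?aE ?bE.
Qed.

Let EJ0 : 0 <= E * J. Proof. by rewrite mulr_ge0. Qed.
Let EM10 : 0 <= E * M1. Proof. by rewrite mulr_ge0. Qed.

Let Tbound x : x \in `[0, 1] -> cmod (iter3 a b x) <= E * (E * J) * M1.
Proof. by move=> x01; apply: fbound => //; exact: H'bound. Qed.

Let T'bound x : x \in `[0, 1] -> cmod (iter3 b a x) <= E * (E * J) * M1.
Proof. by move=> x01; apply: fbound => //; exact: Hbound. Qed.

Let EM20 : 0 <= 2 * E * M2. Proof. by rewrite !mulr_ge0. Qed.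

Let Pbound x : x \in `[0, 1] -> cmod (P x) <= 2 * E * M2.
Proof.
move=> x01; apply: cI_bound => //; first by rewrite mulr_ge0.
move=> t t01; apply: le_trans (cmodB _ _) _; rewrite -mulrA mulr_natl mulr2n.
by apply: lerD; rewrite ?a2E// (le_trans (cE _))// ler_peMl// q20.
Qed.

Let P'bound x : x \in `[0, 1] -> cmod (P' x) <= 2 * E * M2.
Proof.
move=> x01; apply: cI_bound => //; first by rewrite mulr_ge0.
move=> t t01; apply: le_trans (cmodB _ _) _; rewrite -mulrA mulr_natl mulr2n.
by apply: lerD; rewrite ?b2E// (le_trans (cE _))// ler_peMl// q20.
Qed.

Let Sbound x : x \in `[0, 1] -> cmod (S x) <= E * (2 * E * M2) * M1.
Proof. by move=> x01; apply: fbound => //; exact: P'bound. Qed.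

Let S'bound x : x \in `[0, 1] -> cmod (S' x) <= E * (2 * E * M2) * M1.
Proof. by move=> x01; apply: fbound => //; exact: Pbound. Qed.

(* The term of degree four: two integrations by parts, first of [a] against
   the threefold integral, then of [b] inside it. *)
Let T4bound x : x \in `[0, 1] ->
  cmod (cI x (fun t => a t * iter3 b a t)) <=
  E * J * (E * J) + E * M1 * (E * G1) + E * (E * J) * J.
Proof.
move=> x01.
have iBaB : cint01 (fun t => a t * cI t b * cI t b) by exact: cint01Mr.
have ibHA : cint01 (fun t => b t * iter2 a b t * cI t a) by exact: cint01Mr.
have p1 := cprimB (cprimM (cprim_I ia) (cprim_I i3ba)) (cprim_I ibHA).
have -> : cI x (fun t => a t * iter3 b a t) =
    cI x a * iter3 b a x - cI x (fun t => b t * iter2 a b t * cI t a).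
  rewrite -(cprim_cI p1 _ x01) ?cI0 ?mul0r ?subr0//.
  by apply: eq_cI => // t _; rewrite /iter3; ring.
have p2 := cprimB (cprimM (cprim_I ib) (cprim_I i2ab)) (cprim_I iBaB).
have -> : iter3 b a x = cI x b * iter2 a b x - cI x (fun t => a t * cI t b * cI t b).
  rewrite /iter3 -(cprim_cI p2 _ x01) ?cI0 ?mul0r ?subr0//.
  by apply: eq_cI => // t _; rewrite /iter2; ring.
rewrite mulrBr (mulrA (cI x a)).
apply: le_trans (cmodB _ _) _; apply: lerD.
  apply: le_trans (cmodB _ _) _; apply: lerD.
    by apply: cmodMle; [exact: ABbound|exact: Hbound].
  apply: cmodMle; first exact: Abound.
  apply: cI_bound => // t t01; rewrite expr2 !mulrA.
  by do !apply: cmodMle => //; exact: aE.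
apply: (@le_trans _ _ (E * (E * J) * J)) => //.
apply: cI_bound => //; first by rewrite mulr_ge0.
move=> t t01; rewrite [X in _ <= X](_ : _ = E * q t * (E * J) * g t); last by ring.
by apply: cmodMle => //; apply: cmodMle; [exact: bE|exact: Hbound].
Qed.

(* The term of order eps and degree two, by the same two integrations by parts. *)
Let aSbound x : x \in `[0, 1] ->
  cmod (cI x (fun t => a t * S' t)) <=
  E * J * (2 * E * M2) + E * M1 * (2 * E * K2) + E * (2 * E * M2) * J.
Proof.
move=> x01.
have iBc : cint01 (fun t => (c t - a2 t) * cI t b) by exact: cint01Mr.
have ibPA : cint01 (fun t => b t * P t * cI t a) by exact: cint01Mr.
have p1 := cprimB (cprimM (cprim_I ia) (cprim_I ibP)) (cprim_I ibPA).
have -> : cI x (fun t => a t * S' t) =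
    cI x a * S' x - cI x (fun t => b t * P t * cI t a).
  rewrite -(cprim_cI p1 _ x01) ?cI0 ?mul0r ?subr0//.
  by apply: eq_cI => // t _; rewrite /S' /P; ring.
have p2 := cprimB (cprimM (cprim_I ib) (cprim_I iP)) (cprim_I iBc).
have -> : S' x = cI x b * P x - cI x (fun t => (c t - a2 t) * cI t b).
  rewrite /S' -(cprim_cI p2 _ x01) ?cI0 ?mul0r ?subr0//.
  by apply: eq_cI => // t _; rewrite /P; ring.
rewrite mulrBr (mulrA (cI x a)).
apply: le_trans (cmodB _ _) _; apply: lerD.
  apply: le_trans (cmodB _ _) _; apply: lerD.
    by apply: cmodMle; [exact: ABbound|exact: Pbound].
  apply: cmodMle; first exact: Abound.
  apply: cI_bound => //; first by rewrite mulr_ge0.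
  move=> t t01; rewrite mulrA; apply: cmodMle => //.
  apply: le_trans (cmodB _ _) _; rewrite -mulrA mulr_natl mulr2n.
  by apply: lerD; rewrite ?a2E// (le_trans (cE _))// ler_peMl// q20.
apply: cI_bound => //; first by rewrite mulr_ge0.
move=> t t01; rewrite [X in _ <= X](_ : _ = E * q t * (2 * E * M2) * g t); last by ring.
by apply: cmodMle => //; apply: cmodMle; [exact: bE|exact: Pbound].
Qed.

Lemma resid_le x : x \in `[0, 1] ->
  cmod (cI x (resid a b c a2 b2 eps)) <= resid_bound E M1 M2 J K2 G1 (cmod eps).
Proof.
move=> x01.
have c1 t : t \in `[0, 1] -> cmod (c t) <= 1 * q t ^+ 2 by rewrite mul1r; exact: cE.
have i4 : cint01 (fun t => a t * iter3 b a t) by exact: cint01Mr.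
have i5 : cint01 (fun t => a t * S' t) by exact: cint01Mr.
have icA : cint01 (fun t => c t * cI t a) by exact: cint01Mr.
have iaB : cint01 (fun t => a2 t * cI t b) by exact: cint01Mr.
have icH : cint01 (fun t => c t * iter2 a b t) by exact: cint01Mr.
have iaH : cint01 (fun t => a2 t * iter2 b a t) by exact: cint01Mr.
have icT : cint01 (fun t => c t * iter3 a b t) by exact: cint01Mr.
have iaT : cint01 (fun t => a2 t * iter3 b a t) by exact: cint01Mr.
have icP : cint01 (fun t => c t * P t) by exact: cint01Mr.
have icS : cint01 (fun t => c t * S t) by exact: cint01Mr.
have iaP : cint01 (fun t => a2 t * P' t) by exact: cint01Mr.
have iaS : cint01 (fun t => a2 t * S' t) by exact: cint01Mr.
have s1 := cprimD (cprimN (cprim_I i4)) (cprimZ eps (cprim_I i5)).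
have s2 := cprimZ eps (cprimB (cprimD (cprimB (cprimD (cprimB (cprim_I icA) (cprim_I iaB)) (cprim_I icH)) (cprim_I iaH)) (cprim_I icT)) (cprim_I iaT)).
have s3 := cprimZ (eps ^+ 2) (cprimD (cprimB (cprimD (cprimN (cprim_I icP)) (cprim_I icS)) (cprim_I iaP)) (cprim_I iaS)).
have s := cprimD (cprimD s1 s2) s3.
rewrite (cprim_cI s _ x01); last by rewrite !cI0; ring.
have b4 := T4bound x01.
have b5 := aSbound x01.
have bcA : cmod (cI x (fun t => c t * cI t a)) <= K2.
  rewrite -[leRHS]mul1r; apply: cI_bound => // t t01.
  by rewrite mulrA; apply: cmodMle => //; exact: c1.
have baB : cmod (cI x (fun t => a2 t * cI t b)) <= E * K2.
  by apply: cI_bound => // t t01; rewrite mulrA; apply: cmodMle => //; exact: a2E.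
have bcH : cmod (cI x (fun t => c t * iter2 a b t)) <= 1 * (E * J) * M2.
  by apply: fbound => //; exact: Hbound.
have baH : cmod (cI x (fun t => a2 t * iter2 b a t)) <= E * (E * J) * M2.
  by apply: fbound => //; exact: H'bound.
have bcT : cmod (cI x (fun t => c t * iter3 a b t)) <= 1 * (E * (E * J) * M1) * M2.
  by apply: fbound => //; do ?[by rewrite !mulr_ge0]; exact: Tbound.
have baT : cmod (cI x (fun t => a2 t * iter3 b a t)) <= E * (E * (E * J) * M1) * M2.
  by apply: fbound => //; do ?[by rewrite !mulr_ge0]; exact: T'bound.
have bcP : cmod (cI x (fun t => c t * P t)) <= 1 * (2 * E * M2) * M2.
  by apply: fbound => //; exact: Pbound.
have baP : cmod (cI x (fun t => a2 t * P' t)) <= E * (2 * E * M2) * M2.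
  by apply: fbound => //; exact: P'bound.
have bcS : cmod (cI x (fun t => c t * S t)) <= 1 * (E * (2 * E * M2) * M1) * M2.
  by apply: fbound => //; do ?[by rewrite !mulr_ge0]; exact: Sbound.
have baS : cmod (cI x (fun t => a2 t * S' t)) <= E * (E * (2 * E * M2) * M1) * M2.
  by apply: fbound => //; do ?[by rewrite !mulr_ge0]; exact: S'bound.
have e0 := cmod_ge0 eps.
have B2 : 0 <= E * M2 by rewrite mulr_ge0.
rewrite /resid_bound.
apply: le_trans (cmodD _ _) _; apply: lerD; last first.
  rewrite cmodM cmodX; apply: ler_wpM2l; first by rewrite sqr_ge0.
  apply: le_trans (cmodD _ _) _.
  have := cmodB (- cI x (fun t => c t * P t) + cI x (fun t => c t * S t)) (cI x (fun t => a2 t * P' t)).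
  have := cmodD (- cI x (fun t => c t * P t)) (cI x (fun t => c t * S t)).
  rewrite cmodN.
  have : 1 * (2 * E * M2) * M2 <= 2 * (E ^+ 2 * M2 ^+ 2).
    rewrite [leLHS](_ : _ = 2 * (1 * (E * M2 ^+ 2))); last by ring.
    by rewrite ler_pM2l// expr2 -mulrA ler_wpM2r// mulr_ge0// sqr_ge0.
  have : 1 * (E * (2 * E * M2) * M1) * M2 <= 2 * (E ^+ 3 * M1 * M2 ^+ 2).
    rewrite [leLHS](_ : _ = 2 * (1 * (E ^+ 2 * M1 * M2 ^+ 2))); last by ring.
    rewrite [leRHS](_ : _ = 2 * (E * (E ^+ 2 * M1 * M2 ^+ 2))); last by ring.
    by rewrite ler_pM2l// ler_wpM2r// !mulr_ge0// sqr_ge0.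
  have E3 : E * (E * (2 * E * M2) * M1) * M2 = 2 * (E ^+ 3 * M1 * M2 ^+ 2) by ring.
  have E4 : E * (2 * E * M2) * M2 = 2 * (E ^+ 2 * M2 ^+ 2) by ring.
  rewrite E3 in baS; rewrite E4 in baP.
  lra.
apply: le_trans (cmodD _ _) _; apply: lerD; last first.
  rewrite cmodM; apply: ler_wpM2l => //.
  have := cmodB (cI x (fun t => c t * cI t a) - cI x (fun t => a2 t * cI t b)
    + cI x (fun t => c t * iter2 a b t) - cI x (fun t => a2 t * iter2 b a t)
    + cI x (fun t => c t * iter3 a b t)) (cI x (fun t => a2 t * iter3 b a t)).
  have := cmodD (cI x (fun t => c t * cI t a) - cI x (fun t => a2 t * cI t b)
    + cI x (fun t => c t * iter2 a b t) - cI x (fun t => a2 t * iter2 b a t))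
    (cI x (fun t => c t * iter3 a b t)).
  have := cmodB (cI x (fun t => c t * cI t a) - cI x (fun t => a2 t * cI t b)
    + cI x (fun t => c t * iter2 a b t)) (cI x (fun t => a2 t * iter2 b a t)).
  have := cmodD (cI x (fun t => c t * cI t a) - cI x (fun t => a2 t * cI t b))
    (cI x (fun t => c t * iter2 a b t)).
  have := cmodB (cI x (fun t => c t * cI t a)) (cI x (fun t => a2 t * cI t b)).
  have : K2 <= E * K2 by rewrite ler_peMl.
  have : 1 * (E * J) * M2 <= E ^+ 2 * M2 * J.
    rewrite [leLHS](_ : _ = 1 * (E * M2 * J)); last by ring.
    rewrite [leRHS](_ : _ = E * (E * M2 * J)); last by ring.
    by rewrite ler_wpM2r// !mulr_ge0.
  have : 1 * (E * (E * J) * M1) * M2 <= E ^+ 3 * M1 * M2 * J.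
    rewrite [leLHS](_ : _ = 1 * (E ^+ 2 * M1 * M2 * J)); last by ring.
    rewrite [leRHS](_ : _ = E * (E ^+ 2 * M1 * M2 * J)); last by ring.
    by rewrite ler_wpM2r// !mulr_ge0// sqr_ge0.
  have E3 : E * (E * (E * J) * M1) * M2 = E ^+ 3 * M1 * M2 * J by ring.
  have E4 : E * (E * J) * M2 = E ^+ 2 * M2 * J by ring.
  rewrite E3 in baT; rewrite E4 in baH.
  lra.
apply: le_trans (cmodD _ _) _; apply: lerD; last first.
  rewrite cmodM; apply: ler_wpM2l => //; apply: le_trans b5 _.
  have : E * J * (2 * E * M2) + E * M1 * (2 * E * K2) + E * (2 * E * M2) * J =
    4 * (E ^+ 2 * J * M2) + 2 * (E ^+ 2 * M1 * K2) by ring.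
  move=> ->; rewrite lerD2r ler_wpM2r ?ler_nat// !mulr_ge0// sqr_ge0.
rewrite cmodN; apply: le_trans b4 _.
have -> : E * J * (E * J) + E * M1 * (E * G1) + E * (E * J) * J =
    2 * (E ^+ 2 * J ^+ 2) + E ^+ 2 * M1 * G1 by ring.
by rewrite lerD2r ler_wpM2r ?ler_nat// !mulr_ge0// sqr_ge0.
Qed.

End Residual.

(** * Comparison of the system with the truncated series *)

Section Comparison.
Context {R : realType}.
Variables (a b c a2 b2 : R -> R[i]) (eps : R[i]) (q : R -> R) (E : R).
Hypotheses (ia : cint01 a) (ib : cint01 b) (ic : cint01 c) (ia2 : cint01 a2) (ib2 : cint01 b2).
Hypotheses (E1 : 1 <= E) (q0 : forall t, t \in `[0, 1] -> 0 <= q t).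
Hypotheses (iq : int01 q) (iq2 : int01 (fun t => q t ^+ 2)).
Hypotheses (aE : forall t, t \in `[0, 1] -> cmod (a t) <= E * q t).
Hypotheses (bE : forall t, t \in `[0, 1] -> cmod (b t) <= E * q t).
Hypotheses (cE : forall t, t \in `[0, 1] -> cmod (c t) <= q t ^+ 2).
Hypotheses (a2E : forall t, t \in `[0, 1] -> cmod (a2 t) <= E * q t ^+ 2).
Hypotheses (b2E : forall t, t \in `[0, 1] -> cmod (b2 t) <= E * q t ^+ 2).
Let g (t : R) : R := cmod (cI t a) + cmod (cI t b).
Let Qb := resid_bound E (rint 1 q) (rint 1 (fun t => q t ^+ 2)) (rint 1 (fun t => q t * g t))
     (rint 1 (fun t => q t ^+ 2 * g t)) (rint 1 (fun t => q t * g t ^+ 2)) (cmod eps).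

(** The differences between the amplitudes and their truncated series solve the
    system perturbed by the residuals, with zero initial values, so that the sum
    of their moduli obeys an integral inequality of Gronwall type. *)
Lemma system_picard (wp wm : R -> R[i]) :
  cprim wp (fun t => a t * wm t - eps * (c t * wp t - a2 t * wm t)) ->
  cprim wm (fun t => b t * wp t + eps * (c t * wm t - b2 t * wp t)) ->
  wp 0 = 1 -> wm 0 = 1 ->
  forall x, x \in `[0, 1] ->
  cmod (wp x - picard a b c a2 b2 eps x) + cmod (wm x - picard b a c b2 a2 (- eps) x) <=
  2 * Qb * expR (2 * (E * rint 1 q + cmod eps * E * rint 1 (fun t => q t ^+ 2))).
Proof.
move=> pwp pwm wp0 wm0.
pose Up := picard a b c a2 b2 eps; pose Um := picard b a c b2 a2 (- eps).
have pUp : cprim Up _ := picard_prim eps ia ib ic ia2 ib2.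
have pUm : cprim Um _ := picard_prim (- eps) ib ia ic ib2 ia2.
have Up0 : Up 0 = 1 by rewrite /Up /picard /iter3 /iter2 !cI0; ring.
have Um0 : Um 0 = 1 by rewrite /Um /picard /iter3 /iter2 !cI0; ring.
pose Dp x := wp x - Up x; pose Dm x := wm x - Um x.
have pDp : cprim Dp _ := cprimB pwp pUp.
have pDm : cprim Dm _ := cprimB pwm pUm.
have cDp := cprim_cont pDp; have cDm := cprim_cont pDm.
pose n x := cmod (Dp x) + cmod (Dm x).
have cn : {within `[0, 1], continuous n}.
  by move=> z; apply: cvgD; [exact: (cont_cmod cDp)|exact: (cont_cmod cDm)].
have E0 : 0 <= E by exact: le_trans E1.
have n0 t : 0 <= n t by rewrite addr_ge0 ?cmod_ge0.
pose al t := E * q t + cmod eps * E * q t ^+ 2.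
have ial : int01 al by apply: int01D; exact: int01Z.
have al0 t : t \in `[0, 1] -> 0 <= al t.
  by move=> t01; rewrite addr_ge0 ?mulr_ge0 ?cmod_ge0 ?q0 ?sqr_ge0.
have ialn : int01 (fun t => al t * n t).
  by apply: eq_int01 (int01M cn ial) => t _; rewrite mulrC.
have Qp x : x \in `[0, 1] -> cmod (cI x (resid a b c a2 b2 eps)) <= Qb.
  by move=> x01; exact: resid_le.
have Qm x : x \in `[0, 1] -> cmod (cI x (resid b a c b2 a2 (- eps))) <= Qb.
  move=> x01; rewrite /Qb -(cmodN eps).
  rewrite (eq_rint one01 (_ : forall t, t \in `[0, 1] -> q t * g t = q t * (cmod (cI t b) + cmod (cI t a)))); last first.
    by move=> t _; rewrite /g addrC.
  rewrite (eq_rint one01 (_ : forall t, t \in `[0, 1] -> q t ^+ 2 * g t = q t ^+ 2 * (cmod (cI t b) + cmod (cI t a)))); last first.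
    by move=> t _; rewrite /g addrC.
  rewrite (eq_rint one01 (_ : forall t, t \in `[0, 1] -> q t * g t ^+ 2 = q t * (cmod (cI t b) + cmod (cI t a)) ^+ 2)); last first.
    by move=> t _; rewrite /g addrC.
  exact: resid_le.
have ip : cint01 (fun t => a t * Dm t - eps * (c t * Dp t - a2 t * Dm t)).
  apply: cint01B; first exact: cint01Mr.
  by apply: cint01Z; apply: cint01B; exact: cint01Mr.
have im : cint01 (fun t => b t * Dp t + eps * (c t * Dm t - b2 t * Dp t)).
  apply: cint01D; first exact: cint01Mr.
  by apply: cint01Z; apply: cint01B; exact: cint01Mr.
have irp : cint01 (resid a b c a2 b2 eps).
  have := cprim_int (cprimB (cprimB pwp pUp) (cprim_I ip)).
  move=> /cint01N; apply: eq_cint01 => t _; rewrite /Dp /Dm /Up /Um; ring.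
have irm : cint01 (resid b a c b2 a2 (- eps)).
  have := cprim_int (cprimB (cprimB pwm pUm) (cprim_I im)).
  move=> /cint01N; apply: eq_cint01 => t _; rewrite /Dp /Dm /Up /Um opprK; ring.
have Dpx x : x \in `[0, 1] -> cmod (Dp x) <= Qb + rint x (fun t => al t * n t).
  move=> x01.
  rewrite -(cprim_cI pDp _ x01); last by rewrite /Dp wp0 Up0 subrr.
  rewrite (eq_cI x01 (_ : forall t, t \in `[0, 1] -> _ =
    (a t * Dm t - eps * (c t * Dp t - a2 t * Dm t)) - resid a b c a2 b2 eps t)); last first.
    by move=> t _; rewrite /Dp /Dm /Up /Um; ring.
  rewrite cIB//; apply: le_trans (cmodB _ _) _; rewrite addrC; apply: lerD; first exact: Qp.
  apply: cI_le => // t t01.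
  have h1 : cmod (a t * Dm t) <= E * q t * n t.
    by rewrite cmodM; apply: ler_pM; rewrite ?cmod_ge0 ?aE// lerDr cmod_ge0.
  have h2 : cmod (c t * Dp t) <= E * q t ^+ 2 * cmod (Dp t).
    rewrite cmodM; apply: ler_wpM2r; rewrite ?cmod_ge0//; apply: le_trans (cE t01) _.
    by rewrite ler_peMl// sqr_ge0.
  have h3 : cmod (a2 t * Dm t) <= E * q t ^+ 2 * cmod (Dm t).
    by rewrite cmodM; apply: ler_wpM2r; rewrite ?cmod_ge0 ?a2E.
  apply: le_trans (cmodB _ _) _; rewrite (cmodM eps) /al mulrDl; apply: lerD => //.
  rewrite -!mulrA; apply: ler_wpM2l; rewrite ?cmod_ge0//.
  apply: le_trans (cmodB _ _) _; rewrite [leRHS](_ : _ = E * q t ^+ 2 * cmod (Dp t) + E * q t ^+ 2 * cmod (Dm t)); [exact: lerD|rewrite /n; ring].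
have Dmx x : x \in `[0, 1] -> cmod (Dm x) <= Qb + rint x (fun t => al t * n t).
  move=> x01.
  rewrite -(cprim_cI pDm _ x01); last by rewrite /Dm wm0 Um0 subrr.
  rewrite (eq_cI x01 (_ : forall t, t \in `[0, 1] -> _ =
    (b t * Dp t + eps * (c t * Dm t - b2 t * Dp t)) - resid b a c b2 a2 (- eps) t)); last first.
    by move=> t _; rewrite /Dp /Dm /Up /Um opprK; ring.
  rewrite cIB//; apply: le_trans (cmodB _ _) _; rewrite addrC; apply: lerD; first exact: Qm.
  apply: cI_le => // t t01.
  have h1 : cmod (b t * Dp t) <= E * q t * n t.
    by rewrite cmodM; apply: ler_pM; rewrite ?cmod_ge0 ?bE// lerDl cmod_ge0.
  have h2 : cmod (c t * Dm t) <= E * q t ^+ 2 * cmod (Dm t).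
    rewrite cmodM; apply: ler_wpM2r; rewrite ?cmod_ge0//; apply: le_trans (cE t01) _.
    by rewrite ler_peMl// sqr_ge0.
  have h3 : cmod (b2 t * Dp t) <= E * q t ^+ 2 * cmod (Dp t).
    by rewrite cmodM; apply: ler_wpM2r; rewrite ?cmod_ge0 ?b2E.
  apply: le_trans (cmodD _ _) _; rewrite (cmodM eps) /al mulrDl; apply: lerD => //.
  rewrite -!mulrA; apply: ler_wpM2l; rewrite ?cmod_ge0//.
  apply: le_trans (cmodB _ _) _; rewrite [leRHS](_ : _ = E * q t ^+ 2 * cmod (Dm t) + E * q t ^+ 2 * cmod (Dp t)); [exact: lerD|rewrite /n; ring].
have Qb0 : 0 <= Qb by exact: le_trans (cmod_ge0 _) (Qp 0 zero01).
have ial2 : int01 (fun t => 2 * al t) by exact: int01Z.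
move=> x x01.
have -> : 2 * (E * rint 1 q + cmod eps * E * rint 1 (fun t => q t ^+ 2)) =
   rint 1 (fun t => 2 * al t).
  by rewrite rintZ ?one01// rintD ?one01 ?rintZ ?one01//; exact: int01Z.
apply: (@gronwall _ n (fun t => 2 * al t)) => //.
- by move=> t t01; rewrite mulr_ge0 ?al0.
- by rewrite mulr_ge0.
- move=> z z01; have := Dpx z z01; have := Dmx z z01.
  rewrite (eq_rint z01 (_ : forall t, t \in `[0, 1] -> 2 * al t * n t = 2 * (al t * n t))); last first.
    by move=> t _; rewrite mulrA.
  rewrite rintZ// /n; move: (rint z _) => I1; lra.
Qed.
End Comparison.

(** * Reflections and Fubini for complex-valued functions *)

Section Reflection.
Context {R : realType}.
Notation mu := (@lebesgue_measure R).
Notation TR := (measurableTypeR R).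

(** The reflection u |-> c - u, as a map of measurable spaces, so that it can
    be used to push measures forward. *)
Definition reflection (c : R) : TR -> TR := fun u => c - u.

Lemma measurable_reflection (c : R) : measurable_fun [set: TR] (reflection c).
Proof. exact: measurable_funB. Qed.

HB.instance Definition _ (c : R) :=
  isMeasurableFun.Build _ _ TR TR (reflection c) (measurable_reflection c).

Lemma preimage_reflection_itv (c a b : R) :
  reflection c @^-1` `]a, b] = `[c - b, c - a[%classic.
Proof.
by apply/seteqP; split => u; rewrite /reflection /= !in_itv/= => /andP[? ?];
  apply/andP; split; lra.
Qed.

Lemma lebesgue_measure_reflection (c : R) (A : set TR) : measurable A ->
  pushforward mu (reflection c) A = mu A.
Proof.
move=> mA; apply/esym/lebesgue_measure_unique => //= _ [[a b]] _ <-.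
rewrite /pushforward preimage_reflection_itv !lebesgue_measure_itv/=.
rewrite !lte_fin ltrD2l ltrN2 -!EFinD; case: ifP => // _; congr (_%:E); ring.
Qed.

(** No integrability is assumed: the positive and the negative part are treated
    separately. *)
Lemma integral_reflection (c : R) (f : TR -> \bar R) : measurable_fun [set: TR] f ->
  (\int[mu]_u f (c - u)%R = \int[mu]_u f u)%E.
Proof.
have ge0 g : measurable_fun [set: TR] g -> (forall u, 0 <= g u)%E ->
    (\int[mu]_u g (c - u)%R = \int[mu]_u g u)%E.
  move=> mg g0.
  transitivity (\int[mu]_(u in reflection c @^-1` setT) (g \o reflection c) u)%E.
    by rewrite preimage_setT.
  rewrite -ge0_integral_pushforward//.
  by apply: eq_measure_integral => A mA _; exact: lebesgue_measure_reflection.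
move=> mf; rewrite [LHS]integralE [RHS]integralE; congr (_ - _)%E.
  have <- := ge0 f^\+%E (measurable_funepos mf) (funepos_ge0 f).
  by apply: eq_integral => u _; rewrite funepos_comp.
have <- := ge0 f^\-%E (measurable_funeneg mf) (funeneg_ge0 f).
by apply: eq_integral => u _; rewrite funeneg_comp.
Qed.

End Reflection.

Section ComplexFubini.
Context {R : realType}.
Notation mu := (@lebesgue_measure R).
Notation TR := (measurableTypeR R).
Notation Re := complex.Re.
Notation Im := complex.Im.

(** Measurability of a complex-valued function. *)
Definition measC d (T : measurableType d) (f : T -> R[i]) : Prop :=
  measurable_fun [set: T] (fun t => Re (f t)) /\ measurable_fun [set: T] (fun t => Im (f t)).

(** The integral over the whole line. Integrals over intervals are written as
    integrals over the line of a function cut off by a boolean condition, so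
    that changes of variables and of the order of integration only affect the
    condition. *)
Definition integralC (f : TR -> R[i]) : R[i] :=
  Complex (\int[mu]_t Re (f t)) (\int[mu]_t Im (f t)).

(** Integrability over the whole line. *)
Definition integrableC (f : TR -> R[i]) : Prop :=
  mu.-integrable setT (fun t => (Re (f t))%:E) /\ mu.-integrable setT (fun t => (Im (f t))%:E).

Lemma measC_comp d d' (T : measurableType d) (T' : measurableType d') (f : T -> R[i])
   (phi : T' -> T) : measC f -> measurable_fun [set: T'] phi -> measC (fun t => f (phi t)).
Proof. by move=> [mR mJ] mp; split; [exact: measurableT_comp mR mp|exact: measurableT_comp mJ mp]. Qed.

Lemma measCM d (T : measurableType d) (f g : T -> R[i]) : measC f -> measC g -> measC (fun t => f t * g t).
Proof.
move=> [fR fJ] [gR gJ]; split.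
  rewrite (_ : (fun t => Re (f t * g t)) = (fun t => Re (f t) * Re (g t) - Im (f t) * Im (g t))); last first.
    by apply/funext => t; rewrite cReM.
  by apply: measurable_funB; exact: measurable_funM.
rewrite (_ : (fun t => Im (f t * g t)) = (fun t => Re (f t) * Im (g t) + Im (f t) * Re (g t))); last first.
  by apply/funext => t; rewrite cImM.
by apply: measurable_funD; exact: measurable_funM.
Qed.

Lemma measC_if d (T : measurableType d) (p : T -> bool) (f : T -> R[i]) :
  measurable_fun [set: T] p -> measC f -> measC (fun t => if p t then f t else 0).
Proof.
move=> mp [fR fJ]; split.
  rewrite (_ : (fun t => _) = (fun t => if p t then Re (f t) else 0)); last first.
    by apply/funext => t; case: ifP.
  exact: measurable_fun_ifT.
rewrite (_ : (fun t => _) = (fun t => if p t then Im (f t) else 0)); last first.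
  by apply/funext => t; case: ifP.
exact: measurable_fun_ifT.
Qed.

Lemma eq_integralC f g : (forall t, f t = g t) -> integralC f = integralC g.
Proof. by move=> fg; congr integralC; apply/funext. Qed.

Lemma cint_integralC (a b : R) (f : R -> R[i]) :
  cint a b f = integralC (fun t => if a <= t <= b then f t else 0).
Proof.
rewrite /cint /integralC Rintegral_mkcond [in X in Complex _ X]Rintegral_mkcond.
congr Complex; apply: eq_Rintegral => t _; rewrite patchE.
  by rewrite mem_setE in_itv/=; case: ifP.
by rewrite mem_setE in_itv/=; case: ifP.
Qed.

Lemma measC_cmod d (T : measurableType d) (f : T -> R[i]) : measC f ->
  measurable_fun [set: T] (fun t => cmod (f t)).
Proof.
move=> [mR mJ].
rewrite (_ : (fun x => cmod (f x)) = Num.sqrt \o (fun x => Re (f x) ^+ 2 + Im (f x) ^+ 2)); last first.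
  by apply/funext => x; rewrite cmodE.
have mS : measurable_fun [set: R] (@Num.sqrt R) by apply: continuous_measurable_fun; exact: sqrt_continuous.
apply: (measurableT_comp mS).
by apply: measurable_funD; exact: measurable_funX.
Qed.

Lemma integrableC_le (f : TR -> R[i]) (B : R) : measC f ->
  (\int[mu]_t (cmod (f t))%:E <= B%:E)%E -> integrableC f.
Proof.
move=> mf fB.
have mcf := measC_cmod mf.
have ic : mu.-integrable setT (fun t => (cmod (f t))%:E).
  apply/integrableP; split; first exact/measurable_EFinP.
  rewrite (eq_integral (fun t => (cmod (f t))%:E)).
    exact: le_lt_trans fB (ltry B).
  by move=> t _ /=; rewrite ger0_norm ?cmod_ge0.
case: mf => mR mJ.
split; (apply: le_integrable ic => //; first exact/measurable_EFinP) => t _ /=; rewrite lee_fin.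
  by rewrite (ger0_norm (cmod_ge0 _)) Re_le_cmod.
by rewrite (ger0_norm (cmod_ge0 _)) Im_le_cmod.
Qed.

Lemma integralC_Z (k : R[i]) f : integrableC f -> integralC (fun t => k * f t) = k * integralC f.
Proof.
have iZ (r : R) (g : TR -> R) : mu.-integrable setT (fun t => (g t)%:E) ->
    mu.-integrable setT (EFin \o (fun t => r * g t)).
  by move=> ig; apply: eq_integrable (integrableZl measurableT r ig).
move=> [fR fJ]; apply: complex_eq.
  rewrite cReM/= -!RintegralZl// -RintegralB//; try exact: iZ.
  by apply: eq_Rintegral => t _; rewrite cReM.
rewrite cImM/= -!RintegralZl// -RintegralD//; try exact: iZ.
by apply: eq_Rintegral => t _; rewrite cImM.
Qed.

Lemma integralC_reflection (c : R) f : measC f -> integralC (fun u => f (c - u)) = integralC f.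
Proof.
move=> [mR mJ]; rewrite /integralC /Rintegral.
by rewrite (integral_reflection c (f := fun t => (Re (f t))%:E)) ?(integral_reflection c (f := fun t => (Im (f t))%:E))//;
   exact/measurable_EFinP.
Qed.

Lemma integralC_shift (c : R) f : measC f -> integralC (fun u => f (u + c)) = integralC f.
Proof.
move=> mf; have m1 : measC (fun u : TR => f (0 - u)).
  by apply: (measC_comp mf); exact: (measurable_reflection 0).
rewrite -(integralC_reflection 0 mf) -(integralC_reflection (- c) m1).
by apply: eq_integralC => t; congr f; ring.
Qed.

Lemma measC_integralC d (T : measurableType d) (F : T -> TR -> R[i]) :
  measC (fun z : T * TR => F z.1 z.2) -> measC (fun z => integralC (F z)).
Proof.
have key (G : T * TR -> R) : measurable_fun [set: T * TR] G ->
    measurable_fun [set: T] (fun z => \int[mu]_t G (z, t)).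
  move=> mG; rewrite /Rintegral.
  apply: measurableT_comp; first exact: fine_measurable.
  have mE : measurable_fun [set: T * TR] (EFin \o G) by exact/measurable_EFinP.
  rewrite (_ : (fun z => _) = (fun z => \int[mu]_t ((EFin \o G)^\+ (z, t)) -
      \int[mu]_t ((EFin \o G)^\- (z, t)))%E); last first.
    apply/funext => z; rewrite integralE; congr (_ - _)%E; apply: eq_integral => t _.
      exact: (congr1 (fun h => h t) (funepos_comp (EFin \o G) (fun t => (z, t)))).
    exact: (congr1 (fun h => h t) (funeneg_comp (EFin \o G) (fun t => (z, t)))).
  apply: emeasurable_funB.
    by apply: (measurable_fun_fubini_tonelli_F (EFin \o G)^\+%E) => //; exact: measurable_funepos.
  by apply: (measurable_fun_fubini_tonelli_F (EFin \o G)^\-%E) => //; exact: measurable_funeneg.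
move=> [mR mJ]; split.
  exact: (key _ mR).
exact: (key _ mJ).
Qed.

Lemma integral_shift (c : R) (f : TR -> \bar R) : measurable_fun [set: TR] f ->
  (\int[mu]_u f (u + c)%R = \int[mu]_u f u)%E.
Proof.
move=> mf.
have m1 : measurable_fun [set: TR] (fun u : TR => f (0 - u)%R).
  by apply: (measurableT_comp mf); exact: (measurable_reflection 0).
rewrite -(integral_reflection 0 mf) -(integral_reflection (- c) m1).
by apply: eq_integral => t _; congr f; ring.
Qed.

Lemma integralC_le (f : TR -> R[i]) (B : R) : measC f ->
  (\int[mu]_t (cmod (f t))%:E <= B%:E)%E -> cmod (integralC f) <= 2 * B.
Proof.
move=> mf fB; have [iR iJ] := integrableC_le mf fB.
have mcf := measC_cmod mf.
have key (g : TR -> R) : mu.-integrable setT (fun t => (g t)%:E) ->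
    (forall t, `|g t| <= cmod (f t)) -> `|\int[mu]_t g t| <= B.
  move=> ig gf; rewrite -lee_fin EFin_normr_Rintegral//.
  apply: le_trans (le_abse_integral _ _ _) _ => //; first exact: measurable_int ig.
  apply: le_trans fB; apply: ge0_le_integral => //.
  - by apply: measurableT_comp => //; exact: measurable_int ig.
  - exact/measurable_EFinP.
  - by move=> t _ /=; rewrite lee_fin gf.
apply: le_trans (cmod_le_ReIm _) _; rewrite mulr_natl mulr2n; apply: lerD.
  by apply: key => // t; exact: Re_le_cmod.
by apply: key => // t; exact: Im_le_cmod.
Qed.

Lemma integralC_0 f : (forall t, f t = 0) -> integralC f = 0.
Proof.
move=> f0; rewrite /integralC /Rintegral; congr Complex.
  by rewrite integral0_eq// => t _; rewrite f0.
by rewrite integral0_eq// => t _; rewrite f0.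
Qed.

Lemma integrableC_cint01 (x : R) (f : R -> R[i]) : x \in `[0, 1] -> cint01 f ->
  integrableC (fun t => if 0 <= t <= x then f t else 0).
Proof.
move=> x01 [rf jf].
have key (g : R -> R) : int01 g -> mu.-integrable setT (fun t => ((g \_ `[0, x]) t)%:E).
  move=> ig; rewrite (_ : (fun t => _) = EFin \o g \_ `[0, x])//.
  rewrite -restrict_EFin; apply/integrable_restrict => //=; rewrite setTI.
  exact: int01_sub.
split.
  rewrite (_ : (fun t => _) = (fun t => (((fun t => Re (f t)) \_ `[0, x]) t)%:E)); first exact: key.
  by apply/funext => t; rewrite patchE mem_setE in_itv/=; case: ifP.
rewrite (_ : (fun t => _) = (fun t => (((fun t => Im (f t)) \_ `[0, x]) t)%:E)); first exact: key.
by apply/funext => t; rewrite patchE mem_setE in_itv/=; case: ifP.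
Qed.

Lemma cint01_integrableC (f : TR -> R[i]) : integrableC f -> cint01 f.
Proof. by move=> [rf jf]; split; [apply: integrableS rf|apply: integrableS jf]. Qed.

Lemma int01_itv (f : R -> R) : int01 f ->
  mu.-integrable setT (fun t => (if 0 <= t <= 1 then f t else 0)%:E) /\
  (\int[mu]_t (if 0 <= t <= 1 then f t else 0)%:E = (rint 1 f)%:E)%E.
Proof.
move=> ff.
have e : (fun t => (if 0 <= t <= 1 then f t else 0)%:E) = (EFin \o f) \_ `[0, 1].
  by apply/funext => t; rewrite patchE mem_setE in_itv/=; case: ifP.
rewrite e; split.
  by apply/integrable_restrict => //=; rewrite setTI.
rewrite -integral_mkcond rint.unlock /Rintegral fineK//.
exact: integrable_fin_num.
Qed.

(** Fubini's theorem for a kernel [K] whose partial integrals of the modulus are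
    dominated by an integrable function [p]. *)
Section fubini.
Variables (K : TR -> TR -> R[i]) (p : TR -> R).
Hypothesis mK : measC (fun z : TR * TR => K z.1 z.2).
Hypothesis ip : mu.-integrable setT (fun t => (p t)%:E).
Hypothesis Kp : forall t, (\int[mu]_u (cmod (K t u))%:E <= (p t)%:E)%E.

Let Rfubini (G : TR * TR -> R) : measurable_fun [set: TR * TR] G ->
  (forall t u, `|G (t, u)| <= cmod (K t u)) ->
  \int[mu]_t (\int[mu]_u G (t, u)) = \int[mu]_u (\int[mu]_t G (t, u)) /\
  mu.-integrable setT (fun t => (\int[mu]_u G (t, u))%:E).
Proof.
move=> mG GK.
have mE : measurable_fun [set: TR * TR] (EFin \o G) by exact/measurable_EFinP.
have mcK : measurable_fun [set: TR * TR] (fun z => (cmod (K z.1 z.2))%:E).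
  exact/measurable_EFinP/measC_cmod.
have p0 t : (0 <= (p t)%:E)%E.
  by apply: le_trans (Kp t); apply: integral_ge0 => u _; rewrite lee_fin cmod_ge0.
have bt t : (\int[mu]_u `|(EFin \o G) (t, u)| <= (p t)%:E)%E.
  apply: le_trans (Kp t); apply: ge0_le_integral => //.
  - by apply: measurableT_comp => //; exact: measurable_fun_pair2.
  - exact: (measurable_fun_pair2 _ mcK).
  - by move=> u _ /=; rewrite lee_fin GK.
have iG : (mu \x mu)%E.-integrable setT (EFin \o G).
  apply/integrable12ltyP => //.
  apply: (@le_lt_trans _ _ (\int[mu]_t `|(p t)%:E|)%E); last by case/integrableP : ip.
  apply: ge0_le_integral => //.
  - by move=> t _; apply: integral_ge0.
  - apply: (measurable_fun_fubini_tonelli_F (abse \o (EFin \o G))).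
      exact: measurableT_comp.
    by move=> z; exact: abse_ge0.
  - by apply: measurableT_comp => //; exact: measurable_int ip.
  - by move=> t _; apply: le_trans (bt t) _; rewrite gee0_abs.
have F1 t : ((\int[mu]_u G (t, u))%:E = \int[mu]_u (G (t, u))%:E)%E.
  rewrite /Rintegral fineK//.
  apply: integrable_fin_num => //; apply/integrableP; split.
    exact: (measurable_fun_pair2 _ mE).
  exact: le_lt_trans (bt t) (ltry _).
split.
  rewrite {1}/Rintegral; under eq_integral do rewrite F1.
  rewrite [LHS](_ : _ = fine (\int[mu]_t \int[mu]_u (EFin \o G) (t, u))%E)//.
  rewrite Fubini//; rewrite [RHS]/Rintegral; congr fine.
  have iF := integral21_prod_meas1 iG.
  apply: ae_eq_integral => //.
  - exact: (measurable_fubini_G iG).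
  - apply/measurable_EFinP; apply: measurableT_comp; first exact: fine_measurable.
    exact: (measurable_fubini_G iG).
  have := ae_integrable2 iG; apply: filterS.
  move=> u iu _; rewrite /Rintegral fineK//; exact: integrable_fin_num.
rewrite (_ : (fun t => _) = fubini_F mu (EFin \o G)); last by apply/funext => t; rewrite F1.
exact: integrable_fubini_F iG.
Qed.

Lemma integralC_fubini : integralC (fun t => integralC (K t)) = integralC (fun u => integralC (fun t => K t u)).
Proof.
case: mK => mR mJ.
have [e1 _] := Rfubini mR (fun t u => Re_le_cmod (K t u)).
have [e2 _] := Rfubini mJ (fun t u => Im_le_cmod (K t u)).
by apply: complex_eq; [exact: e1|exact: e2].
Qed.

Lemma integrableC_integralC : integrableC (fun t => integralC (K t)).
Proof.
case: mK => mR mJ.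
have [_ e1] := Rfubini mR (fun t u => Re_le_cmod (K t u)).
by have [_ e2] := Rfubini mJ (fun t u => Im_le_cmod (K t u)).
Qed.
End fubini.

End ComplexFubini.

(** * The kernel N as a threefold iterated integral *)

Section SquareIntegrable.
Context {R : realType}.

Lemma int01_cst (c : R) : int01 (fun=> c).
Proof. by apply: int01_cont; apply: continuous_subspaceT => ?; exact: cvg_cst. Qed.

Variable sigma : R -> R[i].
Hypothesis mRs : measurable_fun `[0 : R, 1] (fun t => complex.Re (sigma t)).
Hypothesis mIs : measurable_fun `[0 : R, 1] (fun t => complex.Im (sigma t)).
Hypothesis iq2 : int01 (fun t => cmod (sigma t) ^+ 2).

Lemma sqr_int_cint01 : cint01 sigma.
Proof.
apply: (cint01_le mRs mIs (int01D (int01_cst 1) iq2)) => t _.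
have := sqr_ge0 (cmod (sigma t) - 1); have := cmod_ge0 (sigma t).
have -> : (cmod (sigma t) - 1) ^+ 2 = cmod (sigma t) ^+ 2 - 2 * cmod (sigma t) + 1 by ring.
move: (cmod (sigma t)) => B; rewrite -![B ^+ 2]/(B ^+ 2); lra.
Qed.

Lemma sqr_int_cint01_sqr : cint01 (fun t => sigma t ^+ 2).
Proof.
apply: (cint01_le _ _ iq2).
- rewrite (_ : (fun t => _) = (fun t => complex.Re (sigma t) ^+ 2 - complex.Im (sigma t) ^+ 2)).
    by apply: measurable_funB; exact: measurable_funX.
  by apply/funext => t; rewrite expr2 cReM !expr2.
- rewrite (_ : (fun t => _) = (fun t => complex.Re (sigma t) * complex.Im (sigma t) + complex.Im (sigma t) * complex.Re (sigma t))).
    by apply: measurable_funD; exact: measurable_funM.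
  by apply/funext => t; rewrite expr2 cImM.
- by move=> t _; rewrite cmodX.
Qed.

End SquareIntegrable.

Section NkerIdentity.
Context {R : realType}.
Notation mu := (@lebesgue_measure R).
Notation TR := (measurableTypeR R).
Variables (sigma : R -> R[i]) (k : R[i]) (x : R).
Hypothesis x01 : x \in `[0, 1].
Hypothesis mRs : measurable_fun `[0 : R, 1] (fun t => complex.Re (sigma t)).
Hypothesis mIs : measurable_fun `[0 : R, 1] (fun t => complex.Im (sigma t)).
Hypothesis iq2 : int01 (fun t => cmod (sigma t) ^+ 2).
Let M2 := rint 1 (fun t => cmod (sigma t) ^+ 2).
(* sigma, extended by 0 to the whole line. *)
Let s : TR -> R[i] := fun t => if 0 <= t <= 1 then sigma t else 0.
Let Ck := expR `|complex.Re k|.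

Let x0 : 0 <= x. Proof. by move: x01; rewrite in_itv/= => /andP[]. Qed.
Let x1 : x <= 1. Proof. by move: x01; rewrite in_itv/= => /andP[]. Qed.

Let ms : measC s.
Proof.
split.
  rewrite (_ : (fun t => _) = (fun t => complex.Re (sigma t)) \_ `[0, 1]); last first.
    by apply/funext => t; rewrite patchE mem_setE in_itv/= /s; case: ifP.
  by apply/(measurable_restrictT _ _).1.
rewrite (_ : (fun t => _) = (fun t => complex.Im (sigma t)) \_ `[0, 1]); last first.
  by apply/funext => t; rewrite patchE mem_setE in_itv/= /s; case: ifP.
by apply/(measurable_restrictT _ _).1.
Qed.

Let isg : cint01 sigma. Proof. exact: sqr_int_cint01. Qed.

Let M20 : 0 <= M2. Proof. by apply: rint_ge0 => //; [exact: one01|move=> t _; exact: sqr_ge0]. Qed.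

Let mcexp (c : R[i]) : measC (fun t : TR => cexp (c * t%:C%C)).
Proof.
have mid (r : R) : measurable_fun [set: TR] (fun t : TR => r * t) by exact: measurable_funM.
have E1 : measurable_fun [set: TR] (fun t : TR => expR (complex.Re c * t)).
  by apply: measurableT_comp (mid _); exact: measurable_expR.
have E2 : measurable_fun [set: TR] (fun t : TR => cos (complex.Im c * t)).
  by apply: measurableT_comp (mid _); apply: continuous_measurable_fun; exact: continuous_cos.
have E3 : measurable_fun [set: TR] (fun t : TR => sin (complex.Im c * t)).
  by apply: measurableT_comp (mid _); apply: continuous_measurable_fun; exact: continuous_sin.
split.
  rewrite (_ : (fun t => _) = (fun t : TR => expR (complex.Re c * t) * cos (complex.Im c * t))).
    exact: measurable_funM.
  by apply/funext => t; rewrite /= cReM cImM /= !mulr0 subr0 add0r.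
rewrite (_ : (fun t => _) = (fun t : TR => expR (complex.Re c * t) * sin (complex.Im c * t))).
  exact: measurable_funM.
by apply/funext => t; rewrite /= cReM cImM /= !mulr0 subr0 add0r.
Qed.

Let cexp_le (t : R) : 0 <= t <= 1 -> cmod (cexp (k * t%:C%C)) <= Ck.
Proof.
move=> /andP[t0 t1]; rewrite cmod_cexp cReM /= mulr0 subr0 ler_expR.
apply: le_trans (ler_norm _) _; rewrite normrM (ger0_norm t0).
by rewrite ler_piMr.
Qed.

Let ints2 : (\int[mu]_t (cmod (s t) ^+ 2)%:E = M2%:E)%E.
Proof.
have [_ <-] := int01_itv iq2.
by apply: eq_integral => t _; rewrite /s; case: ifP => // _; rewrite cmod0 expr0n.
Qed.

(* However the product sigma(u + c) sigma(u) is cut off, the integral of its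
   modulus is at most the squared norm of sigma. *)
Let acor (c : R) (p : TR -> bool) : measurable_fun [set: TR] p ->
  (\int[mu]_u (cmod (if p u then s (u + c) * s u else 0))%:E <= M2%:E)%E.
Proof.
move=> mp.
have mc : measurable_fun [set: TR] (fun u : TR => u + c) by exact: measurable_funD.
have m1 : measC (fun u : TR => s (u + c)) by exact: measC_comp ms mc.
have mq1 : measurable_fun [set: TR] (fun u : TR => (cmod (s (u + c)) ^+ 2)%:E).
  by apply/measurable_EFinP; apply: measurable_funX; exact: measC_cmod.
have mq2 : measurable_fun [set: TR] (fun u : TR => (cmod (s u) ^+ 2)%:E).
  by apply/measurable_EFinP; apply: measurable_funX; exact: measC_cmod.
have e1 : (\int[mu]_u (2^-1%:E * ((cmod (s (u + c)) ^+ 2)%:E + (cmod (s u) ^+ 2)%:E)) = M2%:E)%E.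
  rewrite ge0_integralZl//; last 2 first.
  - exact: emeasurable_funD.
  - by move=> u _; rewrite adde_ge0// lee_fin sqr_ge0.
  rewrite ge0_integralD//; try by move=> u _; rewrite lee_fin sqr_ge0.
  rewrite ints2 (integral_shift c (f := fun u => (cmod (s u) ^+ 2)%:E))//.
  by rewrite ints2 -EFinD -EFinM; congr (_%:E); field.
rewrite -e1; apply: ge0_le_integral => //.
- by move=> u _; rewrite lee_fin cmod_ge0.
- apply/measurable_EFinP; apply: measC_cmod; apply: measC_if => //; exact: measCM.
- by apply: measurable_funeM; exact: emeasurable_funD.
move=> u _; rewrite -EFinD -EFinM lee_fin.
have h (v w : R) : v * w <= 2^-1 * (v ^+ 2 + w ^+ 2).
  have := sqr_ge0 (v - w); have -> : (v - w) ^+ 2 = v ^+ 2 + w ^+ 2 - 2 * (v * w) by ring.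
  by move: (v ^+ 2) (w ^+ 2) (v * w) => A B C; lra.
case: ifP => _; first by rewrite cmodM.
by rewrite cmod0 mulr_ge0// addr_ge0// sqr_ge0.
Qed.

(* sigma_tilde(alpha, alpha - t), for 0 <= t <= alpha. *)
Let h (alpha t : R) : R[i] :=
  integralC (fun u => if 0 <= u <= t then s (u + (alpha - t)) * s u else 0).

Let mle2 (c d : R) : measurable_fun [set: TR] (fun u : TR => c <= u <= d).
Proof. by apply: measurable_and; apply: measurable_fun_ler. Qed.

Let h_le alpha t : cmod (h alpha t) <= 2 * M2.
Proof.
apply: integralC_le; last by apply: acor; exact: mle2.
apply: measC_if; first exact: mle2.
apply: measCM => //; apply: (measC_comp ms); exact: measurable_funD.
Qed.

Let mfst : measurable_fun [set: TR * TR] (fst : TR * TR -> TR). Proof. exact: measurable_fst. Qed.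
Let msnd : measurable_fun [set: TR * TR] (snd : TR * TR -> TR). Proof. exact: measurable_snd. Qed.

Let mh : measC (fun z : TR * TR => h z.2 z.1).
Proof.
apply: (@measC_integralC _ _ _ (fun (z : TR * TR) u => if 0 <= u <= z.1 then s (u + (z.2 - z.1)) * s u else 0)).
have m1 : measurable_fun [set: (TR * TR) * TR] (fun w : (TR * TR) * TR => w.2) by exact: measurable_snd.
have m2 : measurable_fun [set: (TR * TR) * TR] (fun w : (TR * TR) * TR => w.1.1).
  by apply: (measurableT_comp mfst); exact: measurable_fst.
have m3 : measurable_fun [set: (TR * TR) * TR] (fun w : (TR * TR) * TR => w.1.2).
  by apply: (measurableT_comp msnd); exact: measurable_fst.
apply: measC_if.
  by apply: measurable_and; exact: measurable_fun_ler.
apply: measCM; last exact: (measC_comp ms m1).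
apply: (measC_comp ms); apply: measurable_funD => //; exact: measurable_funB.
Qed.

(* Integrated over alpha, this is e^(k t) N(x, t), by the substitution
   alpha = t + xi in the definition of N. *)
Let G (t alpha : R) : R[i] :=
  if (0 <= t <= alpha) && (alpha <= x) then cexp (k * t%:C%C) * (s alpha * h alpha t) else 0.

Let mG : measC (fun z : TR * TR => G z.1 z.2).
Proof.
apply: measC_if.
  apply: measurable_and; last exact: measurable_fun_ler.
  by apply: measurable_and; exact: measurable_fun_ler.
apply: measCM; first exact: (measC_comp (mcexp k) mfst).
by apply: measCM mh; exact: (measC_comp ms msnd).
Qed.

Let M1 := rint 1 (fun t => cmod (sigma t)).

Let ints1 : (\int[mu]_t (cmod (s t))%:E = M1%:E)%E.
Proof.
have [_ <-] := int01_itv (cint01_cmod isg).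
by apply: eq_integral => t _; rewrite /s; case: ifP => // _; rewrite cmod0.
Qed.

Let Ck0 : 0 <= Ck. Proof. exact: expR_ge0. Qed.
Let M10 : 0 <= M1. Proof. by apply: rint_ge0 => //; [exact: one01|move=> t _; exact: cmod_ge0]. Qed.

Let step (C : R) (t : R) : R := if 0 <= t <= 1 then C else 0.

Let istep C : mu.-integrable setT (fun t : TR => (step C t)%:E).
Proof. by have [+ _] := int01_itv (int01_cst C). Qed.

Let mcs : measurable_fun [set: TR] (fun t => (cmod (s t))%:E).
Proof. by apply/measurable_EFinP; exact: measC_cmod. Qed.

Let Gp t : (\int[mu]_u (cmod (G t u))%:E <= (step (Ck * (2 * M2) * M1)%R t)%:E)%E.
Proof.
have mGt : measC (fun u : TR => G t u).
  by apply: (measC_comp mG (phi := fun u : TR => (t : TR, u))); exact: measurable_fun_pair.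
rewrite /step; case: ifPn => t01; last first.
  rewrite integral0_eq// => u _; rewrite /G; case: ifPn; last by rewrite cmod0.
  move=> /andP[/andP[t0 tu] ux]; move: t01; rewrite t0/= => /negP[].
  exact: le_trans tu (le_trans ux x1).
rewrite EFinM -ints1 -ge0_integralZl//; last 2 first.
- by move=> u _; rewrite lee_fin cmod_ge0.
- by rewrite lee_fin !mulr_ge0.
apply: ge0_le_integral => //.
- by move=> u _; rewrite lee_fin cmod_ge0.
- by apply/measurable_EFinP; exact: measC_cmod.
- by apply: measurable_funeM.
move=> u _; rewrite -EFinM lee_fin /G; case: ifP => _; last first.
  by rewrite cmod0 !mulr_ge0 ?cmod_ge0.
rewrite !cmodM -mulrA; apply: ler_pM; rewrite ?mulr_ge0 ?cmod_ge0 ?cexp_le//.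
by rewrite mulrC ler_wpM2r ?cmod_ge0.
Qed.

Let Nker_integralC t : 0 <= t <= x -> cexp (k * t%:C%C) * Nker sigma x t = integralC (G t).
Proof.
move=> /andP[t0 tx].
pose Phi (alpha : TR) := if t <= alpha <= x then s alpha * h alpha t else 0.
have mPhi : measC Phi.
  apply: measC_if; first exact: mle2.
  by apply: measCM => //; apply: (measC_comp mh (phi := fun alpha : TR => (t : TR, alpha))); exact: measurable_fun_pair.
have -> : Nker sigma x t = integralC Phi.
  rewrite -(integralC_shift t mPhi) /Nker cint_integralC; apply: eq_integralC => xi; rewrite /Phi.
  have -> : (t <= xi + t <= x) = (0 <= xi <= x - t) by rewrite lerDr lerBrDr.
  case: ifP => // /andP[xi0 xix].
  have xitx : xi + t <= x by rewrite -lerBrDr.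
  congr (_ * _).
    rewrite /s addrC ifT//; apply/andP; split; first by rewrite addr_ge0.
    exact: le_trans xitx x1.
  rewrite /sigma_tilde cint_integralC /h; apply: eq_integralC => u.
  have -> : t + xi - xi = t by ring.
  case: ifP => // /andP[u0 ut].
  have -> : u + (xi + t - t) = xi + u by ring.
  have h1 : 0 <= xi + u <= 1.
    by rewrite addr_ge0//= (le_trans _ x1)// (le_trans _ xitx)// lerD2l.
  have h2 : 0 <= u <= 1 by rewrite u0/= (le_trans ut)// (le_trans tx).
  by rewrite /s h1 h2.
have iPhi : integrableC Phi.
  apply: (@integrableC_le _ _ (2 * M2 * M1)) => //.
  rewrite EFinM -ints1 -ge0_integralZl//; last 2 first.
  - by move=> u _; rewrite lee_fin cmod_ge0.
  - by rewrite lee_fin mulr_ge0.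
  apply: ge0_le_integral => //.
  - by move=> u _; rewrite lee_fin cmod_ge0.
  - by apply/measurable_EFinP; exact: measC_cmod.
  - exact: measurable_funeM.
  move=> u _; rewrite -EFinM lee_fin /Phi; case: ifP => _; last first.
    by rewrite cmod0 !mulr_ge0 ?cmod_ge0.
  by rewrite cmodM mulrC ler_wpM2r ?cmod_ge0.
rewrite -integralC_Z//; apply: eq_integralC => u; rewrite /Phi /G t0/=.
by case: ifP => _; rewrite ?mulr0.
Qed.

Let f t := cexp (k * t%:C%C) * Nker sigma x t.

Let f_integralC : (fun t => if 0 <= t <= x then f t else 0) = (fun t => integralC (G t)).
Proof.
apply/funext => t; case: ifPn => tx; first exact: Nker_integralC.
rewrite integralC_0// => u; rewrite /G; case: ifPn => // /andP[/andP[t0 tu] ux].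
by move: tx; rewrite t0/= (le_trans tu).
Qed.

(** The kernel N(x, t) is only meaningful for t <= x, whence the cut-off. *)
Lemma cint01_Nker : cint01 (fun t => if 0 <= t <= x then f t else 0).
Proof.
apply: cint01_integrableC; rewrite f_integralC.
exact: (integrableC_integralC mG (istep _) Gp).
Qed.

Let a t := cexp (k * t%:C%C) * sigma t.
Let b t := cexp (- k * t%:C%C) * sigma t.
Let ia : cint01 a. Proof. by apply: cint01M isg; exact: cprim_cont (cprim_cexp k). Qed.
Let ib : cint01 b. Proof. by apply: cint01M isg; exact: cprim_cont (cprim_cexp (- k)). Qed.
Let cA : continuous01 (fun t => cI t a). Proof. exact: cprim_cont (cprim_I ia). Qed.
Let ibA : cint01 (fun t => b t * cI t a). Proof. exact: cint01Mr. Qed.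
Let cH : continuous01 (iter2 b a). Proof. exact: cprim_cont (cprim_I ibA). Qed.
Let iaH : cint01 (fun t => a t * iter2 b a t). Proof. exact: cint01Mr. Qed.

Let cI_integralC (y : R) (g : R -> R[i]) : cI y g = integralC (fun t => if 0 <= t <= y then g t else 0).
Proof. by rewrite cI.unlock cint_integralC. Qed.

Section fixed_alpha.
Variable alpha : R.
Hypothesis alpha01 : 0 <= alpha <= 1.
Let alpha0 : 0 <= alpha. Proof. by case/andP: alpha01. Qed.
Let alpha1 : alpha <= 1. Proof. by case/andP: alpha01. Qed.

(* For fixed alpha, the integrand of the inner double integral before and after
   the substitution t = alpha + u - beta. *)
Let K (t u : R) : R[i] :=
  if (0 <= u <= t) && (t <= alpha) then cexp (k * t%:C%C) * (s (u + (alpha - t)) * s u) else 0.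
Let L (u beta : R) : R[i] :=
  if (0 <= u <= beta) && (beta <= alpha)
  then cexp (k * (alpha + u - beta)%:C%C) * (s beta * s u) else 0.

Let mK : measC (fun z : TR * TR => K z.1 z.2).
Proof.
apply: measC_if.
  apply: measurable_and; last exact: measurable_fun_ler.
  by apply: measurable_and; exact: measurable_fun_ler.
apply: measCM; first exact: (measC_comp (mcexp k) mfst).
apply: measCM; last exact: (measC_comp ms msnd).
apply: (measC_comp ms); apply: measurable_funD => //; exact: measurable_funB.
Qed.

Let mL : measC (fun z : TR * TR => L z.1 z.2).
Proof.
apply: measC_if.
  apply: measurable_and; last exact: measurable_fun_ler.
  by apply: measurable_and; exact: measurable_fun_ler.
apply: measCM; last by apply: measCM; [exact: (measC_comp ms msnd)|exact: (measC_comp ms mfst)].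
apply: (measC_comp (mcexp k) (phi := fun z : TR * TR => alpha + z.1 - z.2)).
by apply: measurable_funB => //; exact: measurable_funD.
Qed.

Let mKt t : measC (fun u : TR => K t u).
Proof. by apply: (measC_comp mK (phi := fun u : TR => (t : TR, u))); exact: measurable_fun_pair. Qed.

Let mKu u : measC (fun t : TR => K t u).
Proof. by apply: (measC_comp mK (phi := fun t : TR => (t, u : TR))); exact: measurable_fun_pair. Qed.

Let mLu u : measC (fun beta : TR => L u beta).
Proof. by apply: (measC_comp mL (phi := fun t : TR => (u : TR, t))); exact: measurable_fun_pair. Qed.

Let macor t : measC (fun u : TR => if 0 <= u <= t then s (u + (alpha - t)) * s u else 0).
Proof.
apply: measC_if; first exact: mle2.
apply: measCM => //; apply: (measC_comp ms); exact: measurable_funD.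
Qed.

Let Kp t : (\int[mu]_u (cmod (K t u))%:E <= (step (Ck * M2)%R t)%:E)%E.
Proof.
rewrite /step; case: ifPn => t01; last first.
  rewrite integral0_eq// => u _; rewrite /K; case: ifPn; last by rewrite cmod0.
  move=> /andP[/andP[u0 ut] ta]; move: t01; rewrite (le_trans u0 ut)/= => /negP[].
  exact: le_trans ta alpha1.
apply: (@le_trans _ _ (\int[mu]_u (Ck%:E *
    (cmod (if (0 <= u <= t)%R then s (u + (alpha - t)) * s u else 0))%:E))%E).
  apply: ge0_le_integral => //.
  - by move=> u _; rewrite lee_fin cmod_ge0.
  - by apply/measurable_EFinP; exact: measC_cmod.
  - by apply: measurable_funeM; apply/measurable_EFinP; apply: measC_cmod; exact: macor.
  move=> u _; rewrite -EFinM lee_fin /K; case: ifP => [/andP[ut _]|_].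
    by rewrite ut cmodM ler_wpM2r ?cmod_ge0 ?cexp_le.
  by rewrite cmod0 mulr_ge0 ?cmod_ge0.
rewrite ge0_integralZl//; last 2 first.
- by apply/measurable_EFinP; apply: measC_cmod; exact: macor.
- by move=> u _; rewrite lee_fin cmod_ge0.
rewrite EFinM; apply: lee_wpmul2l; first by rewrite lee_fin.
by apply: acor; exact: mle2.
Qed.

Let integralC_K t : integralC (K t) = if 0 <= t <= alpha then cexp (k * t%:C%C) * h alpha t else 0.
Proof.
case: ifPn => ta.
  have it := integrableC_le (macor t) (acor (alpha - t) (mle2 0 t)).
  rewrite /h -integralC_Z//; apply: eq_integralC => u; rewrite /K.
  by case/andP: ta => _ ->; rewrite andbT; case: ifP; rewrite ?mulr0.
rewrite integralC_0// => u; rewrite /K; case: ifPn => // /andP[/andP[u0 ut] ta'].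
by move: ta; rewrite ta' (le_trans u0 ut).
Qed.

Let integralC_KL u : integralC (fun t => K t u) = integralC (L u).
Proof.
rewrite -(integralC_reflection (alpha + u) (mKu u)); apply: eq_integralC => beta.
rewrite /K /L.
have -> : (0 <= u <= alpha + u - beta) && (alpha + u - beta <= alpha) =
          (0 <= u <= beta) && (beta <= alpha).
  have -> : (u <= alpha + u - beta) = (beta <= alpha).
    by rewrite addrAC -subr_ge0 addrK subr_ge0.
  have -> : (alpha + u - beta <= alpha) = (u <= beta).
    by rewrite -addrA gerDl subr_le0.
  by rewrite -!andbA (andbC (beta <= alpha)).
by have -> : u + (alpha - (alpha + u - beta)) = beta by ring.
Qed.

Let Lp u : (\int[mu]_beta (cmod (L u beta))%:E <= (Ck * M1 * cmod (s u))%:E)%E.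
Proof.
apply: (@le_trans _ _ (\int[mu]_beta ((Ck * cmod (s u))%:E * (cmod (s beta))%:E))%E).
  apply: ge0_le_integral => //.
  - by move=> beta _; rewrite lee_fin cmod_ge0.
  - by apply/measurable_EFinP; exact: measC_cmod.
  - exact: measurable_funeM.
  move=> beta _; rewrite -EFinM lee_fin /L; case: ifP => [/andP[/andP[u0 ub] ba]|_]; last first.
    by rewrite cmod0 !mulr_ge0 ?cmod_ge0.
  rewrite !cmodM (mulrC (cmod (s beta))) mulrA !ler_wpM2r ?cmod_ge0// cexp_le//.
  apply/andP; split; first by rewrite -addrA (addrC u) addrA addr_ge0// subr_ge0.
  by rewrite (le_trans _ alpha1)// -addrA gerDl subr_le0.
rewrite ge0_integralZl//; last 2 first.
- by move=> beta _; rewrite lee_fin cmod_ge0.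
- by rewrite lee_fin mulr_ge0 ?cmod_ge0.
by rewrite ints1 -EFinM lee_fin mulrAC.
Qed.

Let iLp : mu.-integrable setT (fun u => (Ck * M1 * cmod (s u))%:E).
Proof.
have [i1 _] := int01_itv (cint01_cmod isg).
apply: eq_integrable (integrableZl measurableT (Ck * M1) i1) => // u _ /=.
by rewrite /s; case: ifP; rewrite ?cmod0.
Qed.

Let integralC_L beta : integralC (fun u => L u beta) =
  if 0 <= beta <= alpha then cexp (k * alpha%:C%C) * (b beta * cI beta a) else 0.
Proof.
case: ifPn => ba; last first.
  rewrite integralC_0// => u; rewrite /L; case: ifPn => // /andP[/andP[u0 ub] ba'].
  by move: ba; rewrite ba' (le_trans u0 ub).
case/andP: ba => b0 ba.
have beta01 : beta \in `[0, 1] by rewrite in_itv/= b0 (le_trans ba).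
rewrite mulrA cI_integralC -integralC_Z; last exact: integrableC_cint01.
apply: eq_integralC => u; rewrite /L ba andbT; case: ifPn => [/andP[u0 ub]|_]; last by rewrite mulr0.
have s1 : s beta = sigma beta by rewrite /s ifT// b0 (le_trans ba).
have s2 : s u = sigma u by rewrite /s ifT// u0 (le_trans ub)// (le_trans ba).
rewrite s1 s2 /a /b.
have -> : cexp (k * (alpha + u - beta)%:C%C) =
    cexp (k * alpha%:C%C) * cexp (k * u%:C%C) * cexp (- k * beta%:C%C).
  rewrite -!cexpD; congr cexp.
  by rewrite rmorphB rmorphD/=; ring.
ring.
Qed.

(** For fixed alpha the integral over t of e^(k t) sigma_tilde(alpha, alpha - t)
    is, up to the factor e^(k alpha), a twofold iterated integral: integrate over t first, reflect
    t = alpha + u - beta, and exchange the order again. *)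
Lemma acor_fourier :
  integralC (fun t => if 0 <= t <= alpha then cexp (k * t%:C%C) * h alpha t else 0) =
    cexp (k * alpha%:C%C) * iter2 b a alpha /\
  integrableC (fun t => if 0 <= t <= alpha then cexp (k * t%:C%C) * h alpha t else 0).
Proof.
have e1 : (fun t => if 0 <= t <= alpha then cexp (k * t%:C%C) * h alpha t else 0) =
    (fun t => integralC (K t)) by apply/funext => t; rewrite integralC_K.
rewrite e1; split; last exact: (integrableC_integralC mK (istep _) Kp).
rewrite (integralC_fubini mK (istep _) Kp) (eq_integralC integralC_KL) (integralC_fubini mL iLp Lp).
have alphai : alpha \in `[0, 1] by rewrite in_itv/= alpha0.
rewrite /iter2 cI_integralC -integralC_Z; last exact: integrableC_cint01.
by apply: eq_integralC => beta; rewrite integralC_L; case: ifP; rewrite ?mulr0.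
Qed.

End fixed_alpha.

Lemma cI_Nker :
  cI x (fun t => cexp (k * t%:C%C) * Nker sigma x t) = iter3 a b x.
Proof.
rewrite cI_integralC -[LHS]/(integralC (fun t => if 0 <= t <= x then f t else 0)) f_integralC.
rewrite (integralC_fubini mG (istep _) Gp) /iter3 cI_integralC; apply: eq_integralC => alpha.
case: ifPn => [/andP[alpha0 ax]|ax]; last first.
  rewrite integralC_0// => t; rewrite /G; case: ifPn => // /andP[/andP[t0 ta] ax'].
  by move: ax; rewrite ax' (le_trans t0 ta).
have alpha01 : 0 <= alpha <= 1 by rewrite alpha0 (le_trans ax).
have [e1 i1] := acor_fourier alpha01.
have s1 : s alpha = sigma alpha by rewrite /s alpha01.
rewrite /a mulrAC mulrC -e1 -s1 -integralC_Z//; apply: eq_integralC => t; rewrite /G ax andbT.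
by case: ifP => _; rewrite ?mulr0// mulrCA.
Qed.

End NkerIdentity.

(** * The amplitudes of a solution *)

Section L2.
Context {R : realType}.
Notation mu := (@lebesgue_measure R).
Implicit Types f : R -> R[i].

Lemma Lp01_norm2_sqr f :
  ((Lp01_norm 2 f) `^ 2 = \int[mu]_(t in `[0%R, 1%R]) (cmod (f t) ^+ 2)%:E)%E.
Proof.
rewrite /Lp01_norm poweR_Lnorm// [RHS]integral_mkcond.
apply: eq_integral => t _; rewrite /= !patchE; case: ifP => _ /=.
  by rewrite (ger0_norm (cmod_ge0 _)) powR_mulrn ?cmod_ge0.
by rewrite -[point]/(0 : R) normr0 powR0.
Qed.

Lemma L2_01_int f : L2_01 f -> int01 (fun t => cmod (f t) ^+ 2).
Proof.
move=> [mR mJ fin]; apply/integrableP; split.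
  by apply/measurable_EFinP; apply: measurable_funX; exact: measurable_cmod.
have : ((Lp01_norm 2 f) `^ 2 < +oo)%E by exact: poweR_lty.
rewrite Lp01_norm2_sqr; apply: le_lt_trans.
rewrite le_eqVlt; apply/orP; left; apply/eqP; apply: eq_integral => t _ /=.
by rewrite ger0_norm// sqr_ge0.
Qed.

Lemma L2norm_ge0 f : 0 <= L2norm f.
Proof. by rewrite fine_ge0// Lnorm_ge0. Qed.

Lemma L1norm_ge0 f : 0 <= L1norm f.
Proof. by rewrite fine_ge0// Lnorm_ge0. Qed.

Lemma sqr_L2norm f : int01 (fun t => cmod (f t) ^+ 2) ->
  L2norm f ^+ 2 = rint 1 (fun t => cmod (f t) ^+ 2).
Proof.
move=> ff; have := Lp01_norm2_sqr f; rewrite /L2norm.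
have N0 : (0 <= Lp01_norm 2 f)%E by exact: Lnorm_ge0.
have ifin : (\int[mu]_(t in `[0%R, 1%R]) (cmod (f t) ^+ 2)%:E)%E \is a fin_num.
  exact: (integrable_fin_num _ ff).
case: (Lp01_norm 2 f) N0 => [r| |//]; last first.
  by rewrite poweRyr// => _ e; move: ifin; rewrite -e.
rewrite lee_fin poweR_EFin => r0 e.
by rewrite /= -(powR_mulrn _ r0) rint.unlock /Rintegral -e.
Qed.

End L2.

Section Solution.
Context {R : realType}.
Notation lambda := (@lebesgue_measure R).
Notation Re := complex.Re.
Notation Im := complex.Im.

Lemma ac01_Re (f : R -> R[i]) : abs_continuous01 f -> ac01 (fun t => Re (f t)).
Proof.
move=> acf e e0; have [d d0 H] := acf e e0; exists d => // n a b ab tab sd.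
apply: le_lt_trans (H n a b ab tab sd); apply: ler_sum => i _.
by rewrite -[_ - _]/(Re (f (b i)) - Re (f (a i))) -cReN -cReD Re_le_cmod.
Qed.

Lemma ac01_Im (f : R -> R[i]) : abs_continuous01 f -> ac01 (fun t => Im (f t)).
Proof.
move=> acf e e0; have [d d0 H] := acf e e0; exists d => // n a b ab tab sd.
apply: le_lt_trans (H n a b ab tab sd); apply: ler_sum => i _.
by rewrite -[_ - _]/(Im (f (b i)) - Im (f (a i))) -cImN -cImD Im_le_cmod.
Qed.

Lemma ac01_cont01 (f : R -> R[i]) : abs_continuous01 f -> continuous01 f.
Proof. by move=> acf; split; apply: ac01_continuous; [exact: ac01_Re|exact: ac01_Im]. Qed.

Lemma ac01_cprim (F f : R -> R[i]) : abs_continuous01 F -> cint01 f ->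
  {ae lambda, forall x : R, x \in `[0, 1] -> has_cderivative F x (f x)} -> cprim F f.
Proof.
move=> acF [rf jf] dF; split; apply: ac_prim => //.
- exact: ac01_Re.
- move: dF; apply: filterS; first exact: (ae_filter_ringOfSetsType lambda).
  by move=> x h x01; have [] := h x01.
- exact: ac01_Im.
- move: dF; apply: filterS; first exact: (ae_filter_ringOfSetsType lambda).
  by move=> x h x01; have [] := h x01.
Qed.

Variables (sigma : R -> R[i]) (mu : R[i]) (y y1 : R -> R[i]).
Hypothesis isg : cint01 sigma.
Hypothesis isg2 : cint01 (fun t => sigma t ^+ 2).
Hypothesis sol : is_solution sigma mu y y1.

(** The equation as a pair of integral equations, which no longer mention
    pointwise derivatives. *)
Lemma solution_prim_y : cprim y (fun t => y1 t - sigma t * y t).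
Proof.
have [acy acy1 qd _] := sol.
have cy := ac01_cont01 acy; have cy1 := ac01_cont01 acy1.
apply: ac01_cprim => //.
  by apply: cint01B; [exact: cint01_cont|exact: cint01Mr].
move: qd; apply: filterS; first exact: (ae_filter_ringOfSetsType lambda).
by move=> x h x01; have [y' dy ->] := h x01; rewrite addrK.
Qed.

Lemma solution_prim_y1 :
  cprim y1 (fun t => sigma t * y1 t - sigma t ^+ 2 * y t - mu ^+ 2 * y t).
Proof.
have [acy acy1 _ eq] := sol.
have cy := ac01_cont01 acy; have cy1 := ac01_cont01 acy1.
apply: ac01_cprim => //.
  apply: cint01B; last by apply: cint01Z; exact: cint01_cont.
  by apply: cint01B; exact: cint01Mr.
move: eq; apply: filterS; first exact: (ae_filter_ringOfSetsType lambda).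
move=> x h x01; have [dy1 dy e] := h x01.
suff -> : sigma x * y1 x - sigma x ^+ 2 * y x - mu ^+ 2 * y x = dy1 by [].
apply/eqP; rewrite -subr_eq0 -oppr_eq0; apply/eqP; rewrite -[RHS]e; ring.
Qed.

Let ep t := cexp (iu * mu * t%:C%C).
Let em t := cexp (- (iu * mu) * t%:C%C).

Lemma epm t : ep t * em t = 1.
Proof. by rewrite -cexpD -mulrDl subrr mul0r cexp0. Qed.

Let eps : R[i] := (2 * iu * mu)^-1.
Hypothesis mu0 : mu != 0.

(** The system satisfied by the amplitudes. *)
Lemma solution_wp : cprim (fun t => em t * (y1 t + iu * mu * y t)) (fun t =>
   em t ^+ 2 * sigma t * (ep t * (y1 t - iu * mu * y t))
   - eps * (sigma t ^+ 2 * (em t * (y1 t + iu * mu * y t))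
          - em t ^+ 2 * sigma t ^+ 2 * (ep t * (y1 t - iu * mu * y t)))).
Proof.
have p := cprimM (cprim_cexp (- (iu * mu))) (cprimD solution_prim_y1 (cprimZ (iu * mu) solution_prim_y)).
apply: cprim_ext p => t _ //.
rewrite -/(em t).
have e1 := epm t; have i2 := @iu2 R; have i0 := @iu_neq0 R.
have -> : em t ^+ 2 * sigma t * (ep t * (y1 t - iu * mu * y t)) =
   (ep t * em t) * em t * sigma t * (y1 t - iu * mu * y t) by ring.
have -> : em t ^+ 2 * sigma t ^+ 2 * (ep t * (y1 t - iu * mu * y t)) =
   (ep t * em t) * em t * sigma t ^+ 2 * (y1 t - iu * mu * y t) by ring.
rewrite e1 /eps !mul1r.
have -> : (2 * iu * mu)^-1 * (sigma t ^+ 2 * (em t * (y1 t + iu * mu * y t))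
     - em t * sigma t ^+ 2 * (y1 t - iu * mu * y t)) = em t * sigma t ^+ 2 * y t.
  by field; rewrite mu0.
(* With mu^2 written as - i^2 mu^2, the sides agree as polynomials in i. *)
have -> : mu ^+ 2 * y t = - iu ^+ 2 * mu ^+ 2 * y t by rewrite i2; ring.
ring.
Qed.

Lemma solution_wm : cprim (fun t => ep t * (y1 t - iu * mu * y t)) (fun t =>
   ep t ^+ 2 * sigma t * (em t * (y1 t + iu * mu * y t))
   + eps * (sigma t ^+ 2 * (ep t * (y1 t - iu * mu * y t))
          - ep t ^+ 2 * sigma t ^+ 2 * (em t * (y1 t + iu * mu * y t)))).
Proof.
have p := cprimM (cprim_cexp (iu * mu)) (cprimB solution_prim_y1 (cprimZ (iu * mu) solution_prim_y)).
apply: cprim_ext p => t _ //.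
rewrite -/(ep t).
have e1 := epm t; have i2 := @iu2 R; have i0 := @iu_neq0 R.
have -> : ep t ^+ 2 * sigma t * (em t * (y1 t + iu * mu * y t)) =
   (ep t * em t) * ep t * sigma t * (y1 t + iu * mu * y t) by ring.
have -> : ep t ^+ 2 * sigma t ^+ 2 * (em t * (y1 t + iu * mu * y t)) =
   (ep t * em t) * ep t * sigma t ^+ 2 * (y1 t + iu * mu * y t) by ring.
rewrite e1 /eps !mul1r.
have -> : (2 * iu * mu)^-1 * (sigma t ^+ 2 * (ep t * (y1 t - iu * mu * y t))
     - ep t * sigma t ^+ 2 * (y1 t + iu * mu * y t)) = - (ep t * sigma t ^+ 2 * y t).
  by field; rewrite mu0.
have -> : mu ^+ 2 * y t = - iu ^+ 2 * mu ^+ 2 * y t by rewrite i2; ring.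
ring.
Qed.

End Solution.

(** * Trigonometric integrals in terms of exponentials *)

Section TrigExp.
Context {R : realType}.
Implicit Types (mu : R[i]) (t x : R).

(** The exponentials exp(i mu t) and exp(- i mu t). *)
Definition expp mu t : R[i] := cexp (iu * mu * t%:C%C).
Definition expm mu t : R[i] := cexp (- (iu * mu) * t%:C%C).

Lemma inv2iu : (2 * iu)^-1 = - iu / 2 :> R[i].
Proof.
have i0 := @iu_neq0 R; have i2 := @iu2 R.
have -> : (2 * iu)^-1 = - (- 1) / (2 * iu) :> R[i] by rewrite opprK mul1r.
by rewrite -i2; field.
Qed.

Lemma expp_sqr mu t : expp mu t ^+ 2 = cexp (2 * iu * mu * t%:C%C).
Proof. by rewrite expr2 -cexpD; congr cexp; ring. Qed.

Lemma expm_sqr mu t : expm mu t ^+ 2 = cexp (- (2 * iu * mu * t%:C%C)).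
Proof. by rewrite expr2 -cexpD; congr cexp; ring. Qed.

Lemma ccosE mu x : ccos (mu * x%:C%C) = (expp mu x + expm mu x) / 2.
Proof. by rewrite /ccos; congr ((cexp _ + cexp _) / _); ring. Qed.

Lemma csinE mu x : csin (mu * x%:C%C) = - iu / 2 * (expp mu x - expm mu x).
Proof.
rewrite /csin inv2iu mulrC; congr (_ * (cexp _ - cexp _)); ring.
Qed.

Lemma ccos2E mu t : ccos (2 * mu * t%:C%C) = (expp mu t ^+ 2 + expm mu t ^+ 2) / 2.
Proof. by rewrite expp_sqr expm_sqr /ccos; congr ((cexp _ + cexp _) / _); ring. Qed.

Lemma csin2E mu t : csin (2 * mu * t%:C%C) = - iu / 2 * (expp mu t ^+ 2 - expm mu t ^+ 2).
Proof.
rewrite expp_sqr expm_sqr /csin inv2iu mulrC; congr (_ * (cexp _ - cexp _)); ring.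
Qed.

Lemma ccos_shiftE mu x t : ccos (mu * (x - 2 * t)%:C%C) =
  (expp mu x * expm mu t ^+ 2 + expm mu x * expp mu t ^+ 2) / 2.
Proof.
rewrite expp_sqr expm_sqr /ccos /expp /expm -!cexpD.
by congr ((cexp _ + cexp _) / _); rewrite rmorphB rmorphM rmorph_nat/=; ring.
Qed.

Lemma csin_shiftE mu x t : csin (mu * (x - 2 * t)%:C%C) =
  - iu / 2 * (expp mu x * expm mu t ^+ 2 - expm mu x * expp mu t ^+ 2).
Proof.
rewrite expp_sqr expm_sqr /csin /expp /expm -!cexpD inv2iu mulrC.
by congr (_ * (cexp _ - cexp _)); rewrite rmorphB rmorphM rmorph_nat/=; ring.
Qed.

Lemma ccos_diffE mu t s : ccos (2 * mu * (t - s)%:C%C) =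
  (expp mu t ^+ 2 * expm mu s ^+ 2 + expm mu t ^+ 2 * expp mu s ^+ 2) / 2.
Proof.
rewrite (expp_sqr mu t) (expp_sqr mu s) (expm_sqr mu t) (expm_sqr mu s) /ccos -!cexpD.
by congr ((cexp _ + cexp _) / _); rewrite rmorphB/=; ring.
Qed.

Lemma csin_diffE mu t s : csin (2 * mu * (t - s)%:C%C) =
  - iu / 2 * (expp mu t ^+ 2 * expm mu s ^+ 2 - expm mu t ^+ 2 * expp mu s ^+ 2).
Proof.
rewrite (expp_sqr mu t) (expp_sqr mu s) (expm_sqr mu t) (expm_sqr mu s) /csin -!cexpD inv2iu mulrC.
by congr (_ * (cexp _ - cexp _)); rewrite rmorphB/=; ring.
Qed.

End TrigExp.

Section Formulas.
Context {R : realType}.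
Variables (sigma : R -> R[i]) (mu : R[i]) (x : R).
Hypothesis x01 : x \in `[0, 1].
Hypothesis mRs : measurable_fun `[0 : R, 1] (fun t => complex.Re (sigma t)).
Hypothesis mIs : measurable_fun `[0 : R, 1] (fun t => complex.Im (sigma t)).
Hypothesis iq2 : int01 (fun t => cmod (sigma t) ^+ 2).

Let ep := expp mu.
Let em := expm mu.
(** The coefficients of the system satisfied by the amplitudes. *)
Definition coef_a (t : R) := em t ^+ 2 * sigma t.
Definition coef_b (t : R) := ep t ^+ 2 * sigma t.
Definition coef_c (t : R) := sigma t ^+ 2.
Definition coef_a2 (t : R) := em t ^+ 2 * sigma t ^+ 2.
Definition coef_b2 (t : R) := ep t ^+ 2 * sigma t ^+ 2.

Let isg : cint01 sigma. Proof. exact: sqr_int_cint01. Qed.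
Lemma cint_coef_c : cint01 coef_c. Proof. exact: sqr_int_cint01_sqr. Qed.
Lemma cont_expp : continuous01 ep. Proof. exact: cprim_cont (cprim_cexp _). Qed.
Lemma cont_expm : continuous01 em. Proof. exact: cprim_cont (cprim_cexp _). Qed.
Let cep2 : continuous01 (fun t => ep t ^+ 2).
Proof. exact: cont01M cont_expp cont_expp. Qed.
Let cem2 : continuous01 (fun t => em t ^+ 2).
Proof. exact: cont01M cont_expm cont_expm. Qed.
Lemma cint_coef_a : cint01 coef_a. Proof. exact: cint01M cem2 isg. Qed.
Lemma cint_coef_b : cint01 coef_b. Proof. exact: cint01M cep2 isg. Qed.
Lemma cint_coef_a2 : cint01 coef_a2. Proof. exact: cint01M cem2 cint_coef_c. Qed.
Lemma cint_coef_b2 : cint01 coef_b2. Proof. exact: cint01M cep2 cint_coef_c. Qed.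
Let ia := cint_coef_a. Let ib := cint_coef_b. Let ic := cint_coef_c.
Let ia2 := cint_coef_a2. Let ib2 := cint_coef_b2.

(* Every integral below is a polynomial in these. *)
Let A := cI x coef_a. Let B := cI x coef_b. Let C0 := cI x coef_c.
Let A2 := cI x coef_a2. Let B2 := cI x coef_b2.
Let H := iter2 coef_a coef_b x. Let T := iter3 coef_a coef_b x. Let T' := iter3 coef_b coef_a x.

Let cintE (z : R) f : \cint_(0 <= t <= z) f t = cI z f. Proof. by rewrite cI.unlock. Qed.

Let lincomb (z : R) (k l : R[i]) f g F : z \in `[0, 1] -> cint01 f -> cint01 g ->
  (forall t, t \in `[0, 1] -> F t = k * f t + l * g t) ->
  \cint_(0 <= t <= z) F t = k * cI z f + l * cI z g.
Proof.
move=> z01 ff ig FE; rewrite cintE (eq_cI z01 FE) cID ?cIZ//; exact: cint01Z.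
Qed.

Lemma int_cos z : z \in `[0, 1] -> \cint_(0 <= t <= z) (ccos (2 * mu * t%:C%C) * sigma t) =
  2^-1 * cI z coef_a + 2^-1 * cI z coef_b.
Proof. by move=> z01; apply: lincomb => // t _; rewrite ccos2E /coef_a /coef_b /ep /em; ring. Qed.

Lemma int_sin z : z \in `[0, 1] -> \cint_(0 <= t <= z) (csin (2 * mu * t%:C%C) * sigma t) =
  (iu / 2) * cI z coef_a + (- iu / 2) * cI z coef_b.
Proof. by move=> z01; apply: lincomb => // t _; rewrite csin2E /coef_a /coef_b /ep /em; ring. Qed.

Lemma int_cos_r : \cint_(0 <= t <= x) (sigma t * ccos (2 * mu * t%:C%C)) =
  2^-1 * A + 2^-1 * B.
Proof. by apply: lincomb => // t _; rewrite ccos2E /coef_a /coef_b /ep /em; ring. Qed.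

Lemma int_sin_r : \cint_(0 <= t <= x) (sigma t * csin (2 * mu * t%:C%C)) =
  (iu / 2) * A + (- iu / 2) * B.
Proof. by apply: lincomb => // t _; rewrite csin2E /coef_a /coef_b /ep /em; ring. Qed.

Lemma int_cos_sqr : \cint_(0 <= t <= x) (ccos (2 * mu * t%:C%C) * sigma t ^+ 2) =
  2^-1 * A2 + 2^-1 * B2.
Proof. by apply: lincomb => // t _; rewrite ccos2E /coef_a2 /coef_b2 /ep /em; ring. Qed.

Lemma int_sin_sqr : \cint_(0 <= t <= x) (csin (2 * mu * t%:C%C) * sigma t ^+ 2) =
  (iu / 2) * A2 + (- iu / 2) * B2.
Proof. by apply: lincomb => // t _; rewrite csin2E /coef_a2 /coef_b2 /ep /em; ring. Qed.

Lemma int_sqr : \cint_(0 <= t <= x) (sigma t ^+ 2) = C0.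
Proof. by rewrite cintE. Qed.

Lemma int_cos_shift : \cint_(0 <= s <= x) (ccos (mu * (x - 2 * s)%:C%C) * sigma s) =
  (ep x / 2) * A + (em x / 2) * B.
Proof. by apply: lincomb => // t _; rewrite ccos_shiftE /coef_a /coef_b /ep /em; ring. Qed.

Lemma int_sin_shift : \cint_(0 <= s <= x) (csin (mu * (x - 2 * s)%:C%C) * sigma s) =
  (- iu / 2 * ep x) * A + (iu / 2 * em x) * B.
Proof. by apply: lincomb => // t _; rewrite csin_shiftE /coef_a /coef_b /ep /em; ring. Qed.

Lemma int2_cos : \cint_(0 <= s <= x) \cint_(0 <= t <= x)
     (ccos (2 * mu * (t - s)%:C%C) * sigma t ^+ 2 * sigma s) =
  (B2 / 2) * A + (A2 / 2) * B.
Proof.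
apply: lincomb => // s _.
rewrite (lincomb (k := em s ^+ 2 * sigma s / 2) (l := ep s ^+ 2 * sigma s / 2) x01 ib2 ia2).
  by rewrite /coef_a /coef_b /A2 /B2 /ep /em; ring.
by move=> t _; rewrite ccos_diffE /coef_a2 /coef_b2 /ep /em; ring.
Qed.

Lemma int2_sin : \cint_(0 <= s <= x) \cint_(0 <= t <= x)
     (csin (2 * mu * (t - s)%:C%C) * sigma t ^+ 2 * sigma s) =
  (- iu / 2 * B2) * A + (iu / 2 * A2) * B.
Proof.
apply: lincomb => // s _.
rewrite (lincomb (k := - iu / 2 * em s ^+ 2 * sigma s) (l := iu / 2 * ep s ^+ 2 * sigma s) x01 ib2 ia2).
  by rewrite /coef_a /coef_b /A2 /B2 /ep /em; ring.
by move=> t _; rewrite csin_diffE /coef_a2 /coef_b2 /ep /em; ring.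
Qed.

Let iab : cint01 (fun t => coef_a t * cI t coef_b).
Proof. by apply: cint01Mr => //; exact: cprim_cont (cprim_I ib). Qed.
Let iba : cint01 (fun t => coef_b t * cI t coef_a).
Proof. by apply: cint01Mr => //; exact: cprim_cont (cprim_I ia). Qed.

Lemma iter2C : iter2 coef_b coef_a x = A * B - H.
Proof.
have p := cprimB (cprimM (cprim_I ia) (cprim_I ib)) (cprim_I iab).
rewrite /A /B /H /iter2 -(cprim_cI p _ x01) ?cI0 ?mul0r ?subr0//.
by apply: eq_cI => // t _; ring.
Qed.

(** Expanding the product gives the four twofold integrals of a and b; the
    mixed ones are H and A B - H, and those of (a, a) and (b, b) are A^2 / 2 and
    B^2 / 2. *)
Lemma int2_cos_sin : \cint_(0 <= t <= x) \cint_(0 <= s <= t)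
     (sigma s * sigma t * ccos (2 * mu * t%:C%C) * csin (2 * mu * s%:C%C)) =
  - iu / 4 * (H - (A * B - H) + 2^-1 * (B ^+ 2 - A ^+ 2)).
Proof.
have pA := cprim_I ia; have pB := cprim_I ib.
have p := cprimZ (- iu / 4) (cprimD (cprimB (cprim_I iab) (cprim_I iba))
   (cprimZ 2^-1 (cprimB (cprimM pB pB) (cprimM pA pA)))).
rewrite cintE -iter2C !expr2 -(cprim_cI p _ x01); last by rewrite !cI0; ring.
apply: eq_cI => // t t01.
rewrite (lincomb (k := iu / 2 * sigma t * ccos (2 * mu * t%:C%C))
              (l := - iu / 2 * sigma t * ccos (2 * mu * t%:C%C)) t01 ia ib).
  by rewrite ccos2E /coef_a /coef_b /ep /em; field.
by move=> s _; rewrite csin2E /coef_a /coef_b /ep /em; ring.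
Qed.

Let iNm : cint01 (fun t => if 0 <= t <= x then em t ^+ 2 * Nker sigma x t else 0).
Proof.
have := @cint01_Nker R sigma (- (2 * iu * mu)) x x01 mRs mIs iq2.
by apply: eq_cint01 => t _; rewrite mulNr -expm_sqr.
Qed.

Let iNp : cint01 (fun t => if 0 <= t <= x then ep t ^+ 2 * Nker sigma x t else 0).
Proof.
have := @cint01_Nker R sigma (2 * iu * mu) x x01 mRs mIs iq2.
by apply: eq_cint01 => t _; rewrite /ep expp_sqr.
Qed.

Let eq_iter3 (a a' b b' : R -> R[i]) : (forall t, a t = a' t) -> (forall t, b t = b' t) ->
  iter3 a b x = iter3 a' b' x.
Proof. by move=> aa bb; congr iter3; apply/funext. Qed.

(* The values beyond [x] do not matter; the cut-off makes the integrand
   integrable over the whole of [0,1]. *)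
Let cut (f : R -> R[i]) : cI x (fun t => if 0 <= t <= x then f t else 0) = cI x f.
Proof.
rewrite cI.unlock /cint; congr Complex; apply: eq_Rintegral => t;
  by rewrite inE/= in_itv/= => ->.
Qed.

Let Nm : cI x (fun t => if 0 <= t <= x then em t ^+ 2 * Nker sigma x t else 0) = T.
Proof.
rewrite cut /T.
rewrite (eq_cI x01 (_ : forall t, _ -> em t ^+ 2 * Nker sigma x t = cexp (- (2 * iu * mu) * t%:C%C) * Nker sigma x t)).
  rewrite cI_Nker//; apply: eq_iter3 => t; first by rewrite /coef_a mulNr -expm_sqr.
  by rewrite /coef_b /ep expp_sqr opprK.
by move=> t _; rewrite mulNr -expm_sqr.
Qed.

Let Np : cI x (fun t => if 0 <= t <= x then ep t ^+ 2 * Nker sigma x t else 0) = T'.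
Proof.
rewrite cut /T'.
rewrite (eq_cI x01 (_ : forall t, _ -> ep t ^+ 2 * Nker sigma x t = cexp (2 * iu * mu * t%:C%C) * Nker sigma x t)).
  rewrite cI_Nker//; apply: eq_iter3 => t; first by rewrite /coef_b /ep expp_sqr.
  by rewrite /coef_a mulNr -expm_sqr.
by move=> t _; rewrite /ep expp_sqr.
Qed.

Lemma int_sin_Nker : \cint_(0 <= t <= x) (csin (mu * (x - 2 * t)%:C%C) * Nker sigma x t) =
  (- iu / 2 * ep x) * T + (iu / 2 * em x) * T'.
Proof.
rewrite cintE -cut -Nm -Np -!cIZ// -cID//; try exact: cint01Z.
apply: eq_cI => // t _; case: ifP => _; last by rewrite !mulr0 addr0.
rewrite csin_shiftE /ep /em; ring.
Qed.

Lemma int_cos_Nker : \cint_(0 <= t <= x) (ccos (mu * (x - 2 * t)%:C%C) * Nker sigma x t) =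
  (ep x / 2) * T + (em x / 2) * T'.
Proof.
rewrite cintE -cut -Nm -Np -!cIZ// -cID//; try exact: cint01Z.
apply: eq_cI => // t _; case: ifP => _; last by rewrite !mulr0 addr0.
rewrite ccos_shiftE /ep /em; ring.
Qed.

End Formulas.

(** * The main terms of the amplitudes *)

(** All the norms are dominated by one scale [L]; the mixed terms e * gg are
    absorbed by 2 e gg <= e^2 + gg^2. *)
Lemma resid_bound_le (R : realType) (E M1 M2 J K2 G1 e L gg : R) :
  1 <= E -> E <= L -> 0 <= M1 -> M1 <= L -> 0 <= M2 -> M2 <= L ->
  0 <= J -> J <= L * gg -> 0 <= gg -> 0 <= K2 -> 0 <= G1 -> 0 <= e ->
  resid_bound E M1 M2 J K2 G1 e <= 13 * L ^+ 6 * (gg ^+ 2 + G1 + e * K2 + e ^+ 2).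
Proof.
move=> E1 EL M10 M1L M20 M2L J0 JL gg0 K20 G10 e0.
have E0 : 0 <= E by exact: le_trans E1.
have L1 : 1 <= L by exact: le_trans EL.
have L0 : 0 <= L by exact: le_trans L1.
have LX n : (n <= 6)%N -> L ^+ n <= L ^+ 6 by move=> n6; exact: ler_weXn2l.
have E2 : E ^+ 2 <= L ^+ 2 by rewrite lerXn2r.
have E3 : E ^+ 3 <= L ^+ 3 by rewrite lerXn2r.
have wk n (u v : R) : (n <= 6)%N -> 0 <= v -> u <= L ^+ n * v -> u <= L ^+ 6 * v.
  by move=> n6 v0 uv; apply: le_trans uv _; apply: ler_wpM2r => //; exact: LX.
have a1 : E ^+ 2 * J ^+ 2 <= L ^+ 6 * gg ^+ 2.
  apply: (wk 4) => //; first exact: sqr_ge0.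
  rewrite (_ : L ^+ 4 * gg ^+ 2 = L ^+ 2 * (L * gg) ^+ 2); last by ring.
  by apply: ler_pM; [exact: sqr_ge0|exact: sqr_ge0|exact: E2|rewrite lerXn2r ?nnegrE ?mulr_ge0].
have a2 : E ^+ 2 * M1 * G1 <= L ^+ 6 * G1.
  apply: (wk 3) => //; apply: ler_wpM2r => //.
  by rewrite (exprSr L); apply: ler_pM => //; exact: sqr_ge0.
have a3 : E ^+ 2 * J * M2 <= L ^+ 6 * gg.
  apply: (wk 4) => //; rewrite (_ : L ^+ 4 * gg = L ^+ 2 * (L * gg) * L); last by ring.
  apply: ler_pM => //; first by rewrite mulr_ge0// sqr_ge0.
  by apply: ler_pM => //; exact: sqr_ge0.
have a4 : E ^+ 2 * M1 * K2 <= L ^+ 6 * K2.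
  apply: (wk 3) => //; apply: ler_wpM2r => //.
  by rewrite (exprSr L); apply: ler_pM => //; exact: sqr_ge0.
have a5 : E * K2 <= L ^+ 6 * K2.
  by apply: (wk 1) => //; apply: ler_wpM2r.
have a6 : E ^+ 2 * M2 * J <= L ^+ 6 * gg by rewrite mulrAC.
have a7 : E ^+ 3 * M1 * M2 * J <= L ^+ 6 * gg.
  rewrite (_ : L ^+ 6 * gg = L ^+ 3 * L * L * (L * gg)); last by ring.
  have E30 : 0 <= E ^+ 3 by exact: exprn_ge0.
  by do 3 (apply: ler_pM; rewrite ?mulr_ge0//).
have a8 : E ^+ 2 * M2 ^+ 2 <= L ^+ 6 * 1.
  apply: (wk 4) => //; rewrite mulr1 (_ : L ^+ 4 = L ^+ 2 * L ^+ 2); last by ring.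
  by apply: ler_pM; [exact: sqr_ge0|exact: sqr_ge0|exact: E2|rewrite lerXn2r].
have a9 : E ^+ 3 * M1 * M2 ^+ 2 <= L ^+ 6 * 1.
  rewrite mulr1 (_ : L ^+ 6 = L ^+ 3 * L * L ^+ 2); last by ring.
  have E30 : 0 <= E ^+ 3 by exact: exprn_ge0.
  apply: ler_pM; rewrite ?mulr_ge0 ?sqr_ge0//; last by rewrite lerXn2r.
  by apply: ler_pM.
have X0 : 0 <= L ^+ 6 by exact: exprn_ge0.
rewrite /resid_bound; move: a1 a2 a3 a4 a5 a6 a7 a8 a9 X0.
move: (L ^+ 6) (E ^+ 2 * J ^+ 2) (E ^+ 2 * M1 * G1) (E ^+ 2 * J * M2)
  (E ^+ 2 * M1 * K2) (E * K2) (E ^+ 2 * M2 * J) (E ^+ 3 * M1 * M2 * J)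
  (E ^+ 2 * M2 ^+ 2) (E ^+ 3 * M1 * M2 ^+ 2) => X b1 b2 b3 b4 b5 b6 b7 b8 b9.
move=> a1 a2 a3 a4 a5 a6 a7 a8 a9 X0.
have h1 : e * (6 * b3 + 2 * b4) <= e * (6 * (X * gg) + 2 * (X * K2)).
  by apply: ler_wpM2l => //; lra.
have h2 : e * (2 * b5 + 2 * b6 + 2 * b7) <= e * (2 * (X * K2) + 4 * (X * gg)).
  by apply: ler_wpM2l => //; lra.
have h3 : e ^+ 2 * (4 * b8 + 4 * b9) <= e ^+ 2 * (8 * X).
  by apply: ler_wpM2l; [exact: sqr_ge0|lra].
have h4 : 0 <= X * (e - gg) ^+ 2 by rewrite mulr_ge0// sqr_ge0.
have h5 : 0 <= X * G1 by rewrite mulr_ge0.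
have h6 : 0 <= X * (e * K2) by rewrite !mulr_ge0.
have h7 : 0 <= X * gg ^+ 2 by rewrite mulr_ge0// sqr_ge0.
have h8 : e * (6 * (X * gg) + 2 * (X * K2)) = 6 * (X * (e * gg)) + 2 * (X * (e * K2)) by ring.
have h9 : e * (2 * (X * K2) + 4 * (X * gg)) = 2 * (X * (e * K2)) + 4 * (X * (e * gg)) by ring.
have h10 : e ^+ 2 * (8 * X) = 8 * (X * e ^+ 2) by ring.
have h11 : X * (e - gg) ^+ 2 = X * e ^+ 2 - 2 * (X * (e * gg)) + X * gg ^+ 2 by ring.
have -> : 13 * X * (gg ^+ 2 + G1 + e * K2 + e ^+ 2) =
  13 * (X * gg ^+ 2) + 13 * (X * G1) + 13 * (X * (e * K2)) + 13 * (X * e ^+ 2) by ring.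
rewrite h8 in h1; rewrite h9 in h2; rewrite h10 in h3; rewrite h11 in h4.
lra.
Qed.

Section Remainder.
Context {R : realType}.
Variables (sigma : R -> R[i]) (mu : R[i]) (d : R).
Hypothesis mRs : measurable_fun `[0 : R, 1] (fun t => complex.Re (sigma t)).
Hypothesis mIs : measurable_fun `[0 : R, 1] (fun t => complex.Im (sigma t)).
Hypothesis iq2 : int01 (fun t => cmod (sigma t) ^+ 2).
Hypothesis d0 : 0 < d.
Hypothesis mud : `|complex.Im mu| <= d.

Let a := coef_a sigma mu. Let b := coef_b sigma mu. Let c := coef_c sigma.
Let a2 := coef_a2 sigma mu. Let b2 := coef_b2 sigma mu.
Let ia : cint01 a. Proof. exact: cint_coef_a. Qed.
Let ib : cint01 b. Proof. exact: cint_coef_b. Qed.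
Let ic : cint01 c. Proof. exact: cint_coef_c. Qed.
Let ia2 : cint01 a2. Proof. exact: cint_coef_a2. Qed.
Let ib2 : cint01 b2. Proof. exact: cint_coef_b2. Qed.
Let isg : cint01 sigma. Proof. exact: sqr_int_cint01. Qed.

(** |A| + |B|, which is half of gam0. *)
Definition half_gam0 (t : R) := cmod (cI t a) + cmod (cI t b).
Let E := expR (2 * d).

Lemma expR2d_ge1 : 1 <= E. Proof. by rewrite -expR0 ler_expR mulr_ge0// ltW. Qed.

Lemma cmod_expp t : t \in `[0, 1] -> cmod (expp mu t) <= expR d.
Proof.
move=> t01; have /andP[t0 t1] : 0 <= t <= 1 by move: t01; rewrite in_itv/=.
rewrite /expp cmod_cexp cReM cReM cImM /=.
rewrite !(mul0r, mulr0, mul1r, add0r, subr0, sub0r) ler_expR.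
apply: le_trans (ler_norm _) _; rewrite normrM normrN (ger0_norm t0).
by apply: le_trans mud; rewrite ler_piMr.
Qed.

Lemma cmod_expm t : t \in `[0, 1] -> cmod (expm mu t) <= expR d.
Proof.
move=> t01; have /andP[t0 t1] : 0 <= t <= 1 by move: t01; rewrite in_itv/=.
rewrite /expm cmod_cexp cReM cReN cReM cImN cImM /=.
rewrite !(mul0r, mulr0, mul1r, add0r, subr0, sub0r, opprK) ler_expR.
apply: le_trans (ler_norm _) _; rewrite normrM (ger0_norm t0).
by apply: le_trans mud; rewrite ler_piMr.
Qed.

Let expd2 : expR d ^+ 2 = E. Proof. by rewrite expr2 -expRD -mulr2n -mulr_natl. Qed.

Let ep2 t : t \in `[0, 1] -> cmod (expp mu t ^+ 2) <= E.
Proof. by move=> t01; rewrite cmodX -expd2 lerXn2r ?nnegrE ?cmod_ge0 ?expR_ge0// cmod_expp. Qed.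
Let em2 t : t \in `[0, 1] -> cmod (expm mu t ^+ 2) <= E.
Proof. by move=> t01; rewrite cmodX -expd2 lerXn2r ?nnegrE ?cmod_ge0 ?expR_ge0// cmod_expm. Qed.

Let eps : R[i] := - iu / 2 * mu^-1.
Let q t := cmod (sigma t).
Let g := half_gam0.

(** The main terms of wp and wm: the last term of the truncated series is
    integrated by parts and only the boundary term is kept. *)
Definition main_p (x : R) : R[i] :=
  1 + cI x a + iter2 a b x + iter3 a b x - eps * (cI x c - cI x a2)
  + eps * cI x a * (cI x c - cI x b2).
Definition main_m (x : R) : R[i] :=
  1 + cI x b + iter2 b a x + iter3 b a x + eps * (cI x c - cI x b2)
  - eps * cI x b * (cI x c - cI x a2).

(* Integration by parts. *)
Let part (p r h : R -> R[i]) (x : R) : cint01 p -> cint01 r -> cint01 h -> x \in `[0, 1] ->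
  cI x (fun t => p t * cI t (fun s => r s - h s)) =
  cI x p * (cI x r - cI x h) - cI x (fun t => (r t - h t) * cI t p).
Proof.
move=> jp jr jh x01.
have jrh : cint01 (fun s => r s - h s) by exact: cint01B.
have j1 : cint01 (fun t => (r t - h t) * cI t p).
  by apply: cint01Mr => //; exact: cprim_cont (cprim_I jp).
have pp := cprimB (cprimM (cprim_I jp) (cprim_I jrh)) (cprim_I j1).
rewrite -cIB// -(cprim_cI pp _ x01) ?cI0 ?mul0r ?subr0//.
by apply: eq_cI => // t _; ring.
Qed.

Let iq : int01 q. Proof. exact: cint01_cmod. Qed.
Let cA : continuous01 (fun t => cI t a). Proof. exact: cprim_cont (cprim_I ia). Qed.
Let cB : continuous01 (fun t => cI t b). Proof. exact: cprim_cont (cprim_I ib). Qed.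
Lemma cont_half_gam0 : {within `[0, 1], continuous g}.
Proof. by move=> z; apply: cvgD; [exact: (cont_cmod cA)|exact: (cont_cmod cB)]. Qed.
Let iq2g : int01 (fun t => q t ^+ 2 * g t).
Proof. by apply: eq_int01 (int01M cont_half_gam0 iq2) => t _; rewrite mulrC. Qed.

Let corr (h F : R -> R[i]) (x : R) : cint01 h -> continuous01 F -> x \in `[0, 1] ->
  (forall t, t \in `[0, 1] -> cmod (h t) <= 2 * E * q t ^+ 2) ->
  (forall t, cmod (F t) <= g t) ->
  cmod (cI x (fun t => h t * F t)) <= 2 * E * rint 1 (fun t => q t ^+ 2 * g t).
Proof.
move=> ih cF x01 hq Fg; apply: cI_bound => //; first exact: cint01Mr.
- by move=> t _; rewrite mulr_ge0 ?sqr_ge0// addr_ge0 ?cmod_ge0.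
- by rewrite mulr_ge0// expR_ge0.
by move=> t t01; rewrite cmodM mulrA ler_pM ?cmod_ge0// hq.
Qed.

Let c_le t : cmod (c t) <= q t ^+ 2. Proof. by rewrite /c /coef_c cmodX. Qed.
Let a2_le t : t \in `[0, 1] -> cmod (a2 t) <= E * q t ^+ 2.
Proof. by move=> t01; rewrite /a2 /coef_a2 cmodM (cmodX (sigma t)) ler_wpM2r ?sqr_ge0// em2. Qed.
Let b2_le t : t \in `[0, 1] -> cmod (b2 t) <= E * q t ^+ 2.
Proof. by move=> t01; rewrite /b2 /coef_b2 cmodM (cmodX (sigma t)) ler_wpM2r ?sqr_ge0// ep2. Qed.

Let twoE (z w : R[i]) (r : R) : 0 <= r -> cmod z <= r -> cmod w <= E * r -> cmod (z - w) <= 2 * E * r.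
Proof.
move=> r0 zr wr; apply: le_trans (cmodB _ _) _; rewrite -mulrA mulr_natl mulr2n.
by apply: lerD => //; apply: le_trans zr _; rewrite ler_peMl// expR2d_ge1.
Qed.

(** The difference between the amplitudes and their main terms; the last summand
    comes from the integration by parts that separates [main_p] from [picard]. *)
Lemma main_remainder (wp wm : R -> R[i]) :
  cprim wp (fun t => a t * wm t - eps * (c t * wp t - a2 t * wm t)) ->
  cprim wm (fun t => b t * wp t + eps * (c t * wm t - b2 t * wp t)) ->
  wp 0 = 1 -> wm 0 = 1 ->
  forall x, x \in `[0, 1] ->
  cmod (wp x - main_p x) + cmod (wm x - main_m x) <=
  2 * resid_bound E (rint 1 q) (rint 1 (fun t => q t ^+ 2)) (rint 1 (fun t => q t * g t))
     (rint 1 (fun t => q t ^+ 2 * g t)) (rint 1 (fun t => q t * g t ^+ 2)) (cmod eps) *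
    expR (2 * (E * rint 1 q + cmod eps * E * rint 1 (fun t => q t ^+ 2)))
  + 4 * E * (cmod eps * rint 1 (fun t => q t ^+ 2 * g t)).
Proof.
move=> pwp pwm wp0 wm0 x x01.
have a_le t : t \in `[0, 1] -> cmod (a t) <= E * q t.
  by move=> t01; rewrite /a /coef_a cmodM ler_wpM2r ?cmod_ge0 ?em2.
have b_le t : t \in `[0, 1] -> cmod (b t) <= E * q t.
  by move=> t01; rewrite /b /coef_b cmodM ler_wpM2r ?cmod_ge0 ?ep2.
have := system_picard ia ib ic ia2 ib2 expR2d_ge1 (fun t _ => cmod_ge0 _) iq iq2 a_le b_le
   (fun t _ => c_le t) a2_le b2_le pwp pwm wp0 wm0 x01.
set Dp := cmod (wp x - _); set Dm := cmod (wm x - _).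
have e1 : wp x - main_p x = (wp x - picard a b c a2 b2 eps x) -
    eps * cI x (fun t => (c t - b2 t) * cI t a).
  by rewrite /picard part// cIB// /main_p; ring.
have e2 : wm x - main_m x = (wm x - picard b a c b2 a2 (- eps) x) +
    eps * cI x (fun t => (c t - a2 t) * cI t b).
  by rewrite /picard part// cIB// /main_m; ring.
have k1 : cmod (cI x (fun t => (c t - b2 t) * cI t a)) <= 2 * E * rint 1 (fun t => q t ^+ 2 * g t).
  apply: corr => //; first exact: cint01B.
    by move=> t t01; apply: twoE; rewrite ?sqr_ge0// b2_le.
  by move=> t; rewrite lerDl cmod_ge0.
have k2 : cmod (cI x (fun t => (c t - a2 t) * cI t b)) <= 2 * E * rint 1 (fun t => q t ^+ 2 * g t).
  apply: corr => //; first exact: cint01B.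
    by move=> t t01; apply: twoE; rewrite ?sqr_ge0// a2_le.
  by move=> t; rewrite lerDr cmod_ge0.
move=> D.
rewrite e1 e2.
apply: le_trans (lerD (cmodB _ _) (cmodD _ _)) _; rewrite addrACA; apply: lerD; first exact: D.
rewrite [leRHS](mulrCA (4 * E)) (cmodM eps) (cmodM eps) -mulrDr; apply: ler_wpM2l; first exact: cmod_ge0.
have -> : 4 * E * rint 1 (fun t => q t ^+ 2 * g t) =
  2 * E * rint 1 (fun t => q t ^+ 2 * g t) + 2 * E * rint 1 (fun t => q t ^+ 2 * g t) by ring.
exact: lerD.
Qed.

Lemma main_p_prim : exists f, cprim main_p f.
Proof.
have iab : cint01 (fun t => a t * cI t b) by exact: cint01Mr.
have iba : cint01 (fun t => b t * cI t a) by exact: cint01Mr.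
have i3 : cint01 (fun t => a t * iter2 b a t).
  by apply: cint01Mr => //; exact: cprim_cont (cprim_I iba).
eexists; exact: (cprimD (cprimB (cprimD (cprimD (cprimD (cprim_cst 1) (cprim_I ia))
   (cprim_I iab)) (cprim_I i3)) (cprimZ eps (cprimB (cprim_I ic) (cprim_I ia2))))
   (cprimM (cprimZ eps (cprim_I ia)) (cprimB (cprim_I ic) (cprim_I ib2)))).
Qed.

Lemma main_m_prim : exists f, cprim main_m f.
Proof.
have iab : cint01 (fun t => a t * cI t b) by exact: cint01Mr.
have iba : cint01 (fun t => b t * cI t a) by exact: cint01Mr.
have i3 : cint01 (fun t => b t * iter2 a b t).
  by apply: cint01Mr => //; exact: cprim_cont (cprim_I iab).
eexists; exact: (cprimB (cprimD (cprimD (cprimD (cprimD (cprim_cst 1) (cprim_I ib))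
   (cprim_I iba)) (cprim_I i3)) (cprimZ eps (cprimB (cprim_I ic) (cprim_I ib2))))
   (cprimM (cprimZ eps (cprim_I ib)) (cprimB (cprim_I ic) (cprim_I ia2)))).
Qed.

End Remainder.

(** * The constant and the asymptotic formulas *)

Section Constants.
Context {R : realType}.

(** A number that bounds exp(2d), the norm [m] of sigma, and its square. *)
Definition scale (d m : R) : R := expR (2 * d) + `|m| + m ^+ 2.

(** The constant of the theorem: [resid_bound_le] gives the factor 13 scale^6,
    Gronwall's lemma the exponential, the passage from the amplitudes to y and y1
    one more factor exp(2d), and the last integration by parts the second
    summand. *)
Definition bound_const (d m : R) : R :=
  13 * scale d m ^+ 7 * expR (2 * scale d m ^+ 2 + 1) + scale d m ^+ 2.

Lemma scale_gt0 (d m : R) : 0 < scale d m.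
Proof. by rewrite /scale -addrA ltr_wpDr ?expR_gt0// addr_ge0// sqr_ge0. Qed.

Lemma bound_const_gt0 (d m : R) : 0 < bound_const d m.
Proof.
have s0 := scale_gt0 d m.
by rewrite /bound_const addr_gt0 ?exprn_gt0// !mulr_gt0 ?exprn_gt0 ?expR_gt0.
Qed.

End Constants.

Section Estimate.
Context {R : realType}.
Variables (sigma : R -> R[i]) (d : R) (mu : R[i]).
Hypothesis sL2 : L2_01 sigma.
Hypothesis d0 : 0 < d.
Hypothesis muO : Omega d sigma mu.
Let M := L2norm sigma.
Let E := expR (2 * d).
Let L := scale d M.
Let q t := cmod (sigma t).
Let g := half_gam0 sigma mu.
Let eps : R[i] := - iu / 2 * mu^-1.
Let e := cmod eps.

Let mRs : measurable_fun `[0 : R, 1] (fun t => complex.Re (sigma t)). Proof. by case: sL2. Qed.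
Let mIs : measurable_fun `[0 : R, 1] (fun t => complex.Im (sigma t)). Proof. by case: sL2. Qed.
Let iq2 : int01 (fun t => q t ^+ 2). Proof. exact: L2_01_int. Qed.
Let mud : `|complex.Im mu| <= d. Proof. by case: muO. Qed.
Let iq : int01 q. Proof. by apply: cint01_cmod; exact: sqr_int_cint01. Qed.
Let ia : cint01 (coef_a sigma mu). Proof. exact: cint_coef_a. Qed.
Let ib : cint01 (coef_b sigma mu). Proof. exact: cint_coef_b. Qed.
Let M0 : 0 <= M. Proof. exact: L2norm_ge0. Qed.
Let M2E : rint 1 (fun t => q t ^+ 2) = M ^+ 2. Proof. by rewrite /M sqr_L2norm. Qed.
Let E1 : 1 <= E. Proof. exact: expR2d_ge1. Qed.
Let E0 : 0 < E. Proof. exact: expR_gt0. Qed.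
Let EL : E <= L. Proof. by rewrite /L /scale -addrA lerDl addr_ge0// sqr_ge0. Qed.
Let ML : M <= L.
Proof. by rewrite /L /scale (ger0_norm M0) addrAC lerDr addr_ge0 ?sqr_ge0// ltW. Qed.
Let M2L : M ^+ 2 <= L.
Proof. by rewrite /L /scale lerDr addr_ge0// ltW. Qed.
Let L1 : 1 <= L. Proof. exact: le_trans EL. Qed.

(* Only the consequence b >= ||sigma||^2 of the definition of b is used. *)
Let mmu : 2 * M ^+ 2 * E < cmod mu.
Proof.
case: muO => _ /=; apply: le_lt_trans; apply: ler_wpM2r; first exact: ltW.
rewrite ler_pM2l// /bconst.
rewrite ler_peMr ?sqr_ge0// exprn_ege1// -addrA lerDl addr_ge0 ?L1norm_ge0//.
by rewrite mulr_ge0 ?expR_ge0 ?sqr_ge0.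
Qed.

Lemma cmod_mu_gt0 : 0 < cmod mu.
Proof. by apply: le_lt_trans mmu; rewrite mulr_ge0 ?(ltW E0)// mulr_ge0// sqr_ge0. Qed.

Let eE : e = (cmod mu)^-1 / 2.
Proof.
rewrite /e /eps !cmodM cmodN cmod_iu !cmodV cmod2; ring.
Qed.
Let e0 : 0 <= e. Proof. exact: cmod_ge0. Qed.

(* This keeps the Gronwall exponent bounded. *)
Let eEM : e * E * M ^+ 2 <= 2^-1.
Proof.
have m0 := cmod_mu_gt0.
rewrite eE [leLHS](_ : _ = (cmod mu)^-1 * (M ^+ 2 * E / 2)); last by ring.
rewrite ler_pdivrMl//.
have h : 0 <= M ^+ 2 * E by rewrite mulr_ge0 ?sqr_ge0 ?ltW.
move: mmu; rewrite -mulrA; move: (M ^+ 2 * E) (cmod mu) h m0 => u v h m0; lra.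
Qed.

Let A t := cI t (coef_a sigma mu).
Let B t := cI t (coef_b sigma mu).
Let fmE : fourier_m sigma mu = A.
Proof. by apply/funext => t; rewrite /A cI.unlock /fourier_m /coef_a; congr cint; apply/funext => s; rewrite expm_sqr. Qed.
Let fpE : fourier_p sigma mu = B.
Proof. by apply/funext => t; rewrite /B cI.unlock /fourier_p /coef_b; congr cint; apply/funext => s; rewrite expp_sqr. Qed.

Let cA : {within `[0, 1], continuous (fun t => cmod (A t))}.
Proof. by apply: cont_cmod; exact: cprim_cont (cprim_I ia). Qed.
Let cB : {within `[0, 1], continuous (fun t => cmod (B t))}.
Proof. by apply: cont_cmod; exact: cprim_cont (cprim_I ib). Qed.

Let csq (F : R -> R[i]) : {within `[0, 1], continuous (fun t : R => cmod (F t))} ->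
  int01 (fun t => q t * cmod (F t)) /\ rint 1 (fun t => q t * cmod (F t)) <= M * L2norm F.
Proof.
move=> cF.
have iF2 : int01 (fun t => cmod (F t) ^+ 2).
  by apply: eq_int01 (int01M cF (int01_cont cF)) => t _; rewrite expr2.
have mq := int01_measurable iq; have mF := cont01_measurable cF.
split; first exact: int01_mul.
have := cauchy_schwarz mq mF iq2 iF2.
rewrite M2E -sqr_L2norm// -exprMn ler_sqr ?nnegrE//.
- by apply: rint_ge0; [exact: one01|move=> t _; rewrite mulr_ge0 ?cmod_ge0].
- by rewrite mulr_ge0 ?L2norm_ge0.
Qed.

Let M1M : rint 1 q <= M.
Proof.
have c1 : {within `[0, 1], continuous (fun _ : R => 1 : R)}.
  by apply: continuous_subspaceT => ?; exact: cvg_cst.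
have i1 : int01 (fun _ : R => (1 : R) ^+ 2) by rewrite expr1n; exact: int01_cst.
have := cauchy_schwarz (int01_measurable iq) (cont01_measurable c1) iq2 i1.
have -> : rint 1 (fun _ : R => (1 : R) ^+ 2) = 1.
  have [_ h] := @prim_id R; have := h 1 one01; rewrite add0r expr1n => <- //.
rewrite mulr1 M2E (eq_rint one01 (_ : forall t, t \in `[0, 1] -> q t * 1 = q t)) ?ler_sqr ?nnegrE//.
- by apply: rint_ge0; [exact: one01|move=> t _; exact: cmod_ge0].
- by move=> t _; rewrite mulr1.
Qed.

Let gg := gam sigma mu.
Let gg0 : 0 <= gg. Proof. by rewrite /gg /gam mulr_ge0// addr_ge0// L2norm_ge0. Qed.

Let Jg : rint 1 (fun t => q t * g t) <= L * gg.
Proof.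
have [iA hA] := csq cA; have [iB hB] := csq cB.
rewrite (eq_rint one01 (_ : forall t, t \in `[0, 1] -> q t * g t = q t * cmod (A t) + q t * cmod (B t))); last first.
  by move=> t _; rewrite /g /half_gam0 mulrDr.
rewrite rintD ?one01//; apply: le_trans (lerD hA hB) _.
rewrite -mulrDr /gg /gam fmE fpE; apply: ler_pM => //; first by rewrite addr_ge0// L2norm_ge0.
by rewrite ler_peMl ?addr_ge0 ?L2norm_ge0// ler1n.
Qed.

Let K2 := rint 1 (fun t => q t ^+ 2 * g t).
Let G1 := rint 1 (fun t => q t * g t ^+ 2).
Let J := rint 1 (fun t => q t * g t).

Let g0 t : 0 <= g t. Proof. by rewrite addr_ge0 ?cmod_ge0. Qed.
Let cg : {within `[0, 1], continuous g}. Proof. exact: cont_half_gam0. Qed.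
Let iqg : int01 (fun t => q t * g t).
Proof. by apply: eq_int01 (int01M cg iq) => t _; rewrite mulrC. Qed.
Let iq2g : int01 (fun t => q t ^+ 2 * g t).
Proof. by apply: eq_int01 (int01M cg iq2) => t _; rewrite mulrC. Qed.
Let iqg2 : int01 (fun t => q t * g t ^+ 2).
Proof. by apply: eq_int01 (int01M cg iqg) => t _; ring. Qed.
Let q0 t : 0 <= q t. Proof. exact: cmod_ge0. Qed.

Let J0 : 0 <= J. Proof. by apply: rint_ge0; [exact: one01|move=> t _; rewrite mulr_ge0]. Qed.
Let K20 : 0 <= K2. Proof. by apply: rint_ge0; [exact: one01|move=> t _; rewrite mulr_ge0 ?sqr_ge0]. Qed.
Let G10 : 0 <= G1. Proof. by apply: rint_ge0; [exact: one01|move=> t _; rewrite mulr_ge0 ?sqr_ge0]. Qed.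

Let gam0E t : gam0 sigma t mu = 2 * g t.
Proof. by rewrite /gam0 fmE fpE. Qed.

Let gam1E : gam1 sigma mu = 8 * G1.
Proof.
rewrite /gam1 -[X in 2 * X](_ : rint 1 (fun t => q t * gam0 sigma t mu ^+ 2) = _); last by rewrite rint.unlock.
rewrite (eq_rint one01 (_ : forall t, t \in `[0, 1] -> q t * gam0 sigma t mu ^+ 2 = 4 * (q t * g t ^+ 2))).
  by rewrite rintZ ?one01// -/G1; ring.
by move=> t _; rewrite gam0E; ring.
Qed.

Let ksqE : ksq sigma mu = 2 * K2.
Proof.
rewrite /ksq -[LHS](_ : rint 1 (fun t => q t ^+ 2 * gam0 sigma t mu) = _); last by rewrite rint.unlock.
rewrite (eq_rint one01 (_ : forall t, t \in `[0, 1] -> q t ^+ 2 * gam0 sigma t mu = 2 * (q t ^+ 2 * g t))).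
  by rewrite rintZ ?one01.
by move=> t _; rewrite gam0E; ring.
Qed.

Let rho_ge : gg ^+ 2 + G1 + e * K2 + e ^+ 2 <= rho sigma mu.
Proof.
have m0 : 0 <= (cmod mu)^-1 by rewrite invr_ge0 cmod_ge0.
rewrite /rho gam1E ksqE -/gg eE -exprVn; move: m0; move: (cmod mu)^-1 => m m0.
have h1 : 0 <= m * K2 by rewrite mulr_ge0.
have h2 : 0 <= m ^+ 2 by exact: sqr_ge0.
have -> : m / 2 * K2 = m * K2 / 2 by ring.
have -> : m * (2 * K2) = 2 * (m * K2) by ring.
have -> : (m / 2) ^+ 2 = m ^+ 2 / 4 by field.
by move: G10; lra.
Qed.

Let rho0 : 0 <= rho sigma mu.
Proof.
apply: le_trans rho_ge; have := sqr_ge0 gg; have := sqr_ge0 e.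
have : 0 <= e * K2 by rewrite mulr_ge0.
by move: G10; lra.
Qed.

Let rho_ge_K : 4 * (e * K2) <= rho sigma mu.
Proof.
have m0 : 0 <= (cmod mu)^-1 by rewrite invr_ge0 cmod_ge0.
rewrite /rho gam1E ksqE -/gg eE -exprVn; move: m0; move: (cmod mu)^-1 => m m0.
have h1 : 0 <= m * K2 by rewrite mulr_ge0.
have := sqr_ge0 m; have := sqr_ge0 gg.
have -> : m / 2 * K2 = m * K2 / 2 by ring.
have -> : m * (2 * K2) = 2 * (m * K2) by ring.
by move: G10; lra.
Qed.

(** The bound of [main_remainder], multiplied by exp(2d) / 2, is O(rho). *)
Lemma remainder_rho :
  E / 2 * (2 * resid_bound E (rint 1 q) (rint 1 (fun t => q t ^+ 2)) J K2 G1 e *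
    expR (2 * (E * rint 1 q + e * E * rint 1 (fun t => q t ^+ 2)))
  + 4 * E * (e * K2)) <= bound_const d M * rho sigma mu.
Proof.
have L0 : 0 <= L by exact: le_trans L1.
have Q0 : 0 <= rint 1 q by apply: rint_ge0; [exact: one01|move=> t _; exact: q0].
have M2p : 0 <= rint 1 (fun t => q t ^+ 2) by rewrite M2E sqr_ge0.
have r1 : resid_bound E (rint 1 q) (rint 1 (fun t => q t ^+ 2)) J K2 G1 e <=
    13 * L ^+ 6 * rho sigma mu.
  apply: le_trans (resid_bound_le E1 EL Q0 (le_trans M1M ML) M2p _ J0 Jg gg0 K20 G10 e0) _.
    by rewrite M2E.
  by apply: ler_wpM2l rho_ge; rewrite mulr_ge0// exprn_ge0.
have x1 : expR (2 * (E * rint 1 q + e * E * rint 1 (fun t => q t ^+ 2))) <= expR (2 * L ^+ 2 + 1).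
  rewrite ler_expR M2E mulrDr; apply: lerD.
    by rewrite ler_pM2l// expr2; apply: ler_pM; [exact: ltW|exact: Q0|exact: EL|exact: le_trans M1M ML].
  by rewrite -ler_pdivlMl// mulr1.
have X0 := expR_ge0 (2 * L ^+ 2 + 1).
have LR : 0 <= 13 * L ^+ 6 * rho sigma mu by rewrite !mulr_ge0// exprn_ge0.
have y1 : resid_bound E (rint 1 q) (rint 1 (fun t => q t ^+ 2)) J K2 G1 e *
    expR (2 * (E * rint 1 q + e * E * rint 1 (fun t => q t ^+ 2))) <=
    13 * L ^+ 6 * rho sigma mu * expR (2 * L ^+ 2 + 1).
  apply: (@le_trans _ _ (13 * L ^+ 6 * rho sigma mu *
    expR (2 * (E * rint 1 q + e * E * rint 1 (fun t => q t ^+ 2))))).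
    by apply: ler_wpM2r => //; exact: expR_ge0.
  exact: ler_wpM2l.
rewrite mulrDr /bound_const -/L [leRHS]mulrDl; apply: lerD.
  rewrite [leLHS](_ : _ = E * (resid_bound E (rint 1 q) (rint 1 (fun t => q t ^+ 2)) J K2 G1 e *
    expR (2 * (E * rint 1 q + e * E * rint 1 (fun t => q t ^+ 2))))); last by field.
  apply: (@le_trans _ _ (E * (13 * L ^+ 6 * rho sigma mu * expR (2 * L ^+ 2 + 1)))).
    by apply: ler_wpM2l; first exact: ltW.
  rewrite [leRHS](_ : _ = L * (13 * L ^+ 6 * rho sigma mu * expR (2 * L ^+ 2 + 1))); last by ring.
  by apply: ler_wpM2r => //; rewrite mulr_ge0.
rewrite [leLHS](_ : _ = E ^+ 2 * (2^-1 * (4 * (e * K2)))); last by field.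
apply: ler_pM => //.
- exact: sqr_ge0.
- by rewrite !mulr_ge0.
- by rewrite lerXn2r// nnegrE ltW.
- apply: le_trans rho_ge_K; rewrite ler_piMl//; first by rewrite !mulr_ge0.
  by rewrite invf_le1 ?ler1n.
Qed.

End Estimate.

Lemma C01_norm_le (R : realType) (f : R -> R[i]) (B : R) :
  (forall x, x \in `[0, 1] -> cmod (f x) <= B) -> (C01_norm f <= B%:E)%E.
Proof.
move=> fB; apply: ge_ereal_sup => _ [x /= x01 <-]; rewrite lee_fin; exact: fB.
Qed.

Theorem corollary4p2 (R : realType) :
  exists C : R -> R -> R, (forall d m : R, 0 < C d m) /\
  forall (sigma : R -> R[i]) (d : R), L2_01 sigma -> 0 < d ->
  forall (mu : R[i]) (y y1 : R -> R[i]),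
    Omega d sigma mu ->
    is_solution sigma mu y y1 -> y 0 = 0 -> y1 0 = 1 ->
  exists phi1 phi2 : R -> R[i],
  [/\ forall x : R, x \in `[0, 1] ->
      mu * y x =
        csin (mu * x%:C%C)
      + csin (mu * x%:C%C)
          * \cint_(0 <= t <= x) (ccos (2 * mu * t%:C%C) * sigma t)
      - ccos (mu * x%:C%C)
          * \cint_(0 <= t <= x) (csin (2 * mu * t%:C%C) * sigma t)
      + 2 * ccos (mu * x%:C%C)
          * \cint_(0 <= t <= x) \cint_(0 <= s <= t)
              (sigma s * sigma t
               * ccos (2 * mu * t%:C%C) * csin (2 * mu * s%:C%C))
      - (2 * mu)^-1 * ccos (mu * x%:C%C)
          * \cint_(0 <= t <= x) (ccos (2 * mu * t%:C%C) * sigma t ^+ 2)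
      - (2 * mu)^-1 * csin (mu * x%:C%C)
          * \cint_(0 <= t <= x) (csin (2 * mu * t%:C%C) * sigma t ^+ 2)
      + (2 * mu)^-1 * ccos (mu * x%:C%C)
          * \cint_(0 <= t <= x) (sigma t ^+ 2)
      + \cint_(0 <= t <= x) (csin (mu * (x - 2 * t)%:C%C) * Nker sigma x t)
      - ccos (mu * x%:C%C)
          * \cint_(0 <= t <= x) (sigma t * csin (2 * mu * t%:C%C))
          * \cint_(0 <= s <= x) (sigma s * ccos (2 * mu * s%:C%C))
      + 2^-1 * csin (mu * x%:C%C)
          * ((\cint_(0 <= t <= x) (ccos (2 * mu * t%:C%C) * sigma t)) ^+ 2
             + (\cint_(0 <= t <= x) (csin (2 * mu * t%:C%C) * sigma t)) ^+ 2)
      - (2 * mu)^-1 * \cint_(0 <= t <= x) (sigma t ^+ 2)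
          * \cint_(0 <= s <= x) (ccos (mu * (x - 2 * s)%:C%C) * sigma s)
      + (2 * mu)^-1 * ccos (mu * x%:C%C)
          * \cint_(0 <= s <= x) \cint_(0 <= t <= x)
              (ccos (2 * mu * (t - s)%:C%C) * sigma t ^+ 2 * sigma s)
      - (2 * mu)^-1 * csin (mu * x%:C%C)
          * \cint_(0 <= s <= x) \cint_(0 <= t <= x)
              (csin (2 * mu * (t - s)%:C%C) * sigma t ^+ 2 * sigma s)
      + phi1 x,
      forall x : R, x \in `[0, 1] ->
      y1 x =
        ccos (mu * x%:C%C)
      + ccos (mu * x%:C%C)
          * \cint_(0 <= t <= x) (ccos (2 * mu * t%:C%C) * sigma t)
      + csin (mu * x%:C%C)
          * \cint_(0 <= t <= x) (csin (2 * mu * t%:C%C) * sigma t)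
      - 2 * csin (mu * x%:C%C)
          * \cint_(0 <= t <= x) \cint_(0 <= s <= t)
              (sigma s * sigma t
               * ccos (2 * mu * t%:C%C) * csin (2 * mu * s%:C%C))
      + (2 * mu)^-1 * csin (mu * x%:C%C)
          * \cint_(0 <= t <= x) (ccos (2 * mu * t%:C%C) * sigma t ^+ 2)
      - (2 * mu)^-1 * ccos (mu * x%:C%C)
          * \cint_(0 <= t <= x) (csin (2 * mu * t%:C%C) * sigma t ^+ 2)
      - (2 * mu)^-1 * csin (mu * x%:C%C)
          * \cint_(0 <= t <= x) (sigma t ^+ 2)
      + \cint_(0 <= t <= x) (ccos (mu * (x - 2 * t)%:C%C) * Nker sigma x t)
      + csin (mu * x%:C%C)
          * \cint_(0 <= t <= x) (sigma t * csin (2 * mu * t%:C%C))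
          * \cint_(0 <= s <= x) (sigma s * ccos (2 * mu * s%:C%C))
      + 2^-1 * ccos (mu * x%:C%C)
          * ((\cint_(0 <= t <= x) (ccos (2 * mu * t%:C%C) * sigma t)) ^+ 2
             + (\cint_(0 <= t <= x) (csin (2 * mu * t%:C%C) * sigma t)) ^+ 2)
      + (2 * mu)^-1 * \cint_(0 <= t <= x) (sigma t ^+ 2)
          * \cint_(0 <= s <= x) (csin (mu * (x - 2 * s)%:C%C) * sigma s)
      - (2 * mu)^-1 * csin (mu * x%:C%C)
          * \cint_(0 <= s <= x) \cint_(0 <= t <= x)
              (ccos (2 * mu * (t - s)%:C%C) * sigma t ^+ 2 * sigma s)
      - (2 * mu)^-1 * ccos (mu * x%:C%C)
          * \cint_(0 <= s <= x) \cint_(0 <= t <= x)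
              (csin (2 * mu * (t - s)%:C%C) * sigma t ^+ 2 * sigma s)
      + phi2 x,
      continuous01 phi1 /\ continuous01 phi2,
      (C01_norm phi1 <= (C d (L2norm sigma) * rho sigma mu)%:E)%E &
      (C01_norm phi2 <= (C d (L2norm sigma) * rho sigma mu)%:E)%E].
Proof.
exists bound_const; split; first exact: bound_const_gt0.
move=> sigma d sL2 d0 mu y y1 muO sol y00 y10.
have [mRs mIs _] := sL2.
have iq2 : int01 (fun t => cmod (sigma t) ^+ 2) by exact: L2_01_int.
have isg : cint01 sigma by exact: sqr_int_cint01.
have isg2 : cint01 (fun t => sigma t ^+ 2) by exact: sqr_int_cint01_sqr.
have mud : `|complex.Im mu| <= d by case: muO.
have mu0 : mu != 0.
  by apply/eqP => m0; have := cmod_mu_gt0 muO; rewrite m0 cmod0 ltxx.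
pose eps : R[i] := - iu / 2 * mu^-1.
have epsE : (2 * iu * mu)^-1 = eps by rewrite invfM inv2iu.
pose wp t := expm mu t * (y1 t + iu * mu * y t).
pose wm t := expp mu t * (y1 t - iu * mu * y t).
have pwp := solution_wp isg isg2 sol mu0.
have pwm := solution_wm isg isg2 sol mu0.
rewrite epsE in pwp pwm.
have wp0 : wp 0 = 1 by rewrite /wp /expm y00 y10 !mulr0 cexp0 addr0 mulr1.
have wm0 : wm 0 = 1 by rewrite /wm /expp y00 y10 !mulr0 cexp0 subr0 mulr1.
have rem := main_remainder mRs mIs iq2 d0 mud pwp pwm wp0 wm0.
pose dp x := wp x - main_p sigma mu x.
pose dm x := wm x - main_m sigma mu x.
have phi_cont (k l : R[i]) : continuous01 (fun x => k * (expp mu x * dp x) + l * (expm mu x * dm x)).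
  have [fp pp] := main_p_prim mu mRs mIs iq2; have [fm pm] := main_m_prim mu mRs mIs iq2.
  exact: cprim_cont (cprimD (cprimZ k (cprimM (cprim_cexp _) (cprimB pwp pp)))
    (cprimZ l (cprimM (cprim_cexp _) (cprimB pwm pm)))).
have phi_bound (k l : R[i]) : cmod k = 2^-1 -> cmod l = 2^-1 ->
    forall x, x \in `[0, 1] -> cmod (k * (expp mu x * dp x) + l * (expm mu x * dm x)) <=
    bound_const d (L2norm sigma) * rho sigma mu.
  move=> k2 l2 x x01; apply: le_trans (remainder_rho sL2 d0 muO).
  have dE : expR d <= expR (2 * d) by rewrite ler_expR ler_peMl ?ler1n// ltW.
  have h1 := le_trans (cmod_expp mud x01) dE.
  have h2 := le_trans (cmod_expm mud x01) dE.
  apply: le_trans (cmodD _ _) _; rewrite (cmodM k) (cmodM l) (cmodM (expp mu x)) (cmodM (expm mu x)) k2 l2.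
  apply: (@le_trans _ _ (expR (2 * d) / 2 * (cmod (dp x) + cmod (dm x)))); last first.
    rewrite ler_pM2l ?divr_gt0 ?expR_gt0//; exact: rem.
  rewrite [leRHS](_ : _ = 2^-1 * (expR (2 * d) * cmod (dp x)) +
    2^-1 * (expR (2 * d) * cmod (dm x))); last by field.
  by apply: lerD; apply: ler_wpM2l => //; apply: ler_wpM2r; rewrite ?cmod_ge0.
have ee x : expp mu x * expm mu x = 1 by exact: epm.
have i2 := @iu2 R.
(* mu y = (ep wp - em wm) / (2 i) and y1 = (ep wp + em wm) / 2; the remainders
   are the same combinations of the errors [dp] and [dm]. *)
exists (fun x => - iu / 2 * (expp mu x * dp x) + iu / 2 * (expm mu x * dm x)),
       (fun x => 2^-1 * (expp mu x * dp x) + 2^-1 * (expm mu x * dm x)).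
(* Both formulas are polynomial identities modulo i^2 + 1. The quotient of the
   difference of the sides by i^2 + 1 is given explicitly below, which leaves
   identities in which i may be treated as a variable. *)
have cofactor (z w r : R[i]) : z - w = (iu ^+ 2 + 1) * r -> z = w.
  by rewrite i2 addNr mul0r => /eqP; rewrite subr_eq0 => /eqP.
split.
- move=> x x01.
  have -> : mu * y x = - iu / 2 * (expp mu x * wp x) + iu / 2 * (expm mu x * wm x).
    transitivity (- iu ^+ 2 * (expp mu x * expm mu x) * (mu * y x)).
      by rewrite i2 ee opprK !mul1r.
    by rewrite /wp /wm; field.
  rewrite int2_cos_sin// int2_cos// int2_sin// int_sin_Nker// (int_cos mu mRs mIs iq2 x01) (int_sin mu mRs mIs iq2 x01).
  rewrite int_cos_sqr// int_sin_sqr// int_sqr int_cos_r// int_sin_r// int_cos_shift//.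
  rewrite ccosE csinE /dp /dm /main_p /main_m iter2C//.
  move: (expp mu x) (expm mu x) (wp x) (wm x) (cI x (coef_a sigma mu)) (cI x (coef_b sigma mu))
    (cI x (coef_c sigma)) (cI x (coef_a2 sigma mu)) (cI x (coef_b2 sigma mu))
    (iter2 (coef_a sigma mu) (coef_b sigma mu) x)
    (iter3 (coef_a sigma mu) (coef_b sigma mu) x)
    (iter3 (coef_b sigma mu) (coef_a sigma mu) x) => e f Wp Wm A B C0 A2 B2 H T T'.
  apply: (cofactor _ _ (- (((1 / 8) * A * B * e * iu) + (- (1 / 8) * A * B * f * iu) + ((1 / 8) * A * B2 * e * mu^-1) + ((1 / 8) * A * B2 * f * mu^-1) + (- (1 / 4) * A * C0 * e * mu^-1) + (- (1 / 16) * A ^+ 2 * e * iu) + ((1 / 16) * A ^+ 2 * f * iu) + ((1 / 8) * A2 * B * e * mu^-1) + ((1 / 8) * A2 * B * f * mu^-1) + (- (1 / 8) * A2 * e * mu^-1) + (- (1 / 8) * A2 * f * mu^-1) + (- (1 / 4) * B * C0 * f * mu^-1) + (- (1 / 16) * B ^+ 2 * e * iu) + ((1 / 16) * B ^+ 2 * f * iu) + (- (1 / 8) * B2 * e * mu^-1) + (- (1 / 8) * B2 * f * mu^-1) + ((1 / 4) * C0 * e * mu^-1) + ((1 / 4) * C0 * f * mu^-1)))).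
  by field.
- move=> x x01.
  have -> : y1 x = 2^-1 * (expp mu x * wp x) + 2^-1 * (expm mu x * wm x).
    transitivity ((expp mu x * expm mu x) * y1 x); first by rewrite ee mul1r.
    by rewrite /wp /wm; field.
  rewrite int2_cos_sin// int2_cos// int2_sin// int_cos_Nker// (int_cos mu mRs mIs iq2 x01) (int_sin mu mRs mIs iq2 x01).
  rewrite int_cos_sqr// int_sin_sqr// int_sqr int_cos_r// int_sin_r// int_sin_shift//.
  rewrite ccosE csinE /dp /dm /main_p /main_m iter2C//.
  move: (expp mu x) (expm mu x) (wp x) (wm x) (cI x (coef_a sigma mu)) (cI x (coef_b sigma mu))
    (cI x (coef_c sigma)) (cI x (coef_a2 sigma mu)) (cI x (coef_b2 sigma mu))
    (iter2 (coef_a sigma mu) (coef_b sigma mu) x)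
    (iter3 (coef_a sigma mu) (coef_b sigma mu) x)
    (iter3 (coef_b sigma mu) (coef_a sigma mu) x) => e f Wp Wm A B C0 A2 B2 H T T'.
  apply: (cofactor _ _ (- (((1 / 8) * A * B * e) + (- (3 / 8) * A * B * f) + (- (1 / 4) * A * e) + ((1 / 4) * A * f) + ((1 / 16) * A ^+ 2 * e) + ((1 / 16) * A ^+ 2 * f) + ((1 / 4) * B * e) + (- (1 / 4) * B * f) + ((1 / 16) * B ^+ 2 * e) + ((1 / 16) * B ^+ 2 * f) + (- (1 / 2) * H * e) + ((1 / 2) * H * f)))).
  by field.
- by split; exact: phi_cont.
- apply: C01_norm_le; apply: phi_bound; rewrite !cmodM ?cmodN cmod_iu cmodV cmod2 mul1r//.
- by apply: C01_norm_le; apply: phi_bound; rewrite cmodV cmod2.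
Qed.
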